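(* Let $(\Omega,\sigma)$ be a continuous global real flow on a compact metric space, $\omega\cdot t:=\sigma(t,\omega)$. Let $H=\begin{bmatrix}H_1 & H_3 \\ H_2 & -H_1^T\end{bmatrix}\colon\Omega\to\mathfrak{sp}(n,\mathbb{R})$ and $\Delta\colon\Omega\to\mathbb{S}_n(\mathbb{R})$ be continuous. For $\lambda\in\mathbb{C}$ let $(F^\lambda)$ denote the family $$\mathbf{z}'=\begin{bmatrix}H_1(\omega\cdot t) & H_3(\omega\cdot t)+\lambda\Delta(\omega\cdot t) \\ H_2(\omega\cdot t) & -H_1^T(\omega\cdot t)\end{bmatrix}\mathbf{z},\qquad\omega\in\Omega.$$ Suppose that $\Delta>0$ on $\Omega$ and that there exists $\lambda_0\in\mathbb{C}$ such that $(F^{\lambda_0})$ has exponential dichotomy. Then: (i) If $\operatorname{Im}\lambda\ne0$, then the family $(F^\lambda)$ has exponential dichotomy. (ii) If $\operatorname{Im}\lambda\ne0$, the Weyl functions $M^\pm(\omega,\lambda)$ of $(F^\lambda)$ globally exist. In addition, the maps $M^\pm\colon\Omega\times(\mathbb{C}-\mathbb{R})\to\mathbb{S}_n(\mathbb{C})$, $(\omega,\lambda)\mapsto M^\pm(\omega,\lambda)$, are jointly continuous, satisfy $\pm\operatorname{Im}\lambda\,\operatorname{Im}M^\pm(\omega,\lambda)\ge0$, and are holomorphic on $\mathbb{C}-\mathbb{R}$ for each fixed $\omega\in\Omega$. In particular, they are Herglotz functions on $\mathbb{C}^+$ and $\mathbb{C}^-$. (iii) Suppose in addition that the following Atkinson-type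 condition does not hold: ''each minimal subset of $\Omega$ contains at least one point $\omega_0$ such that $\int_{-\infty}^\infty\|\Delta(\omega_0\cdot t)\,\mathbf{z}_2(t,\omega_0,\mathbf{z}_0)\|^2\,dt>0$ for all $\mathbf{z}_0\in\mathbb{C}^{2n}-\{\mathbf{0}\}$'', where $\mathbf{z}(t,\omega,\mathbf{z}_0)=\begin{bmatrix}\mathbf{z}_1(t,\omega,\mathbf{z}_0) \\ \mathbf{z}_2(t,\omega,\mathbf{z}_0)\end{bmatrix}$ is the solution of $\mathbf{z}'=H(\omega\cdot t)\mathbf{z}$ with $\mathbf{z}(0,\omega,\mathbf{z}_0)=\mathbf{z}_0$. Then there exists a minimal subset $\mathcal{M}\subseteq\Omega$ such that either $\det M^+(\omega,\lambda)=0$ for all $\omega\in\mathcal{M}$ and all $\lambda\in\mathbb{C}-\mathbb{R}$, or $\det M^-(\omega,\lambda)=0$ for all $\omega\in\mathcal{M}$ and all $\lambda\in\mathbb{C}-\mathbb{R}$.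
   Context: Notation: $\mathbb{S}_n(\mathbb{K})$ is the set of symmetric ($M^T=M$) $n\times n$ matrices over $\mathbb{K}=\mathbb{R}$ or $\mathbb{C}$; for $M\in\mathbb{S}_n(\mathbb{R})$, $M>0$, $M\ge0$ mean positive definite, positive semidefinite, and for matrix-valued functions on $\Omega$ this means at every point. $\operatorname{Im}M$ is the entrywise imaginary part. $\mathbb{C}^\pm=\{\lambda\in\mathbb{C} : \pm\operatorname{Im}\lambda>0\}$. $J=\begin{bmatrix}0_n & -I_n \\ I_n & 0_n\end{bmatrix}$ and $\mathfrak{sp}(n,\mathbb{K})=\{H\in\mathbb{M}_{2n\times2n}(\mathbb{K}) : H^TJ+JH=0\}$ (so that $H_2,H_3$ are symmetric). A subset of $\Omega$ is minimal if it is nonempty, compact, $\sigma$-invariant and contains properly no other nonempty compact $\sigma$-invariant set. For a family $\mathbf{z}'=H(\omega\cdot t)\mathbf{z}$, $\omega\in\Omega$, with continuous $H\colon\Omega\to\mathfrak{sp}(n,\mathbb{K})$, let $U(t,\omega)$ be the fundamental matrix with $U(0,\omega)=I_{2n}$. Exponential dichotomy: there exist $\eta\ge1$, $\beta>0$ and a splitting $\Omega\times\mathbb{K}^{2n}=L^+\oplus L^-$ into the Whitney sum of two closed subbundles, invariant under $(t,\omega,\mathbf{z})\mapsto(\omega\cdot t,U(t,\omega)\mathbf{z})$, with $\|U(t,\omega)\mathbf{z}\|\le\eta e^{-\beta t}\|\mathbf{z}\|$ for $t\ge0$, $(\omega,\mathbf{z})\in L^+$, and $\|U(t,\omega)\mathbf{z}\|\le\eta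 e^{\beta t}\|\mathbf{z}\|$ for $t\le0$, $(\omega,\mathbf{z})\in L^-$. The fibers $l^\pm(\omega)=\{\mathbf{z} : (\omega,\mathbf{z})\in L^\pm\}$ are then Lagrange planes ($n$-dimensional subspaces of $\mathbb{K}^{2n}$ on which $\mathbf{z}^TJ\mathbf{w}=0$). Weyl functions: in the presence of exponential dichotomy, $M^\pm$ globally exists if for every $\omega\in\Omega$ there is a (necessarily symmetric) matrix $M^\pm(\omega)$ such that the columns of $\begin{bmatrix}I_n \\ M^\pm(\omega)\end{bmatrix}$ form a basis of $l^\pm(\omega)$. Herglotz: a symmetric matrix-valued function $M$ on $\mathbb{C}^+$ or $\mathbb{C}^-$ is Herglotz if it is holomorphic and $\operatorname{Im}M(\lambda)$ is either positive semidefinite on the whole half-plane or negative semidefinite on the whole half-plane. *)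

(* Defs.v *)
From HB Require Import structures.
From mathcomp Require Import all_boot all_order all_algebra.
From mathcomp Require Import all_classical all_reals all_analysis.
From mathcomp Require Export complex.

Set Implicit Arguments.
Unset Strict Implicit.
Unset Printing Implicit Defensive.

Import Order.TTheory GRing.Theory Num.Theory.
Import numFieldNormedType.Exports.

Local Open Scope classical_set_scope.
Local Open Scope ring_scope.

(* The modulus topology on R[i], as a normed space over itself.  All matrix
   types over R[i] then carry the library's entrywise topology and norm. *)
HB.instance Definition _ (R : rcfType) := NormedModule.copy R[i] R[i]^o.

Section LinearAlgebra.
Variable R : realType.
Local Notation C := R[i].

Definition toC (m k : nat) (A : 'M[R]_(m, k)) : 'M[C]_(m, k) :=
  map_mx (real_complex R) A.

Definition mxIm (m k : nat) (A : 'M[C]_(m, k)) : 'M[R]_(m, k) :=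
  map_mx (@complex.Im R) A.

Definition enorm (m : nat) (z : 'cV[C]_m) : R :=
  Num.sqrt (\sum_i ((complex.Re (z i 0)) ^+ 2 + (complex.Im (z i 0)) ^+ 2)).

Definition posdef (n : nat) (M : 'M[R]_n) : Prop :=
  M^T = M /\ forall x : 'cV[R]_n, x != 0 -> 0 < (x^T *m M *m x) 0 0.

Definition possemidef (n : nat) (M : 'M[R]_n) : Prop :=
  M^T = M /\ forall x : 'cV[R]_n, 0 <= (x^T *m M *m x) 0 0.

Definition Jmx (n : nat) : 'M[R]_(n + n) := block_mx 0 (- 1%:M) 1%:M 0.

Definition in_sp (n : nat) (H : 'M[R]_(n + n)) : Prop :=
  H^T *m Jmx n + Jmx n *m H = 0.

Definition col_basis (m k : nat) (B : 'M[C]_(m, k)) (V : set 'cV[C]_m) : Prop :=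
  \rank B = k /\ V = [set B *m c | c in [set: 'cV[C]_k]].

End LinearAlgebra.

Section Flow.
Variables (R : realType) (Om : metricType R).
Implicit Type s : R -> Om -> Om.

Definition continuous_flow s : Prop :=
  [/\ continuous (fun p : R * Om => s p.1 p.2),
      forall w, s 0 w = w
    & forall t u w, s (t + u) w = s t (s u w)].

Definition flow_invariant s (M : set Om) : Prop := forall t, s t @` M = M.

Definition minimal_set s (M : set Om) : Prop :=
  [/\ M !=set0, compact M, flow_invariant s M
    & forall K : set Om, K !=set0 -> compact K -> flow_invariant s K ->
        K `<=` M -> K = M].

End Flow.

Section LinearSystems.
Variables (R : realType) (Om : metricType R) (s : R -> Om -> Om).
Local Notation C := R[i].

(* Derivative of a complex matrix-valued function of a real variable. *)
Definition is_tderive (m k : nat) (Z : R -> 'M[C]_(m, k)) (t : R)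
    (D : 'M[C]_(m, k)) : Prop :=
  forall i j,
    is_derive t 1 (fun u : R => complex.Re (Z u i j)) (complex.Re (D i j)) /\
    is_derive t 1 (fun u : R => complex.Im (Z u i j)) (complex.Im (D i j)).

(* Solutions of z' = A(w.t) z on the whole line, for vectors (k = 1) and for
   matrices. *)
Definition solution (m k : nat) (A : Om -> 'M[C]_m) (w : Om)
    (Z : R -> 'M[C]_(m, k)) : Prop :=
  forall t, is_tderive Z t (A (s t w) *m Z t).

Definition fundamental_matrix (m : nat) (A : Om -> 'M[C]_m)
    (U : R -> Om -> 'M[C]_m) : Prop :=
  forall w, U 0 w = 1%:M /\ solution A w (fun t => U t w).

Definition fiber (m : nat) (L : set (Om * 'cV[C]_m)) (w : Om) : set 'cV[C]_m :=
  [set z | L (w, z)].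

(* Closed subset of Om * C^m that is, locally over Om, the span of a continuous
   frame. *)
Definition closed_subbundle (m : nat) (L : set (Om * 'cV[C]_m)) : Prop :=
  closed L /\
  forall w0, exists (k : nat) (O : set Om) (v : Om -> 'M[C]_(m, k)),
    [/\ open O, O w0, {within O, continuous v}
      & forall w, O w -> col_basis (v w) (fiber L w)].

Definition whitney_sum (m : nat) (Lp Lm : set (Om * 'cV[C]_m)) : Prop :=
  forall w, (forall z, exists zp zm,
               [/\ fiber Lp w zp, fiber Lm w zm & z = zp + zm]) /\
            (forall z, fiber Lp w z -> fiber Lm w z -> z = 0).

Definition flow_invariant_bundle (m : nat) (U : R -> Om -> 'M[C]_m)
    (L : set (Om * 'cV[C]_m)) : Prop :=
  forall t w z, L (w, z) -> L (s t w, U t w *m z).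

Definition dichotomy_splitting (m : nat) (A : Om -> 'M[C]_m)
    (Lp Lm : set (Om * 'cV[C]_m)) : Prop :=
  [/\ closed_subbundle Lp, closed_subbundle Lm, whitney_sum Lp Lm
    & exists U, [/\ fundamental_matrix A U,
        flow_invariant_bundle U Lp, flow_invariant_bundle U Lm
      & exists eta beta : R, [/\ 1 <= eta, 0 < beta,
          forall t w z, 0 <= t -> Lp (w, z) ->
            enorm (U t w *m z) <= eta * expR (- beta * t) * enorm z
        & forall t w z, t <= 0 -> Lm (w, z) ->
            enorm (U t w *m z) <= eta * expR (beta * t) * enorm z]]].

Definition exp_dichotomy (m : nat) (A : Om -> 'M[C]_m) : Prop :=
  exists Lp Lm, dichotomy_splitting A Lp Lm.

(* The splitting of a family with exponential dichotomy is unique, so the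
   universal quantifier ranges over the single pair (L^+, L^-). *)
Definition weyl_functions (n : nat) (A : Om -> 'M[C]_(n + n))
    (Mp Mm : Om -> 'M[C]_n) : Prop :=
  exp_dichotomy A /\
  forall Lp Lm, dichotomy_splitting A Lp Lm ->
    forall w, col_basis (col_mx 1%:M (Mp w)) (fiber Lp w) /\
              col_basis (col_mx 1%:M (Mm w)) (fiber Lm w).

Definition hamiltonian_family (n : nat) (H : Om -> 'M[R]_(n + n))
    (Delta : Om -> 'M[R]_n) (l : C) (w : Om) : 'M[C]_(n + n) :=
  let H1 := ulsubmx (H w) in
  let H3 := ursubmx (H w) in
  let H2 := dlsubmx (H w) in
  block_mx (toC H1) (toC H3 + l *: toC (Delta w)) (toC H2) (- (toC H1)^T).

Definition atkinson_condition (n : nat) (H : Om -> 'M[R]_(n + n))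
    (Delta : Om -> 'M[R]_n) : Prop :=
  forall M, minimal_set s M -> exists2 w0, M w0 &
    forall z0 : 'cV[C]_(n + n), z0 != 0 ->
    forall z : R -> 'cV[C]_(n + n),
      solution (fun w => toC (H w)) w0 z -> z 0 = z0 ->
      (0 < \int[lebesgue_measure]_t
             ((enorm (toC (Delta (s t w0)) *m dsubmx (z t))) ^+ 2)%:E)%E.

End LinearSystems.

Section Herglotz.
Variable R : realType.
Local Notation C := R[i].

Definition nonreal : set C := [set l | complex.Im l != 0].
Definition Cplus : set C := [set l | 0 < complex.Im l].
Definition Cminus : set C := [set l | complex.Im l < 0].

Definition holomorphic_on (n : nat) (D : set C) (M : C -> 'M[C]_n) : Prop :=
  forall l, D l -> derivable M l 1.

Definition herglotz (n : nat) (D : set C) (M : C -> 'M[C]_n) : Prop :=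
  [/\ forall l, D l -> (M l)^T = M l, holomorphic_on D M
    & (forall l, D l -> possemidef (mxIm (M l))) \/
      (forall l, D l -> possemidef (- mxIm (M l)))].

End Herglotz.

(* Main.v *)
(* The form Q(z) = Im (z^* J z) satisfies Q' = 2 Im l z2^* Delta z2 along the
   solutions of (F^l), so sg(Im l) Q is nondecreasing, and its increase over a
   time step T controls both the component z2 and the distance to the solution
   of (F^l0) with the same initial value. Let P+ and P- be the projections of
   the dichotomy at l0. For T large, |P- z|^2 - |P+ z|^2 grows under (F^l0);
   adding K sg(Im l) Q with K large absorbs the perturbation and gives a strict
   discrete Lyapunov function for every nonreal l at once. Hence solutions
   starting at time 0 in the graph of M and ending at time kT in the plane
   z2 = i sg(Im l) z1 decay geometrically, uniformly in k, and these matrices M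
   converge to M^+(w, l), whose graph consists of the decaying solutions. The
   estimates are uniform, whence joint continuity; (Z_l^T J Z_m)' =
   (m - l) Z_l2^T Delta Z_m2 computes the difference quotients of M^+ in l,
   whence holomorphy. Time reversal yields M^-.

   If the Atkinson condition fails, some nonzero solution over a point of a
   minimal set has z2 = 0, hence solves (F^l) for every l. If it decays at +oo,
   then det M^+ = 0 along the whole orbit; otherwise it is attracted by the
   graph of M^- and det M^- tends to 0 along the orbit. Minimality spreads the
   vanishing to the whole set. *)
Require Import Defs.
From mathcomp Require Import all_boot all_order all_algebra.
From mathcomp Require Import all_classical all_reals all_analysis.
From mathcomp Require Import measurable_realfun ring lra.

Set Implicit Arguments.
Unset Strict Implicit.
Unset Printing Implicit Defensive.

Import Order.TTheory GRing.Theory Num.Theory.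
Import numFieldNormedType.Exports.

Local Open Scope classical_set_scope.
Local Open Scope ring_scope.

(** * Real differential equations *)

(** The obstacle is that the derivative of the monotone form sees only z2. Positivity of [Delta] on
    the compact base makes it dominate |z2|^2 uniformly, and the equation of z2 turns this time
    integral into a bound at the single time 0; this is what confines initial values with
    nonpositive form at time T to graphs over z1 of bounded slope. The argument is discrete because
    the dichotomy at l0 comes with an arbitrary factor eta: one long step beats it and leaves room
    (8 and 1/8) for the factors 2 lost whenever the squared norm of a sum is split. On the terminal
    plane the form is minus the squared norm, so the Lyapunov function with large K is nonpositive
    there, and nonpositivity propagates backwards in time. Planes of decaying solutions are handled
    through matrices: [M] is characterised by the equivalence of decay with z2(0) = M z1(0), which
    gives symmetry, invariance and the comparison with an arbitrary splitting. Constants are uniform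
    for |Im l| bounded below and |l| bounded above, because continuity and holomorphy need them near
    each nonreal l. *)

Lemma cvg_big_sum (K : numFieldType) (T : Type) (F : set_system T) (I : Type)
    (r : seq I) (P : pred I) (f : I -> T -> K) (l : I -> K) : Filter F ->
  (forall i, P i -> f i x @[x --> F] --> l i) ->
  (\sum_(i <- r | P i) f i x) @[x --> F] --> \sum_(i <- r | P i) l i.
Proof.
move=> FF H; elim: r => [|i r IH].
  by rewrite big_nil; under eq_fun do rewrite big_nil; exact: cvg_cst.
rewrite big_cons; under eq_fun do rewrite big_cons.
by case: ifPn => Pi //; apply: cvgD => //; exact: H.
Qed.

Section RealCalculus.
Variable R : realType.
Implicit Types (f g : R -> R) (a b t : R).

Lemma rderivD f g t a b : is_derive t 1 f a -> is_derive t 1 g b ->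
  is_derive t 1 (fun u => f u + g u) (a + b).
Proof. by move=> fa gb; exact: is_deriveD. Qed.

Lemma rderivN f t a : is_derive t 1 f a -> is_derive t 1 (fun u => - f u) (- a).
Proof. by move=> fa; exact: is_deriveN. Qed.

Lemma rderivB f g t a b : is_derive t 1 f a -> is_derive t 1 g b ->
  is_derive t 1 (fun u => f u - g u) (a - b).
Proof. by move=> fa gb; exact: is_deriveB. Qed.

Lemma rderivM f g t a b : is_derive t 1 f a -> is_derive t 1 g b ->
  is_derive t 1 (fun u => f u * g u) (a * g t + f t * b).
Proof.
move=> fa gb; have := is_deriveM fa gb.
by rewrite /GRing.scale /= addrC [g t * a]mulrC.
Qed.

Lemma rderiv_cst a t : is_derive t 1 (fun _ : R => a) 0.
Proof. exact: is_derive_cst. Qed.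

Lemma rderivZ (k : R) f t a : is_derive t 1 f a ->
  is_derive t 1 (fun u => k * f u) (k * a).
Proof.
move=> fa; have := rderivM (rderiv_cst k t) fa.
by rewrite mul0r add0r.
Qed.

Lemma rderiv_sum (I : Type) (r : seq I) (P : pred I) (F : I -> R -> R)
    (d : I -> R) t :
  (forall i, P i -> is_derive t 1 (F i) (d i)) ->
  is_derive t 1 (fun u => \sum_(i <- r | P i) F i u) (\sum_(i <- r | P i) d i).
Proof.
move=> H; elim: r => [|i r IH].
  rewrite big_nil; have := rderiv_cst 0 t; apply: near_eq_is_derive.
  by near=> u; rewrite big_nil.
rewrite big_cons; case: ifPn => Pi; last first.
  by move: IH; apply: near_eq_is_derive; near=> u; rewrite big_cons (negbTE Pi).
have := rderivD (H i Pi) IH; apply: near_eq_is_derive.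
by near=> u; rewrite big_cons Pi.
Unshelve. all: by end_near. Qed.

Lemma rderiv_comp f g t a b : is_derive t 1 g b -> is_derive (g t) 1 f a ->
  is_derive t 1 (fun u => f (g u)) (b * a).
Proof. by move=> gb fa; rewrite mulrC; exact: is_derive1_comp. Qed.

Lemma rderiv_shift f (c t a : R) : is_derive (t + c) 1 f a ->
  is_derive t 1 (fun u => f (u + c)) a.
Proof.
move=> fa; have h : is_derive t 1 (fun u : R => u + c) 1.
  apply: (is_derive_eq (rderivD (is_derive_id t 1) (rderiv_cst c t))).
  exact: addr0.
by have := rderiv_comp h fa; rewrite mul1r.
Qed.

Lemma rderiv_opp f t a : is_derive (- t) 1 f a ->
  is_derive t 1 (fun u => f (- u)) (- a).
Proof.
move=> fa; have h : is_derive t 1 (fun u : R => - u) (- 1).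
  by apply: rderivN; exact: is_derive_id.
by have := rderiv_comp h fa; rewrite mulN1r.
Qed.

Lemma rderiv_expM (k t : R) :
  is_derive t 1 (fun u => expR (k * u)) (k * expR (k * t)).
Proof.
have h : is_derive t 1 (fun u : R => k * u) k.
  by have := @rderivZ k id t 1 (is_derive_id _ _); rewrite mulr1.
exact: rderiv_comp h (is_derive_expR _).
Qed.

Lemma rderiv_continuous f t a : is_derive t 1 f a -> {for t, continuous f}.
Proof.
by case=> fd _; apply: differentiable_continuous; exact/derivable1_diffP.
Qed.

Lemma deriv_ge0_le f (df : R -> R) a b : a <= b ->
  (forall t, a <= t <= b -> is_derive t 1 f (df t)) ->
  (forall t, a <= t <= b -> 0 <= df t) -> f a <= f b.
Proof.
move=> ab fd df0.
have [||c] := @MVT_segment R f df a b ab.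
- by move=> x; rewrite in_itv /= => /andP[ax xb]; apply: fd; rewrite !ltW.
- apply: continuous_in_subspaceT => x; rewrite inE /= in_itv /= => /fd.
  exact: rderiv_continuous.
rewrite in_itv /= => cab e; rewrite -subr_ge0 e.
by rewrite mulr_ge0 ?df0 // subr_ge0.
Qed.

Lemma deriv_le_le f g (df dg : R -> R) a b : a <= b ->
  (forall t, a <= t <= b -> is_derive t 1 f (df t)) ->
  (forall t, a <= t <= b -> is_derive t 1 g (dg t)) ->
  (forall t, a <= t <= b -> df t <= dg t) -> f b - f a <= g b - g a.
Proof.
move=> ab hf hg h.
suff : g a - f a <= g b - f b by lra.
apply: (@deriv_ge0_le (fun u => g u - f u) (fun u => dg u - df u)) => // t ht.
  exact: rderivB (hg t ht) (hf t ht).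
by rewrite subr_ge0 h.
Qed.

(** The increment of [q] plays the part of the integral of the forcing. The function
    [expR (- L * u) * f u - c * q u] is nonincreasing, because the weight is at most 1 on the
    forcing term. *)
Lemma gronwall f q (df dq : R -> R) (L c t : R) : 0 <= L -> 0 <= c -> 0 <= t ->
  (forall u, 0 <= u <= t -> is_derive u 1 f (df u)) ->
  (forall u, 0 <= u <= t -> is_derive u 1 q (dq u)) ->
  (forall u, 0 <= u <= t -> 0 <= dq u) ->
  (forall u, 0 <= u <= t -> df u <= L * f u + c * dq u) ->
  f t <= expR (L * t) * (f 0 + c * (q t - q 0)).
Proof.
move=> L0 c0 t0 hf hq q0 h.
pose phi u := expR (- L * u) * f u.
pose dphi u := (- L * expR (- L * u)) * f u + expR (- L * u) * df u.
have hphi u : 0 <= u <= t -> is_derive u 1 phi (dphi u).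
  by move=> ut; apply: rderivM (rderiv_expM _ _) (hf _ ut).
have hcq u : 0 <= u <= t -> is_derive u 1 (fun u => c * q u) (c * dq u).
  by move=> ut; apply: rderivZ; exact: hq.
have := deriv_le_le t0 hphi hcq.
have -> : phi 0 = f 0 by rewrite /phi mulr0 expR0 mul1r.
have H u : 0 <= u <= t -> dphi u <= c * dq u.
  move=> ut; have -> : dphi u = expR (- L * u) * (df u - L * f u).
    by rewrite /dphi; ring.
  apply: (@le_trans _ _ (expR (- L * u) * (c * dq u))).
    by rewrite ler_wpM2l ?expR_ge0 // lerBlDl h.
  rewrite ler_piMl // ?mulr_ge0 ?q0 //.
  by rewrite -expR0 ler_expR mulNr oppr_le0 mulr_ge0 //; case/andP: ut.
move=> /(_ H) hh.
have -> : f t = expR (L * t) * phi t.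
  by rewrite /phi mulrA -expRD mulNr subrr expR0 mul1r.
by rewrite ler_wpM2l ?expR_ge0 //; lra.
Qed.

End RealCalculus.

(** * Primitives, limits with a rate, and Picard iteration for real linear systems *)

Section Picard.
Variable R : realType.
Implicit Types (f g : R -> R) (a b t : R).

Lemma deriv_eq_sub f g (d : R -> R) a b : a <= b ->
  (forall t, a <= t <= b -> is_derive t 1 f (d t)) ->
  (forall t, a <= t <= b -> is_derive t 1 g (d t)) -> f b - f a = g b - g a.
Proof.
by move=> ab hf hg; apply/eqP; rewrite eq_le; apply/andP; split;
  apply: deriv_le_le ab _ _ _ => // t _.
Qed.

Lemma primitive_exists f : continuous f ->
  exists F : R -> R, F 0 = 0 /\ forall t, is_derive t 1 F (f t).
Proof.
move=> cf.
pose G (N x : R) := (\int[lebesgue_measure]_(t in `[(- N)%R, x]) (f t))%R.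
have dG (N x : R) : - N < x -> is_derive x 1 (G N) (f x).
  move=> Nx.
  have [||d1 d2] := @continuous_FTC1_closed R f (- N) x (x + 1) _ _ Nx (cf x).
  - by rewrite ltrDl.
  - apply: continuous_compact_integrable; first exact: segment_compact.
    exact: continuous_subspaceT.
  - by rewrite derive1E in d2; rewrite -d2; exact: derivableP.
have GG (N N' u : R) : 0 < N -> N <= N' -> - N < u ->
    G N' u - G N' 0 = G N u - G N 0.
  move=> N0 NN' Nu; have [u0|u0] := leP 0 u.
    by apply: (deriv_eq_sub (d := f)) => // t /andP[t0 tu]; apply: dG; lra.
  suff : G N' 0 - G N' u = G N 0 - G N u by lra.
  by apply: (deriv_eq_sub (d := f)); first exact: ltW;
    move=> t /andP[t0 tu]; apply: dG; lra.
(* The lower end of integration moves with [x] to keep [x] in the interior; subtracting the value at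
   0 removes the dependence on it, by [GG]. *)
exists (fun x => G (`|x| + 1) x - G (`|x| + 1) 0); split; first by rewrite subrr.
move=> t.
have H : is_derive t 1 (fun u => G (`|t| + 2) u - G (`|t| + 2) 0) (f t).
  have tt : - `|t| <= t by rewrite lerNl -normrN ler_norm.
  have dt : is_derive t 1 (G (`|t| + 2)) (f t) by apply: dG; lra.
  by have := rderivB dt (rderiv_cst (G (`|t| + 2) 0) t); rewrite subr0.
apply: near_eq_is_derive H; near=> u.
have ut : `|u| < `|t| + 1.
  near: u; have := @norm_continuous _ R t; rewrite /continuous_at => /cvgr_dist_lt.
  move=> /(_ 1 ltr01); apply: filterS => u h.
  have := ler_norm (`|u| - `|t|); rewrite distrC; lra.
have uu : - `|u| <= u by rewrite lerNl -normrN ler_norm.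
have u0 := normr_ge0 u.
by rewrite (GG (`|u| + 1)) //; lra.
Unshelve. all: by end_near. Qed.

(* Picard bound: the exponential weight makes every integration gain a
   constant factor, so no factorials are needed. *)
Lemma deriv_exp_bound f (df : R -> R) (L c : R) : 0 <= c -> 0 <= L -> f 0 = 0 ->
  (forall t, is_derive t 1 f (df t)) ->
  (forall t, `|df t| <= L * c * expR (L * `|t|)) ->
  forall t, `|f t| <= c * expR (L * `|t|).
Proof.
move=> c0 L0 f0 hf h.
have pos g (dg : R -> R) (t : R) : 0 <= t -> g 0 = 0 ->
    (forall u : R, 0 <= u <= t -> is_derive u 1 g (dg u)) ->
    (forall u : R, 0 <= u <= t -> dg u <= L * c * expR (L * u)) ->
    g t <= c * expR (L * t).
  move=> t0 g0 hg k.
  have hE (u : R) : is_derive u 1 (fun u => c * expR (L * u)) (L * c * expR (L * u)).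
    rewrite -mulrA mulrCA; apply: rderivZ; exact: rderiv_expM.
  have := deriv_le_le t0 hg (fun u _ => hE u) k.
  rewrite g0 mulr0 expR0; lra.
have posn g (dg : R -> R) (t : R) : 0 <= t -> g 0 = 0 ->
    (forall u : R, is_derive u 1 g (dg u)) ->
    (forall u : R, 0 <= u <= t -> `|dg u| <= L * c * expR (L * u)) ->
    `|g t| <= c * expR (L * t).
  move=> t0 g0 hg k; rewrite ler_norml; apply/andP; split.
    rewrite lerNl; apply: (pos (fun u => - g u) (fun u => - dg u)) => //.
    - by rewrite g0 oppr0.
    - by move=> u /k; apply: le_trans; rewrite -normrN ler_norm.
  apply: (pos g dg) => // u /k; apply: le_trans; exact: ler_norm.
move=> t; have [t0|t0] := leP 0 t.
  rewrite (ger0_norm t0); apply: posn hf _ => // u /andP[u0 _].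
  by rewrite -{2}(ger0_norm u0).
rewrite (ltr0_norm t0) -{1}[t]opprK.
apply: (posn (fun u => f (- u)) (fun u => - df (- u))) => //.
- by rewrite oppr_ge0 ltW.
- by rewrite oppr0.
- by move=> u; exact: (rderiv_opp (hf (- u))).
- by move=> u /andP[u0 _]; rewrite normrN -{2}(ger0_norm u0) -[`|u|]normrN.
Qed.

Lemma geometric_small (b th e : R) : 0 <= th < 1 -> 0 < e ->
  exists k0, forall k, (k0 <= k)%N -> b * th ^+ k < e.
Proof.
move=> /andP[th0 th1] e0.
have /(cvg_geometric b)/cvgrPdist_lt/(_ e e0) : `|th| < 1 by rewrite ger0_norm.
case=> k0 _ h; exists k0 => k kk; have := h k kk; rewrite /geometric /= sub0r normrN.
by apply: le_lt_trans; exact: ler_norm.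
Qed.

Lemma le0_geometric (a b th : R) : 0 <= th < 1 ->
  (forall k, a <= b * th ^+ k) -> a <= 0.
Proof.
move=> th01 h; rewrite leNgt; apply/negP => a0.
have [k0 /(_ k0 (leqnn _))] := geometric_small b th01 a0.
by rewrite ltNge h.
Qed.

(** The intervals with centre [u k] and radius [r k] meet pairwise, so the supremum of their lower
    ends lies in all of them. *)
Lemma cauchy_rate_lim (u r : nat -> R) :
  (forall k l, (k <= l)%N -> `|u k - u l| <= r k) ->
  exists l, forall k, `|u k - l| <= r k.
Proof.
move=> h.
have r0 k : 0 <= r k by apply: le_trans (h k k (leqnn _)).
have cross k m : u k - r k <= u m + r m.
  have [km|/ltnW mk] := leqP k m.
    have := le_trans (ler_norm _) (h _ _ km); have := r0 m; lra.
  by have := le_trans (ler_norm _) (h _ _ mk); rewrite -opprB; have := r0 k;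
    move: (h _ _ mk); rewrite ler_norml => /andP[]; lra.
pose E := [set x | exists k, x = u k - r k].
have E0 : E !=set0 by exists (u 0%N - r 0%N), 0%N.
exists (sup E) => k; rewrite ler_norml; apply/andP; split.
  have : sup E <= u k + r k by apply: ge_sup => // _ [m ->].
  lra.
have : u k - r k <= sup E.
  apply: (@sup_upper_bound _ E); last by exists k.
  by split=> //; exists (u 0%N + r 0%N) => _ [m ->].
lra.
Qed.

Lemma half_cauchy (u : nat -> R) (D : R) :
  (forall k, `|u k.+1 - u k| <= D * 2^-1 ^+ k) ->
  forall k l, (k <= l)%N -> `|u k - u l| <= 2 * D * 2^-1 ^+ k.
Proof.
move=> h k l kl.
have D0 : 0 <= D by have := le_trans (normr_ge0 _) (h 0%N); rewrite expr0 mulr1.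
(* The subtracted term strengthens the induction on [m]: it halves at each step and thereby frees
   exactly the [D * 2^-1 ^+ (k + m)] that the step costs. *)
suff H m : `|u k - u (k + m)%N| <= 2 * D * 2^-1 ^+ k - 2 * D * 2^-1 ^+ (k + m).
  rewrite -(subnKC kl); apply: le_trans (H _) _.
  by rewrite lerBlDr lerDl mulr_ge0 ?exprn_ge0 ?mulr_ge0 // invr_ge0.
elim: m => [|m IH]; first by rewrite addn0 !subrr normr0.
rewrite addnS; have := h (k + m)%N; rewrite distrC exprS => h1.
apply: le_trans (ler_distD (u (k + m)%N) _ _) _.
set X := 2^-1 ^+ (k + m) in IH h1 *; lra.
Qed.

(** The exponent [L] is twice the Lipschitz constant [cI] of the right-hand side, so each iteration
    halves the distance in the norm weighted by [expR (L * |t|)], and the iterates converge on the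
    whole line at once. *)
Lemma picard (I : finType) (a : I -> I -> R -> R) (c : R) (x0 : I -> R) :
  (forall i j, continuous (a i j)) -> (forall i j t, `|a i j t| <= c) ->
  exists x : I -> R -> R, (forall i, x i 0 = x0 i) /\
    forall i t, is_derive t 1 (x i) (\sum_j a i j t * x j t).
Proof.
move=> ca ac.
have [P hP] : {P : (R -> R) -> R -> R & forall f, continuous f ->
    P f 0 = 0 /\ forall t, is_derive t 1 (P f) (f t)}.
  apply: (@choice _ _ (fun f F : R -> R => continuous f ->
    F 0 = 0 /\ forall t, is_derive t 1 F (f t))) => f.
  have [cf|ncf] := pselect (continuous f).
    by have [F hF] := primitive_exists cf; exists F.
  (* An arbitrary value for discontinuous functions, so that [P] is a total operator that can be
     iterated. *)
  by exists f => cf.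
pose rhs (x : I -> R -> R) i t := \sum_j a i j t * x j t.
have crhs x : (forall i, continuous (x i)) -> forall i, continuous (rhs x i).
  move=> cx i t; apply: cvg_big_sum => j _.
  by apply: cvgM; [exact: ca | exact: cx].
pose step (x : I -> R -> R) i t := x0 i + P (rhs x i) t.
have dstep x : (forall i, continuous (x i)) ->
    forall i t, is_derive t 1 (step x i) (rhs x i t).
  move=> cx i t; have [_ h] := hP _ (crhs _ cx i).
  by have := rderivD (rderiv_cst (x0 i) t) (h t); rewrite add0r.
have cstep x : (forall i, continuous (x i)) -> forall i, continuous (step x i).
  by move=> cx i t; apply: rderiv_continuous (dstep _ cx i t).
have step0 x : (forall i, continuous (x i)) -> forall i, step x i 0 = x0 i.
  by move=> cx i; rewrite /step (hP _ (crhs _ cx i)).1 addr0.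
pose X k := iter k step (fun i _ => x0 i).
have cX k i : continuous (X k i).
  elim: k i => [|k IH] i; first by move=> t; exact: cvg_cst.
  exact: cstep IH i.
pose B := \sum_i `|x0 i|.
have B0 : 0 <= B by apply: sumr_ge0 => i _.
have xB i : `|x0 i| <= B.
  by rewrite /B (bigD1 i) //= lerDl sumr_ge0.
pose cI : R := #|I|%:R * `|c|; pose L := 2 * cI.
have cI0 : 0 <= cI by rewrite mulr_ge0.
have L0 : 0 <= L by rewrite mulr_ge0.
have rhs_bound (x : I -> R -> R) (b t : R) : (forall j, `|x j t| <= b) ->
    forall i, `|rhs x i t| <= cI * b.
  move=> xb i; apply: le_trans (ler_norm_sum _ _ _) _.
  rewrite /cI -mulrA mulr_natl -sumr_const; apply: ler_sum => j _.
  rewrite normrM ler_pM //; apply: le_trans (ac i j t) (ler_norm _).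
have rhsB x y i t : rhs x i t - rhs y i t = rhs (fun j u => x j u - y j u) i t.
  by rewrite /rhs -sumrB; apply: eq_bigr => j _; rewrite mulrBr.
have E1 (t : R) : 1 <= expR (L * `|t|).
  by rewrite -expR0 ler_expR mulr_ge0.
have dX k i t : `|X k.+1 i t - X k i t| <= B * 2^-1 ^+ k * expR (L * `|t|).
  elim: k i t => [|k IH] i t.
    rewrite expr0 mulr1.
    apply: (@deriv_exp_bound (fun t => X 1%N i t - X 0%N i t)
        (fun t => rhs (X 0%N) i t)) => //.
    - by rewrite /= step0 ?subrr //; exact: (cX 0%N).
    - move=> u; have := rderivB (dstep _ (cX 0%N) i u) (rderiv_cst (x0 i) u).
      by rewrite subr0.
    - move=> u; apply: le_trans (@rhs_bound _ B u _ i) _; first exact: xB.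
      have E0 : 0 <= expR (L * `|u|) - 1 by rewrite subr_ge0.
      have := mulr_ge0 cI0 B0; have := mulr_ge0 (mulr_ge0 cI0 B0) E0.
      move: (expR _) => E; rewrite /L; nra.
  apply: (@deriv_exp_bound (fun t => X k.+2 i t - X k.+1 i t)
      (fun t => rhs (X k.+1) i t - rhs (X k) i t)) => //.
  - by rewrite mulr_ge0 // exprn_ge0.
  - by rewrite /= -/(X k.+1) -/(X k) (step0 _ (cX k.+1)) (step0 _ (cX k)) subrr.
  - by move=> u; exact: (rderivB (dstep _ (cX k.+1) i u) (dstep _ (cX k) i u)).
  - move=> u; rewrite rhsB; apply: le_trans (rhs_bound _ _ _ (IH^~ u) i) _.
    rewrite /L exprS le_eqVlt; apply/orP; left; apply/eqP.
    by move: (expR _) (2^-1 ^+ k) => E p; field.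
have XC i t k l : (k <= l)%N ->
    `|X k i t - X l i t| <= 2 * (B * expR (L * `|t|)) * 2^-1 ^+ k.
  apply: (half_cauchy (u := fun k => X k i t)) => m.
  by have := dX m i t; rewrite mulrAC.
have [x hx] : {x : I -> R -> R & forall i t k,
    `|X k i t - x i t| <= 2 * (B * expR (L * `|t|)) * 2^-1 ^+ k}.
  have /choice [x hx] : forall p : I * R, exists l, forall k,
      `|X k p.1 p.2 - l| <= 2 * (B * expR (L * `|p.2|)) * 2^-1 ^+ k.
    by move=> [i t]; apply: (cauchy_rate_lim (u := fun k => X k i t)) (XC i t).
  by exists (fun i t => x (i, t)) => i t; exact: hx (i, t).
have half01 : 0 <= (2^-1 : R) < 1 by lra.
have cx i : continuous (x i).
  move=> t; apply/cvgrPdist_lt => e e0.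
  pose E := 2 * (B * expR (L * (`|t| + 1))).
  have e3 : 0 < e / 3 by lra.
  have [k hk] := geometric_small E half01 e3; have {}hk := hk k (leqnn _).
  have bnd (u : R) : `|u| <= `|t| + 1 -> `|X k i u - x i u| < e / 3.
    move=> ut; apply: le_lt_trans (hx i u k) (le_lt_trans _ hk).
    rewrite ler_wpM2r ?exprn_ge0 // ler_wpM2l // ler_wpM2l // ler_expR.
    by rewrite ler_wpM2l.
  near=> u.
  have ut : `|u| <= `|t| + 1.
    have : `|t - u| < 1.
      by near: u; have /cvgrPdist_lt := @cvg_id _ (nbhs t); apply.
    have := ler_norm (`|u| - `|t|); have := ler_dist_dist u t.
    rewrite (distrC u t) => h1 h2 h3; lra.
  have tt : `|t| <= `|t| + 1 by lra.
  have h1 := bnd t tt; have h2 := bnd u ut.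
  have h3 : `|X k i t - X k i u| < e / 3.
    by near: u; have /cvgrPdist_lt := cX k i t; apply.
  rewrite distrC in h1.
  have -> : x i t - x i u = (x i t - X k i t) + (X k i t - X k i u) + (X k i u - x i u).
    ring.
  apply: le_lt_trans (ler_normD _ _) _.
  have := ler_normD (x i t - X k i t) (X k i t - X k i u); lra.
(* Derivatives are not passed to the limit: [x] coincides with [step x], which is differentiable by
   construction. *)
have xfix i t : x i t = step x i t.
  apply/eqP; rewrite -subr_eq0 -normr_le0; apply/eqP.
  apply/eqP; apply: (@le0_geometric _ (2 * (B * expR (L * `|t|))) 2^-1) => // k.
  have h1 : `|step x i t - X k.+1 i t| <= B * 2^-1 ^+ k * expR (L * `|t|).
    apply: (@deriv_exp_bound (fun t => step x i t - X k.+1 i t)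
      (fun t => rhs x i t - rhs (X k) i t)) => //.
    - by rewrite mulr_ge0 // exprn_ge0.
    - by rewrite (step0 _ cx) [X in _ - X](step0 _ (cX k) i) subrr.
    - by move=> u; exact: (rderivB (dstep _ cx i u) (dstep _ (cX k) i u)).
    - move=> u; rewrite rhsB.
      have h j : `|x j u - X k j u| <= 2 * (B * expR (L * `|u|)) * 2^-1 ^+ k.
        by rewrite distrC.
      apply: le_trans (rhs_bound _ _ _ h i) _.
      rewrite /L le_eqVlt; apply/orP; left; apply/eqP; ring.
  have h2 := hx i t k.+1; rewrite exprS in h2.
  have := ler_distD (X k.+1 i t) (x i t) (step x i t).
  rewrite distrC in h1; rewrite distrC in h2.
  set p := 2^-1 ^+ k in h1 h2 *; set q := expR _ in h1 h2 *; lra.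
exists x; split=> [i|i t]; first by rewrite xfix step0.
have := dstep _ cx i t; apply: near_eq_is_derive.
by near=> u; rewrite -xfix.
Unshelve. all: by end_near. Qed.

End Picard.

(** * Complex linear differential equations *)

Section ComplexNumbers.
Variable R : realType.
Local Notation C := R[i].
Local Notation Re := (@complex.Re R).
Local Notation Im := (@complex.Im R).
Implicit Types (x y z : C) (e : R).

Lemma cReD x y : Re (x + y) = Re x + Re y. Proof. by case: x; case: y. Qed.
Lemma cImD x y : Im (x + y) = Im x + Im y. Proof. by case: x; case: y. Qed.
Lemma cReN x : Re (- x) = - Re x. Proof. by case: x. Qed.
Lemma cImN x : Im (- x) = - Im x. Proof. by case: x. Qed.
Lemma cReB x y : Re (x - y) = Re x - Re y. Proof. by rewrite cReD cReN. Qed.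
Lemma cImB x y : Im (x - y) = Im x - Im y. Proof. by rewrite cImD cImN. Qed.
Lemma cReM x y : Re (x * y) = Re x * Re y - Im x * Im y.
Proof. by case: x; case: y. Qed.
Lemma cImM x y : Im (x * y) = Re x * Im y + Im x * Re y.
Proof. by case: x => a b; case: y => c d /=; rewrite [b * c]mulrC addrC addrC [c * b]mulrC. Qed.

Lemma cRe_sum (I : Type) (r : seq I) (P : pred I) (F : I -> C) :
  Re (\sum_(i <- r | P i) F i) = \sum_(i <- r | P i) Re (F i).
Proof. by apply: (big_morph Re cReD). Qed.

Lemma cIm_sum (I : Type) (r : seq I) (P : pred I) (F : I -> C) :
  Im (\sum_(i <- r | P i) F i) = \sum_(i <- r | P i) Im (F i).
Proof. by apply: (big_morph Im cImD). Qed.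

Lemma complex_eqP x y : Re x = Re y -> Im x = Im y -> x = y.
Proof. by case: x; case: y => a b c d /= -> ->. Qed.

(** The norm of [R[i]] takes values in [R[i]]; squared moduli with values in [R] reduce all
    estimates to polynomial inequalities over the reals. *)
Definition nsq x : R := Re x ^+ 2 + Im x ^+ 2.

Lemma nsq_ge0 x : 0 <= nsq x.
Proof. by rewrite addr_ge0 // sqr_ge0. Qed.

Lemma nsq0 : nsq 0 = 0. Proof. by rewrite /nsq /= expr0n addr0. Qed.

Lemma nsq_eq0 x : nsq x = 0 -> x = 0.
Proof.
move/eqP; rewrite paddr_eq0 ?sqr_ge0 // !sqrf_eq0 => /andP[/eqP a /eqP b].
exact: complex_eqP.
Qed.

Lemma nsqM x y : nsq (x * y) = nsq x * nsq y.
Proof. by rewrite /nsq cReM cImM; ring. Qed.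

Lemma nsqN x : nsq (- x) = nsq x.
Proof. by rewrite /nsq cReN cImN !sqrrN. Qed.

Lemma nsqB x y : nsq (x - y) = nsq (y - x).
Proof. by rewrite -nsqN opprB. Qed.

Lemma nsqD x y : nsq (x + y) <= 2 * nsq x + 2 * nsq y.
Proof.
rewrite /nsq cReD cImD.
have := sqr_ge0 (Re x - Re y); have := sqr_ge0 (Im x - Im y); lra.
Qed.

(** Sum [2 * f i * f j <= f i ^+ 2 + f j ^+ 2] over all pairs. *)
Lemma sum_sqr_le (I : finType) (f : I -> R) :
  (\sum_i f i) ^+ 2 <= #|I|%:R * \sum_i (f i) ^+ 2.
Proof.
rewrite expr2 mulr_suml.
apply: (@le_trans _ _ (\sum_i \sum_j (2^-1 * (f i ^+ 2) + 2^-1 * f j ^+ 2))).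
  apply: ler_sum => i _; rewrite mulr_sumr; apply: ler_sum => j _.
  by have := sqr_ge0 (f i - f j); lra.
set S := \sum_i f i ^+ 2; set k : R := #|I|%:R.
have in1 i : \sum_j (2^-1 * f i ^+ 2 + 2^-1 * f j ^+ 2) = k * 2^-1 * f i ^+ 2 + 2^-1 * S.
  by rewrite big_split /= sumr_const -mulr_sumr -mulrA mulr_natl.
rewrite (eq_bigr _ (fun i _ => in1 i)) big_split /= -mulr_sumr sumr_const -/S.
rewrite -[_ *+ #|_|]mulr_natl -/k le_eqVlt; apply/orP; left; apply/eqP.
by field.
Qed.

Lemma nsq_sum (I : finType) (f : I -> C) :
  nsq (\sum_i f i) <= #|I|%:R * \sum_i nsq (f i).
Proof.
rewrite /nsq cRe_sum cIm_sum big_split /= mulrDr.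
by rewrite lerD // sum_sqr_le.
Qed.

Lemma norm_lt_nsq x e : 0 < e -> (`|x| < e%:C%C) = (nsq x < e ^+ 2).
Proof.
move=> e0; rewrite normc_def ltcR -/(nsq x).
by rewrite -[in LHS](ger0_norm (ltW e0)) -sqrtr_sqr ltr_sqrt // exprn_gt0.
Qed.

Lemma cvgC_nsqP (T : Type) (F : set_system T) (f : T -> C) (l : C) : Filter F ->
  (f x @[x --> F] --> l) <->
  (forall e, 0 < e -> \forall x \near F, nsq (f x - l) < e).
Proof.
move=> FF; split.
  move=> /cvgrPdist_lt h e e0.
  have s0 : 0 < Num.sqrt e by rewrite sqrtr_gt0.
  have : (0 : C) < (Num.sqrt e)%:C%C by rewrite ltcR.
  move=> /h; apply: filterS => x.
  by rewrite norm_lt_nsq // sqr_sqrtr ?ltW // nsqB.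
move=> h; apply/cvgrPdist_lt => -[e e'].
rewrite ltcE /= => /andP[/eqP -> e0].
have := h (e ^+ 2); rewrite exprn_gt0 // => /(_ isT); apply: filterS => x.
by rewrite nsqB -norm_lt_nsq.
Qed.

Lemma cvgC_ReIm (T : Type) (F : set_system T) (f : T -> C) (l : C) : Filter F ->
  (f x @[x --> F] --> l) <->
  (Re (f x) @[x --> F] --> Re l) /\ (Im (f x) @[x --> F] --> Im l).
Proof.
move=> FF; rewrite cvgC_nsqP; split=> [h|[hr hi] e e0].
  have key (p : C -> R) : (forall x, (p x) ^+ 2 <= nsq x) ->
      (forall x y, p (x - y) = p x - p y) -> p (f x) @[x --> F] --> p l.
    move=> p1 p2; apply/cvgrPdist_lt => e e0.
    have := h (e ^+ 2); rewrite exprn_gt0 // => /(_ isT); apply: filterS => x fx.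
    rewrite distrC -p2 -ltr_sqr ?nnegrE ?(ltW e0) //.
    by rewrite real_normK ?num_real // (le_lt_trans (p1 _)).
  split; apply: key => *; rewrite ?cReB ?cImB // /nsq ?lerDl ?lerDr ?sqr_ge0 //.
have s0 : 0 < Num.sqrt (e / 2) by rewrite sqrtr_gt0 divr_gt0.
have s2 : Num.sqrt (e / 2) ^+ 2 = e / 2 by rewrite sqr_sqrtr // divr_ge0 // ltW.
move/cvgrPdist_lt/(_ _ s0) : hr => hr; move/cvgrPdist_lt/(_ _ s0) : hi => hi.
have sq (u v : R) : `|u| < v -> u ^+ 2 < v ^+ 2.
  move=> uv; rewrite -[u ^+ 2]real_normK ?num_real //.
  by rewrite ltr_sqr ?nnegrE // ltW // (le_lt_trans (normr_ge0 u) uv).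
near=> x; rewrite /nsq cReB cImB.
have h1 : (Re (f x) - Re l) ^+ 2 < e / 2.
  rewrite -s2; apply: sq; rewrite distrC; near: x; exact: hr.
have h2 : (Im (f x) - Im l) ^+ 2 < e / 2.
  rewrite -s2; apply: sq; rewrite distrC; near: x; exact: hi.
by have := ltrD h1 h2; rewrite -splitr.
Unshelve. all: by end_near. Qed.

Lemma cvg_mx_entries (T : Type) (F : set_system T) (S : topologicalType)
    (m k : nat) (f : T -> 'M[S]_(m, k)) (l : 'M[S]_(m, k)) : Filter F ->
  (f x @[x --> F] --> l) <-> (forall i j, f x i j @[x --> F] --> l i j).
Proof.
move=> FF; split=> [h i j A Al|h A [P Pl PA]].
  apply: (h [set M | A (M i j)]).
  (* A basic neighbourhood that constrains the entry [(i, j)] only. *)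
  exists (fun i' j' => [set y | i' = i -> j' = j -> A y]).
    move=> i' j'; have [->|/eqP ni] := eqVneq i' i; last first.
      by apply: filterS filterT => y _ /ni.
    have [->|/eqP nj] := eqVneq j' j; last first.
      by apply: filterS filterT => y _ _ /nj.
    by apply: filterS Al => y Ay _ _.
  by move=> M /(_ i j erefl erefl).
suff : \forall x \near F, forall i j, P i j (f x i j).
  by apply: filterS => x; exact: PA.
apply: filter_forall => i; apply: filter_forall => j.
exact: h (Pl i j).
Qed.

Lemma cvg_mx_nsqP (T : Type) (F : set_system T) (m k : nat)
    (f : T -> 'M[C]_(m, k)) (l : 'M[C]_(m, k)) : Filter F ->
  (f x @[x --> F] --> l) <->
  (forall e, 0 < e -> \forall x \near F, forall i j, nsq (f x i j - l i j) < e).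
Proof.
move=> FF; rewrite cvg_mx_entries; split=> [h e e0|h i j].
  apply: filter_forall => i; apply: filter_forall => j.
  exact: ((cvgC_nsqP _ _ _).1 (h i j)).
by apply/cvgC_nsqP => e /h; apply: filterS.
Qed.

End ComplexNumbers.

(** * Squared norms and the real inner product on complex vectors *)

Section Vectors.
Variable R : realType.
Local Notation C := R[i].
Local Notation Re := (@complex.Re R).
Local Notation Im := (@complex.Im R).

Definition sqn (m : nat) (z : 'cV[C]_m) : R := \sum_i nsq (z i 0).

Lemma sqn_ge0 m (z : 'cV[C]_m) : 0 <= sqn z.
Proof. by apply: sumr_ge0 => i _; exact: nsq_ge0. Qed.

Lemma sqn0 m : sqn (0 : 'cV[C]_m) = 0.
Proof. by rewrite /sqn big1 // => i _; rewrite mxE nsq0. Qed.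

Lemma nsq_le_sqn m (z : 'cV[C]_m) i : nsq (z i 0) <= sqn z.
Proof. by rewrite /sqn (bigD1 i) //= lerDl sumr_ge0 // => j _; exact: nsq_ge0. Qed.

Lemma sqn_eq0 m (z : 'cV[C]_m) : sqn z = 0 -> z = 0.
Proof.
move=> z0; apply/matrixP => i j; rewrite ord1 mxE; apply: nsq_eq0.
by apply/eqP; rewrite eq_le nsq_ge0 andbT -z0 nsq_le_sqn.
Qed.

Lemma sqn_le0 m (z : 'cV[C]_m) : sqn z <= 0 -> z = 0.
Proof. by move=> h; apply: sqn_eq0; apply/eqP; rewrite eq_le h sqn_ge0. Qed.

Lemma sqnN m (z : 'cV[C]_m) : sqn (- z) = sqn z.
Proof. by apply: eq_bigr => i _; rewrite mxE nsqN. Qed.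

Lemma sqnD m (x y : 'cV[C]_m) : sqn (x + y) <= 2 * sqn x + 2 * sqn y.
Proof.
rewrite /sqn !mulr_sumr -big_split /=; apply: ler_sum => i _; rewrite mxE.
exact: nsqD.
Qed.

Lemma sqnB m (x y : 'cV[C]_m) : sqn (x - y) <= 2 * sqn x + 2 * sqn y.
Proof. by have := sqnD x (- y); rewrite sqnN. Qed.

Lemma sqnZ m (c : C) (z : 'cV[C]_m) : sqn (c *: z) = nsq c * sqn z.
Proof. by rewrite /sqn mulr_sumr; apply: eq_bigr => i _; rewrite mxE nsqM. Qed.

Lemma sqn_col_mx m k (x : 'cV[C]_m) (y : 'cV[C]_k) :
  sqn (col_mx x y) = sqn x + sqn y.
Proof.
rewrite /sqn big_split_ord /=.
by congr (_ + _); apply: eq_bigr => i _; rewrite ?col_mxEu ?col_mxEd.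
Qed.

Lemma sqn_split m k (z : 'cV[C]_(m + k)) :
  sqn z = sqn (usubmx z) + sqn (dsubmx z).
Proof. by rewrite -sqn_col_mx vsubmxK. Qed.

Lemma sqn_mulmx m k (A : 'M[C]_(m, k)) (z : 'cV[C]_k) (a : R) :
  (forall i j, nsq (A i j) <= a) ->
  sqn (A *m z) <= (m * k)%:R * a * sqn z.
Proof.
move=> Aa; rewrite /sqn.
apply: (@le_trans _ _ (\sum_(i < m) k%:R * (a * sqn z))).
  apply: ler_sum => i _; rewrite mxE.
  apply: le_trans (nsq_sum _) _; rewrite card_ord ler_wpM2l //.
  rewrite /sqn mulr_sumr; apply: ler_sum => j _; rewrite nsqM.
  by rewrite ler_wpM2r ?nsq_ge0.
by rewrite sumr_const card_ord -[X in X <= _]mulr_natl natrM !mulrA.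
Qed.

Lemma enorm_ge0 m (z : 'cV[C]_m) : 0 <= enorm z.
Proof. exact: sqrtr_ge0. Qed.

Lemma sqr_enorm m (z : 'cV[C]_m) : enorm z ^+ 2 = sqn z.
Proof. by rewrite sqr_sqrtr // sqn_ge0. Qed.

Lemma enorm_le m k (x : 'cV[C]_m) (y : 'cV[C]_k) (a : R) : 0 <= a ->
  (enorm x <= a * enorm y) <-> (sqn x <= a ^+ 2 * sqn y).
Proof.
move=> a0; rewrite -!sqr_enorm -exprMn.
by rewrite ler_sqr ?nnegrE ?mulr_ge0 ?enorm_ge0.
Qed.

(** The real part of the Hermitian product, that is, the Euclidean product of the underlying real
    space; the derivative of [sqn] is twice [rdot]. *)
Definition rdot m (x y : 'cV[C]_m) : R :=
  \sum_i (Re (x i 0) * Re (y i 0) + Im (x i 0) * Im (y i 0)).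

Lemma rdotDr m (x y z : 'cV[C]_m) : rdot x (y + z) = rdot x y + rdot x z.
Proof.
rewrite /rdot -big_split; apply: eq_bigr => i _ /=; rewrite mxE cReD cImD; ring.
Qed.

Lemma rdot_young m (x y : 'cV[C]_m) (a : R) : 0 < a ->
  2 * rdot x y <= a * sqn x + a^-1 * sqn y.
Proof.
move=> a0; rewrite /rdot /sqn !mulr_sumr -big_split /=; apply: ler_sum => i _.
rewrite /nsq; set p := Re _; set q := Re _; set r := Im _; set t := Im _.
have h (u v : R) : 2 * (u * v) <= a * u ^+ 2 + a^-1 * v ^+ 2.
  have := mulr_ge0 (ltW (divr_gt0 ltr01 a0)) (sqr_ge0 (a * u - v)).
  rewrite div1r.
  have -> : a^-1 * (a * u - v) ^+ 2 = a * u ^+ 2 - 2 * (u * v) + a^-1 * v ^+ 2.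
    by field; exact: lt0r_neq0.
  lra.
have := h p q; have := h r t; lra.
Qed.

Lemma rdot_youngN m (x y : 'cV[C]_m) (a : R) : 0 < a ->
  - (2 * rdot x y) <= a * sqn x + a^-1 * sqn y.
Proof.
move=> a0; have := @rdot_young m x (- y) a a0; rewrite sqnN.
have -> : rdot x (- y) = - rdot x y; last by rewrite mulrN.
by rewrite /rdot -sumrN; apply: eq_bigr => i _; rewrite mxE cReN cImN; ring.
Qed.

End Vectors.

Section ComplexDerivatives.
Variable R : realType.
Local Notation C := R[i].
Local Notation Re := (@complex.Re R).
Local Notation Im := (@complex.Im R).

Definition is_cderive (f : R -> C) (t : R) (d : C) : Prop :=
  is_derive t 1 (fun u => Re (f u)) (Re d) /\
  is_derive t 1 (fun u => Im (f u)) (Im d).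

Lemma eq_is_derive (f g : R -> R) (t d : R) : f =1 g ->
  is_derive t 1 f d -> is_derive t 1 g d.
Proof. by move=> /funext ->. Qed.

Lemma cderive_cst (c : C) t : is_cderive (fun=> c) t 0.
Proof. by split; exact: rderiv_cst. Qed.

Lemma cderiveM f g t a b : is_cderive f t a -> is_cderive g t b ->
  is_cderive (fun u => f u * g u) t (a * g t + f t * b).
Proof.
move=> [fr fi] [gr gi]; split.
  apply: (@eq_is_derive (fun u => Re (f u) * Re (g u) - Im (f u) * Im (g u))).
    by move=> u; rewrite cReM.
  have := rderivB (rderivM fr gr) (rderivM fi gi).
  by congr is_derive; rewrite cReD !cReM; ring.
apply: (@eq_is_derive (fun u => Re (f u) * Im (g u) + Im (f u) * Re (g u))).
  by move=> u; rewrite cImM.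
have := rderivD (rderivM fr gi) (rderivM fi gr).
by congr is_derive; rewrite cImD !cImM; ring.
Qed.

Lemma cderive_sum (I : Type) (r : seq I) (P : pred I) (F : I -> R -> C)
    (d : I -> C) t :
  (forall i, P i -> is_cderive (F i) t (d i)) ->
  is_cderive (fun u => \sum_(i <- r | P i) F i u) t (\sum_(i <- r | P i) d i).
Proof.
move=> H; split.
  rewrite cRe_sum; apply: eq_is_derive (rderiv_sum r (fun i Pi => (H i Pi).1)).
  by move=> u; rewrite cRe_sum.
rewrite cIm_sum; apply: eq_is_derive (rderiv_sum r (fun i Pi => (H i Pi).2)).
by move=> u; rewrite cIm_sum.
Qed.

Section MatrixDerivatives.
Variables (m k p : nat).
Implicit Types (Z : R -> 'M[C]_(m, k)) (t : R).

Lemma tderive_cst (A : 'M[C]_(m, k)) t : is_tderive (fun=> A) t 0.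
Proof. by move=> i j; rewrite mxE; exact: cderive_cst. Qed.

Lemma tderiveD Z Z' t D D' : is_tderive Z t D -> is_tderive Z' t D' ->
  is_tderive (fun u => Z u + Z' u) t (D + D').
Proof.
move=> h h' i j; have [a b] := h i j; have [a' b'] := h' i j.
rewrite mxE cReD cImD; split.
  by apply: eq_is_derive (rderivD a a') => u; rewrite mxE cReD.
by apply: eq_is_derive (rderivD b b') => u; rewrite mxE cImD.
Qed.

Lemma tderiveN Z t D : is_tderive Z t D -> is_tderive (fun u => - Z u) t (- D).
Proof.
move=> h i j; have [a b] := h i j; rewrite mxE cReN cImN; split.
  by apply: eq_is_derive (rderivN a) => u; rewrite mxE cReN.
by apply: eq_is_derive (rderivN b) => u; rewrite mxE cImN.
Qed.

Lemma tderiveB Z Z' t D D' : is_tderive Z t D -> is_tderive Z' t D' ->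
  is_tderive (fun u => Z u - Z' u) t (D - D').
Proof. by move=> h h'; exact: tderiveD h (tderiveN h'). Qed.

Lemma tderiveM Z (W : R -> 'M[C]_(k, p)) t D E :
  is_tderive Z t D -> is_tderive W t E ->
  is_tderive (fun u => Z u *m W u) t (D *m W t + Z t *m E).
Proof.
move=> h h' i j.
suff : is_cderive (fun u => \sum_l Z u i l * W u l j) t
    (\sum_l (D i l * W t l j + Z t i l * E l j)).
  have -> : (fun u => \sum_l Z u i l * W u l j) = (fun u => (Z u *m W u) i j).
    by apply/funext => u; rewrite mxE.
  by rewrite big_split /= !mxE.
by apply: cderive_sum => l _; apply: cderiveM; [exact: h | exact: h'].
Qed.

Lemma tderive_tr Z t D : is_tderive Z t D ->
  is_tderive (fun u => (Z u)^T) t D^T.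
Proof.
move=> h i j; have [a b] := h j i; rewrite mxE.
by split; [apply: eq_is_derive a | apply: eq_is_derive b] => u; rewrite mxE.
Qed.

Lemma tderive_conj Z t D : is_tderive Z t D ->
  is_tderive (fun u => map_mx (@conjc R) (Z u)) t (map_mx (@conjc R) D).
Proof.
move=> h i j; have [a b] := h i j; rewrite mxE; case: (D i j) a b => d d' /= a b.
split; [apply: eq_is_derive a | apply: eq_is_derive (rderivN b)] => u;
by rewrite mxE; case: (Z u i j).
Qed.

Lemma tderive_shift Z (c : R) t D : is_tderive Z (t + c) D ->
  is_tderive (fun u => Z (u + c)) t D.
Proof.
by move=> h i j; have [a b] := h i j; split;
  [exact: (rderiv_shift a) | exact: (rderiv_shift b)].
Qed.

Lemma tderive_opp Z t D : is_tderive Z (- t) D ->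
  is_tderive (fun u => Z (- u)) t (- D).
Proof.
move=> h i j; have [a b] := h i j; rewrite mxE cReN cImN; split.
  exact: (rderiv_opp a).
exact: (rderiv_opp b).
Qed.

End MatrixDerivatives.

Lemma tderive_usub m1 m2 k (Z : R -> 'M[C]_(m1 + m2, k)) t D :
  is_tderive Z t D -> is_tderive (fun u => usubmx (Z u)) t (usubmx D).
Proof.
move=> h i j; rewrite mxE; have [a b] := h (lshift m2 i) j.
by split; [apply: eq_is_derive a | apply: eq_is_derive b] => u; rewrite mxE.
Qed.

Lemma tderive_dsub m1 m2 k (Z : R -> 'M[C]_(m1 + m2, k)) t D :
  is_tderive Z t D -> is_tderive (fun u => dsubmx (Z u)) t (dsubmx D).
Proof.
move=> h i j; rewrite mxE; have [a b] := h (rshift m1 i) j.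
by split; [apply: eq_is_derive a | apply: eq_is_derive b] => u; rewrite mxE.
Qed.

Lemma sqn_derive m (z : R -> 'cV[C]_m) t d : is_tderive z t d ->
  is_derive t 1 (fun u => sqn (z u)) (2 * rdot (z t) d).
Proof.
move=> h; rewrite /rdot mulr_sumr /sqn; apply: rderiv_sum => i _.
have [a b] := h i 0; have := rderivD (rderivM a a) (rderivM b b).
set X := (X in is_derive _ _ _ X -> _); set Y := (Y in _ -> is_derive _ _ _ Y).
have -> : X = Y by rewrite /X /Y; ring.
by apply: eq_is_derive => u; rewrite /nsq !expr2.
Qed.

End ComplexDerivatives.

Section LinearODE.
Variable R : realType.
Local Notation C := R[i].
Local Notation Re := (@complex.Re R).
Local Notation Im := (@complex.Im R).

(** [solution] along one orbit, with the coefficient as a function of time alone, so that shifted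
    and reversed systems fall under the same lemmas. *)
Definition linsol (m k : nat) (a : R -> 'M[C]_m) (Z : R -> 'M[C]_(m, k)) : Prop :=
  forall t, is_tderive Z t (a t *m Z t).

Definition cont_entries (T : topologicalType) (m k : nat)
    (a : T -> 'M[C]_(m, k)) : Prop :=
  forall i j, continuous (fun t => Re (a t i j)) /\
              continuous (fun t => Im (a t i j)).

Lemma linsol_exists_col m (a : R -> 'M[C]_m) (c : R) (z0 : 'cV[C]_m) :
  cont_entries a -> (forall t i j, nsq (a t i j) <= c) ->
  exists z, z 0 = z0 /\ linsol a z.
Proof.
move=> ca ac.
(* Realification: index [(i, false)] carries the real part of coordinate [i], index [(i, true)] its
   imaginary part. *)
pose b (p q : 'I_m * bool) (t : R) : R :=
  match p.2, q.2 with
  | false, false => Re (a t p.1 q.1)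
  | false, true => - Im (a t p.1 q.1)
  | true, false => Im (a t p.1 q.1)
  | true, true => Re (a t p.1 q.1)
  end.
pose x0 (p : 'I_m * bool) := if p.2 then Im (z0 p.1 0) else Re (z0 p.1 0).
(* From [2 * |x| <= x ^+ 2 + 1]: the bound on squared moduli becomes the bound on absolute values
   that [picard] asks for. *)
have le1 (x y : R) : x ^+ 2 + y ^+ 2 <= c -> `|x| <= c + 1.
  move=> h; rewrite ler_norml; have := sqr_ge0 (x - 1); have := sqr_ge0 (x + 1).
  by have := sqr_ge0 y; move=> *; apply/andP; split; nra.
have [|p q t|x [xi hx]] := @picard R _ b (c + 1) x0.
- move=> [i [|]] [j [|]]; rewrite /b /=; have [cr ci] := ca i j => //.
  by move=> t; apply: cvgN; exact: ci.
- have := ac t p.1 q.1; rewrite /nsq => h; have h' := h; rewrite addrC in h'.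
  by rewrite /b; case: p.2; case: q.2; rewrite ?normrN; apply: le1; eassumption.
exists (fun t => \col_i (Complex (x (i, false) t) (x (i, true) t))); split.
  by apply/colP => i; rewrite mxE !xi /x0 /=; case: (z0 i 0).
have split_sum (F : 'I_m * bool -> R) :
    \sum_p F p = \sum_j (F (j, false) + F (j, true)).
  rewrite (eq_bigr (fun p => F (p.1, p.2))); last by case.
  rewrite -(pair_bigA _ (fun i b => F (i, b))) /=; apply: eq_bigr => j _.
  by rewrite big_bool addrC.
move=> t i j; rewrite !mxE !cRe_sum !cIm_sum; split.
  apply: (@eq_is_derive _ (x (i, false))); first by move=> u; rewrite mxE.
  have := hx (i, false) t; rewrite split_sum; congr is_derive.
  by apply: eq_bigr => l _; rewrite mxE cReM /b /= mulNr.
apply: (@eq_is_derive _ (x (i, true))); first by move=> u; rewrite mxE.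
have := hx (i, true) t; rewrite split_sum; congr is_derive.
by apply: eq_bigr => l _; rewrite mxE cImM /b /= addrC.
Qed.

Lemma linsol_exists m k (a : R -> 'M[C]_m) (c : R) (Z0 : 'M[C]_(m, k)) :
  cont_entries a -> (forall t i j, nsq (a t i j) <= c) ->
  exists Z, Z 0 = Z0 /\ linsol a Z.
Proof.
move=> ca ac.
have [z hz] : {z : 'I_k -> R -> 'cV[C]_m & forall j, z j 0 = col j Z0 /\ linsol a (z j)}.
  apply: (@choice _ _ (fun j z => z 0 = col j Z0 /\ linsol a z)) => j.
  exact: linsol_exists_col ac.
exists (fun t => \matrix_(i, j) z j t i 0); split.
  by apply/matrixP => i j; rewrite mxE (hz j).1 mxE.
move=> t i j; have := (hz j).2 t i 0.
have -> : (a t *m \matrix_(i, j) z j t i 0) i j = (a t *m z j t) i 0.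
  by rewrite !mxE; apply: eq_bigr => l _; rewrite mxE.
case=> dr di; split; [move: dr | move: di]; apply: eq_is_derive => u;
by rewrite mxE.
Qed.

Section Properties.
Variables (m k p : nat) (a : R -> 'M[C]_m).
Implicit Types Z : R -> 'M[C]_(m, k).

Lemma linsolD Z Z' : linsol a Z -> linsol a Z' -> linsol a (fun t => Z t + Z' t).
Proof. by move=> h h' t; rewrite mulmxDr; exact: tderiveD. Qed.

Lemma linsolB Z Z' : linsol a Z -> linsol a Z' -> linsol a (fun t => Z t - Z' t).
Proof. by move=> h h' t; rewrite mulmxBr; exact: tderiveB. Qed.

Lemma linsolM Z (c : 'M[C]_(k, p)) : linsol a Z -> linsol a (fun t => Z t *m c).
Proof.
move=> h t; have := tderiveM (h t) (tderive_cst c t).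
by rewrite mulmx0 addr0 mulmxA.
Qed.

Lemma linsol_shift Z (c : R) : linsol a Z ->
  linsol (fun t => a (t + c)) (fun t => Z (t + c)).
Proof. by move=> h t; exact: tderive_shift. Qed.

Lemma linsol_opp Z : linsol a Z ->
  linsol (fun t => - a (- t)) (fun t => Z (- t)).
Proof. by move=> h t; rewrite mulNmx; exact: tderive_opp. Qed.

End Properties.

(* The forcing term is compared with the derivative of some monotone [q]. *)
Lemma forced_growth m (a : R -> 'M[C]_m) (c b t : R) (z f : R -> 'cV[C]_m)
    (q dq : R -> R) :
  0 <= c -> 0 <= b -> 0 <= t -> (forall u i j, nsq (a u i j) <= c) ->
  (forall u, is_tderive z u (a u *m z u + f u)) ->
  (forall u, 0 <= u <= t -> is_derive u 1 q (dq u)) ->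
  (forall u, 0 <= u <= t -> 0 <= dq u) ->
  (forall u, 0 <= u <= t -> sqn (f u) <= b * dq u) ->
  sqn (z t) <= expR ((2 + (m * m)%:R * c) * t) * (sqn (z 0) + b * (q t - q 0)).
Proof.
move=> c0 b0 t0 ac hz hq dq0 hf.
apply: (@gronwall _ (fun u => sqn (z u)) q
  (fun u => 2 * rdot (z u) (a u *m z u + f u)) dq) => //.
- by rewrite addr_ge0 // mulr_ge0.
- by move=> u _; apply: sqn_derive.
move=> u ut; rewrite rdotDr mulrDr.
have h1 := rdot_young (z u) (a u *m z u) ltr01.
have h2 := rdot_young (z u) (f u) ltr01.
have h3 := sqn_mulmx (z u) (ac u); have h4 := hf u ut.
rewrite invr1 in h1 h2.
have -> : (2 + (m * m)%:R * c) * sqn (z u) = 2 * sqn (z u) + (m * m)%:R * c * sqn (z u).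
  by rewrite mulrDl.
lra.
Qed.

Lemma linsol_growth m (a : R -> 'M[C]_m) (c t : R) (z : R -> 'cV[C]_m) :
  0 <= c -> 0 <= t -> (forall u i j, nsq (a u i j) <= c) -> linsol a z ->
  sqn (z t) <= expR ((2 + (m * m)%:R * c) * t) * sqn (z 0).
Proof.
move=> c0 t0 ac hz.
have -> : sqn (z 0) = sqn (z 0) + 0 * (0 - 0 : R) by rewrite mul0r addr0.
apply: (@forced_growth m a c 0 t z (fun=> 0) (fun=> 0) (fun=> 0)) => // u.
- by rewrite addr0; exact: hz.
- by move=> _; rewrite sqn0 mul0r.
Qed.

Lemma linsol_unique_col m (a : R -> 'M[C]_m) (c : R) (z : R -> 'cV[C]_m) :
  (forall u i j, nsq (a u i j) <= c) -> linsol a z -> z 0 = 0 ->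
  forall t, z t = 0.
Proof.
move=> ac hz z0 t.
have ac' u i j : nsq (a u i j) <= `|c| by apply: le_trans (ac u i j) (ler_norm _).
apply: sqn_le0; have [t0|/ltW t0] := leP 0 t.
  by have := linsol_growth (normr_ge0 c) t0 ac' hz; rewrite z0 sqn0 mulr0.
rewrite -oppr_ge0 in t0.
have ac2 u i j : nsq ((- a (- u)) i j) <= `|c| by rewrite mxE nsqN.
have := linsol_growth (normr_ge0 c) t0 ac2 (linsol_opp hz).
by rewrite opprK oppr0 z0 sqn0 mulr0.
Qed.

Lemma linsol_unique m k (a : R -> 'M[C]_m) (c : R) (Z W : R -> 'M[C]_(m, k)) :
  (forall u i j, nsq (a u i j) <= c) -> linsol a Z -> linsol a W -> Z 0 = W 0 ->
  Z =1 W.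
Proof.
move=> ac hZ hW e t; apply/matrixP => i j.
have h := linsol_unique_col ac (linsolM (delta_mx j 0 : 'cV_k) (linsolB hZ hW)).
have /matrixP/(_ i 0) : (Z t - W t) *m (delta_mx j 0 : 'cV_k) = 0.
  by apply: h; rewrite e subrr mul0mx.
by rewrite -colE !mxE => /eqP; rewrite subr_eq0 => /eqP.
Qed.

End LinearODE.

(** * Continuity of determinant, adjugate and inverse *)

Section DetContinuity.
Variables (K : numFieldType) (T : Type) (F : set_system T).
Context {FF : Filter F}.

Lemma cvg_big_prod (I : Type) (r : seq I) (P : pred I) (f : I -> T -> K)
    (l : I -> K) : (forall i, P i -> f i x @[x --> F] --> l i) ->
  (\prod_(i <- r | P i) f i x) @[x --> F] --> \prod_(i <- r | P i) l i.
Proof.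
move=> H; elim: r => [|i r IH].
  by rewrite big_nil; under eq_fun do rewrite big_nil; exact: cvg_cst.
rewrite big_cons; under eq_fun do rewrite big_cons.
by case: ifPn => Pi //; apply: cvgM => //; exact: H.
Qed.

Lemma cvg_det n (A : T -> 'M[K]_n) (L : 'M[K]_n) :
  (forall i j, A x i j @[x --> F] --> L i j) ->
  \det (A x) @[x --> F] --> \det L.
Proof.
move=> h; apply: cvg_big_sum => s _; apply: cvgM; first exact: cvg_cst.
by apply: cvg_big_prod => i _; exact: h.
Qed.

Lemma cvg_adj n (A : T -> 'M[K]_n) (L : 'M[K]_n) :
  (forall i j, A x i j @[x --> F] --> L i j) ->
  forall i j, (\adj (A x)) i j @[x --> F] --> (\adj L) i j.
Proof.
move=> h i j; rewrite mxE; under eq_fun do rewrite mxE.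
apply: cvgM; first exact: cvg_cst.
apply: cvg_det => k l; rewrite !mxE; under eq_fun do rewrite !mxE.
exact: h.
Qed.

Lemma cvg_invmx n (A : T -> 'M[K]_n) (L : 'M[K]_n) :
  (forall x, A x \in unitmx) -> L \in unitmx ->
  (forall i j, A x i j @[x --> F] --> L i j) ->
  forall i j, (invmx (A x)) i j @[x --> F] --> (invmx L) i j.
Proof.
move=> Au Lu h i j; rewrite /invmx Lu [in X in _ --> X]mxE.
under eq_fun do rewrite /invmx Au mxE.
apply: cvgM; last exact: cvg_adj.
apply: cvgV; last exact: cvg_det.
by move: Lu; rewrite unitmxE unitfE.
Qed.

End DetContinuity.

(** * Lower bounds for positive definite forms *)

Section Coercive.
Variable R : realType.
Local Notation C := R[i].

Lemma compact_bounded_fun (T : topologicalType) (f : T -> R) :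
  compact [set: T] -> continuous f -> exists c, forall x, `|f x| <= c.
Proof.
move=> cT cf; have [[x0 _]|T0] := pselect ([set: T] !=set0); last first.
  by exists 0 => x; case: T0; exists x.
have [||c _ h] := @compact_EVT_max T R (fun x => `|f x|) setT _ cT.
- by exists x0.
- apply: continuous_subspaceT => x.
  by apply: cvg_norm; exact: cf.
by exists `|f c| => x; apply: h; rewrite inE.
Qed.

Definition qform n (D : 'M[R]_n) (x y : 'cV[R]_n) : R := (x^T *m D *m y) 0 0.

Lemma qformE n (D : 'M[R]_n) x y :
  qform D x y = \sum_i \sum_j D i j * (x i 0 * y j 0).
Proof.
rewrite /qform mxE exchange_big /=; apply: eq_bigr => j _; rewrite mxE mulr_suml.
by apply: eq_bigr => i _; rewrite mxE; ring.
Qed.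

Lemma qform_le n (D : 'M[R]_n) (c : R) x : (forall i j, `|D i j| <= c) ->
  `|qform D x x| <= c * n%:R * \sum_i x i 0 ^+ 2.
Proof.
move=> Dc; rewrite qformE.
apply: (@le_trans _ _ (\sum_i \sum_j c * (`|x i 0| * `|x j 0|))).
  apply: le_trans (ler_norm_sum _ _ _) _; apply: ler_sum => i _.
  apply: le_trans (ler_norm_sum _ _ _) _; apply: ler_sum => j _.
  by rewrite !normrM ler_wpM2r ?mulr_ge0.
have [n0|n0] := posnP n.
  by rewrite !big1 ?mulr0 // => i _; exfalso; case: i => i; rewrite n0.
have c0 : 0 <= c by apply: le_trans (normr_ge0 _) (Dc (Ordinal n0) (Ordinal n0)).
have := sum_sqr_le (fun i => `|x i 0|); rewrite card_ord.
under [X in _ * X]eq_bigr do rewrite real_normK ?num_real //.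
move=> /(ler_wpM2l c0) h; rewrite [X in _ <= X]mulrA expr2 in h; apply: le_trans h.
rewrite mulr_suml mulr_sumr le_eqVlt; apply/orP; left; apply/eqP.
by apply: eq_bigr => i _; rewrite !mulr_sumr.
Qed.

Lemma posdef_cauchy n (D : 'M[R]_n) x y : posdef D ->
  qform D x y ^+ 2 <= qform D x x * qform D y y.
Proof.
move=> [Dt Dp]; have [->|y0] := eqVneq y 0.
  by rewrite /qform !mulmx0 mxE expr0n mulr0.
have sym : qform D y x = qform D x y.
  rewrite !qformE exchange_big; apply: eq_bigr => i _; apply: eq_bigr => j _.
  by rewrite -{1}Dt mxE [y j 0 * _]mulrC.
have dy : 0 < qform D y y by exact: Dp.
set t := qform D x y / qform D y y.
have : 0 <= qform D (x - t *: y) (x - t *: y).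
  have [->|h] := eqVneq (x - t *: y) 0; last exact/ltW/Dp.
  by rewrite /qform mulmx0 mxE.
have -> : qform D (x - t *: y) (x - t *: y) =
    qform D x x - t * qform D x y - t * qform D y x + t * t * qform D y y.
  rewrite !qformE !mulr_sumr -!sumrB -big_split /=; apply: eq_bigr => i _.
  rewrite !mulr_sumr -!sumrB -big_split /=; apply: eq_bigr => j _.
  by rewrite !mxE; ring.
rewrite sym => h.
have {}h : 0 <= (qform D x x - t * qform D x y - t * qform D x y +
   t * t * qform D y y) * qform D y y by rewrite mulr_ge0 // ltW.
rewrite -subr_ge0; apply: le_trans h _.
rewrite le_eqVlt; apply/orP; left; apply/eqP; rewrite /t; field.
exact: lt0r_neq0.
Qed.

Lemma posdef_unit n (D : 'M[R]_n) : posdef D -> D \in unitmx.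
Proof.
move=> [Dt Dp]; rewrite -row_free_unit -kermx_eq0.
apply/negPn/negP => /rowV0Pn [v /sub_kermxP vD v0].
have vT : v^T != 0 by apply: contra v0 => /eqP h; rewrite -[v]trmxK h trmx0.
by have := Dp _ vT; rewrite trmxK vD mul0mx mxE ltxx.
Qed.

(** Cauchy-Schwarz for the form [D] at [x] and [invmx D *m x] gives |x|^4 <= D(x,x) D^-1(x,x). The
    lower bound of [D] thus rests on an upper bound for the entries of its inverse, which continuity
    makes uniform on a compact base. *)
Lemma posdef_coercive n (D : 'M[R]_n) (c : R) (x : 'cV[R]_n) : posdef D ->
  (forall i j, `|invmx D i j| <= c) ->
  \sum_i x i 0 ^+ 2 <= c * n%:R * qform D x x.
Proof.
move=> Dp Dc; have Du := posdef_unit Dp.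
have q0 : 0 <= qform D x x.
  have [->|/Dp.2/ltW//] := eqVneq x 0; by rewrite /qform mulmx0 mxE.
set S := \sum_i _.
have S0 : 0 <= S by apply: sumr_ge0 => i _; exact: sqr_ge0.
have [n0|n0] := posnP n.
  rewrite /S big1 => [|i _]; last by exfalso; case: i => i; rewrite n0.
  have -> : n%:R = 0 :> R by rewrite n0.
  by rewrite mulr0 mul0r.
have c0 : 0 <= c by apply: le_trans (normr_ge0 _) (Dc (Ordinal n0) (Ordinal n0)).
have [S00|Sn] := eqVneq S 0; first by rewrite S00; apply: mulr_ge0 q0; apply: mulr_ge0.
have Sp : 0 < S by rewrite lt0r Sn.
have De : D *m (invmx D *m x) = x by rewrite mulmxA mulmxV // mul1mx.
have := posdef_cauchy x (invmx D *m x) Dp.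
have -> : qform D x (invmx D *m x) = S.
  rewrite /qform -mulmxA De mxE.
  by apply: eq_bigr => i _; rewrite mxE expr2.
have -> : qform D (invmx D *m x) (invmx D *m x) = qform (invmx D) x x.
  by rewrite /qform -mulmxA De trmx_mul trmx_inv Dp.1.
move=> h; have h2 := qform_le x Dc; rewrite -/S in h2.
have h3 : S ^+ 2 <= qform D x x * (c * n%:R * S).
  apply: le_trans h _; rewrite ler_wpM2l //; exact: le_trans (ler_norm _) h2.
by rewrite -(ler_pM2r Sp) -expr2; apply: le_trans h3 _; rewrite mulrCA mulrA.
Qed.

Definition mxconj m k (Z : 'M[C]_(m, k)) : 'M[C]_(m, k) := map_mx (@conjc R) Z.

Definition dform n (D : 'M[R]_n) (x : 'cV[C]_n) : R :=
  complex.Re (((mxconj x)^T *m toC D *m x) 0 0).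

Lemma dformE n (D : 'M[R]_n) (x : 'cV[C]_n) :
  dform D x = qform D (map_mx (@complex.Re R) x) (map_mx (@complex.Re R) x) +
    qform D (map_mx (@complex.Im R) x) (map_mx (@complex.Im R) x).
Proof.
rewrite !qformE /dform mxE cRe_sum.
under eq_bigr do rewrite mxE mulr_suml cRe_sum.
rewrite exchange_big -big_split /=; apply: eq_bigr => i _.
rewrite -big_split /=; apply: eq_bigr => j _.
rewrite !mxE; case: (x i 0) => a b; case: (x j 0) => a' b' /=.
ring.
Qed.

End Coercive.

Section ComplexMatrices.
Variable R : realType.
Local Notation C := R[i].

Lemma toCE m k (M : 'M[R]_(m, k)) i j : toC M i j = (M i j)%:C%C.
Proof. by rewrite mxE. Qed.

Lemma nsq_real (x : R) : nsq x%:C%C = x ^+ 2.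
Proof. by rewrite /nsq /= expr0n addr0. Qed.

Lemma toC_tr m k (M : 'M[R]_(m, k)) : (toC M)^T = toC M^T.
Proof. by rewrite /toC map_trmx. Qed.

Lemma mxconj_toC m k (M : 'M[R]_(m, k)) : mxconj (toC M) = toC M.
Proof. by apply/matrixP => i j; rewrite !mxE conjc_real. Qed.

Lemma mxconjM m k p (M : 'M[C]_(m, k)) (N : 'M[C]_(k, p)) :
  mxconj (M *m N) = mxconj M *m mxconj N.
Proof. exact: map_mxM. Qed.

Lemma in_sp_blocks n (H : 'M[R]_(n + n)) : in_sp H ->
  [/\ (dlsubmx H)^T = dlsubmx H, (ursubmx H)^T = ursubmx H
    & drsubmx H = - (ulsubmx H)^T].
Proof.
rewrite /in_sp -{1 2}[H]submxK /Jmx tr_block_mx !mulmx_block add_block_mx.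
rewrite !(mulmx0, mul0mx, mulmx1, mul1mx, mulmxN, mulNmx, addr0, add0r).
rewrite -[X in _ = X -> _]block_mx0 => /eq_block_mx [h1 h2 h3 h4]; split.
- by apply/eqP; rewrite -subr_eq0; apply/eqP.
- by apply/eqP; rewrite eq_sym -subr_eq0 addrC; apply/eqP.
- by apply/eqP; rewrite -subr_eq0 opprK -oppr_eq0 opprD addrC; apply/eqP.
Qed.

End ComplexMatrices.

(** * Hamiltonian families *)

Section Hamiltonian.
Variables (R : realType) (Om : metricType R) (s : R -> Om -> Om) (n : nat).
Variables (H : Om -> 'M[R]_(n + n)) (Delta : Om -> 'M[R]_n).
Hypothesis H_sp : forall w, in_sp (H w).
Hypothesis Delta_sym : forall w, (Delta w)^T = Delta w.
Local Notation C := R[i].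
Local Notation Re := (@complex.Re R).
Local Notation Im := (@complex.Im R).
Local Notation A := (hamiltonian_family H Delta).

Lemma hamiltonian_mulmx k l w (Z : 'M[C]_(n + n, k)) : A l w *m Z =
  col_mx (toC (ulsubmx (H w)) *m usubmx Z + toC (ursubmx (H w)) *m dsubmx Z
          + l *: (toC (Delta w) *m dsubmx Z))
    (toC (dlsubmx (H w)) *m usubmx Z - (toC (ulsubmx (H w)))^T *m dsubmx Z).
Proof.
rewrite -{1}[Z]vsubmxK /hamiltonian_family mul_block_col mulmxDl -scalemxAl.
by rewrite mulNmx addrA.
Qed.

(* This is Z^T J W. *)
Definition bJ k p (Z : 'M[C]_(n + n, k)) (W : 'M[C]_(n + n, p)) : 'M[C]_(k, p) :=
  (dsubmx Z)^T *m usubmx W - (usubmx Z)^T *m dsubmx W.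

(** The terms in [H1], [H2], [H3] cancel by the symmetry of [H2] and [H3]; the two [Delta] terms are
    equal up to the factors [m] and [- l]. *)
Lemma bJ_derive k p l m w (Z : R -> 'M[C]_(n + n, k)) (W : R -> 'M[C]_(n + n, p)) :
  linsol (fun t => A l (s t w)) Z -> linsol (fun t => A m (s t w)) W ->
  forall t : R, is_tderive (fun u => bJ (Z u) (W u)) t
    ((m - l) *: ((dsubmx (Z t))^T *m toC (Delta (s t w)) *m dsubmx (W t))).
Proof.
move=> hZ hW t; have [H2 H3 _] := in_sp_blocks (H_sp (s t w)).
have H2' : (toC (dlsubmx (H (s t w))))^T = toC (dlsubmx (H (s t w))).
  by rewrite toC_tr H2.
have H3' : (toC (ursubmx (H (s t w))))^T = toC (ursubmx (H (s t w))).
  by rewrite toC_tr H3.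
have D' : (toC (Delta (s t w)))^T = toC (Delta (s t w)) by rewrite toC_tr Delta_sym.
have Z1 := tderive_tr (tderive_usub (hZ t)).
have Z2 := tderive_tr (tderive_dsub (hZ t)).
have W1 := tderive_usub (hW t); have W2 := tderive_dsub (hW t).
have := tderiveB (tderiveM Z2 W1) (tderiveM Z1 W2).
rewrite /bJ !hamiltonian_mulmx !col_mxKu !col_mxKd.
move: H2' H3' D'; move: (toC (ulsubmx _)) (toC (dlsubmx _)) (toC (ursubmx _)) (toC (Delta _)).
move: (dsubmx (Z t)) (usubmx (Z t)) (dsubmx (W t)) (usubmx (W t)).
move=> z2 z1 w2 w1 h1 h2 h3 d H2' H3' D'.
have trD k1 k2 (a b : 'M[C]_(k1, k2)) : (a + b)^T = a^T + b^T by exact: raddfD.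
have trN k1 k2 (a : 'M[C]_(k1, k2)) : (- a)^T = - a^T by exact: raddfN.
have trZ k1 k2 (a : C) (b : 'M[C]_(k1, k2)) : (a *: b)^T = a *: b^T by exact: linearZ.
rewrite !(trD, trN, trZ, trmx_mul) H2' H3' D' !trmxK.
rewrite !(mulmxDl, mulmxDr, mulmxN, mulNmx) -?scalemxAl -?scalemxAr.
rewrite !mulmxA.
set X := (X in is_tderive _ _ X -> _); set Y := (Y in _ -> is_tderive _ _ Y).
suff -> : X = Y by [].
rewrite /X /Y; move: (z1^T *m h2 *m w1) (z2^T *m h1 *m w1) (z2^T *m h3 *m w2).
move: (z2^T *m d *m w2) (z1^T *m h1^T *m w2) => a1 a2 a3 a4 a5.
by apply/matrixP => i j; rewrite !mxE; ring.
Qed.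

(* Twice the imaginary part of z2^* z1, i.e. Im (z^* J z). *)
Definition Qf (z : 'cV[C]_(n + n)) : R := Im (bJ (mxconj z) z 0 0).

Lemma linsol_conj k l w (Z : R -> 'M[C]_(n + n, k)) :
  linsol (fun t => A l (s t w)) Z ->
  linsol (fun t => A (conjc l) (s t w)) (fun t => mxconj (Z t)).
Proof.
move=> h t; have := tderive_conj (h t); rewrite -/(mxconj _) mxconjM.
suff -> : mxconj (A l (s t w)) = A (conjc l) (s t w) by [].
rewrite /mxconj /hamiltonian_family map_block_mx map_mxD map_mxZ map_mxN -map_trmx.
by rewrite -!/(mxconj _) !mxconj_toC.
Qed.

(** The conjugate of [z] solves the family at [conjc l], so [bJ_derive] produces the factor
    [l - conjc l], which is 2 i Im l. *)
Lemma Qf_derive l w (z : R -> 'cV[C]_(n + n)) :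
  linsol (fun t => A l (s t w)) z ->
  forall t : R, is_derive t 1 (fun u => Qf (z u))
    (2 * Im l * dform (Delta (s t w)) (dsubmx (z t))).
Proof.
move=> h t; have [_] := bJ_derive (linsol_conj h) h t 0 0.
congr is_derive; rewrite mxE /dform.
have -> : mxconj (dsubmx (z t)) = dsubmx (mxconj (z t)).
  by apply/matrixP => i j; rewrite !mxE.
move: (_ 0 0) => [a b]; case: l {h} => c d /=; ring.
Qed.

Lemma QfE z : Qf z = 2 * \sum_i (Re (z (rshift n i) 0) * Im (z (lshift n i) 0)
   - Im (z (rshift n i) 0) * Re (z (lshift n i) 0)).
Proof.
rewrite /Qf /bJ !mxE cImB !cIm_sum mulr_sumr -sumrB; apply: eq_bigr => i _.
rewrite !mxE; case: (z (rshift n i) 0) => a b; case: (z (lshift n i) 0) => c d /=.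
ring.
Qed.

(** The weight [e] stays free because [graph_bound] must make the z2 term small enough to be
    absorbed. *)
Lemma Qf_young z (e : R) : 0 < e ->
  `|Qf z| <= e * sqn (usubmx z) + e^-1 * sqn (dsubmx z).
Proof.
move=> e0; have key (u v : R) : `|2 * (u * v)| <= e * u ^+ 2 + e^-1 * v ^+ 2.
  have h (v' : R) : 2 * (u * v') <= e * u ^+ 2 + e^-1 * v' ^+ 2.
    have := mulr_ge0 (ltW (divr_gt0 ltr01 e0)) (sqr_ge0 (e * u - v')).
    rewrite div1r.
    have -> : e^-1 * (e * u - v') ^+ 2 = e * u ^+ 2 - 2 * (u * v') + e^-1 * v' ^+ 2.
      by field; exact: lt0r_neq0.
    lra.
  rewrite ler_norml h andbT; have := h (- v); rewrite sqrrN; lra.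
rewrite QfE mulr_sumr /sqn !mulr_sumr -big_split /=.
apply: le_trans (ler_norm_sum _ _ _) _; apply: ler_sum => i _.
rewrite !mxE /nsq; set a := Re _; set b := Im _; set c := Im _; set d := Re _.
have := key b a; have := key d c.
have := ler_normB (2 * (b * a)) (2 * (d * c)).
have -> : 2 * (b * a) - 2 * (d * c) = 2 * (a * b - c * d) by ring.
lra.
Qed.

Lemma Qf_le z : `|Qf z| <= sqn z.
Proof.
by have := @Qf_young z 1 ltr01; rewrite invr1 !mul1r -sqn_split.
Qed.

End Hamiltonian.

Section EntryBounds.
Variables (R : realType) (Om : topologicalType).
Local Notation C := R[i].

Lemma mx_continuous_entry m k (M : Om -> 'M[R]_(m, k)) i j :
  continuous M -> continuous (fun w => M w i j).
Proof. by move=> cM w; have /cvg_mx_entries := cM w; apply. Qed.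

Lemma mx_bounded m k (M : Om -> 'M[R]_(m, k)) : compact [set: Om] ->
  (forall i j, continuous (fun w => M w i j)) ->
  exists2 c, 0 <= c & forall w i j, `|M w i j| <= c.
Proof.
move=> cO cM.
have [b hb] : {b : 'I_m * 'I_k -> R & forall p w, `|M w p.1 p.2| <= b p}.
  apply: (@choice _ _ (fun p b => forall w, `|M w p.1 p.2| <= b)) => -[i j].
  exact: compact_bounded_fun.
exists (\sum_p `|b p|) => [|w i j]; first by apply: sumr_ge0.
apply: le_trans (hb (i, j) w) _; apply: le_trans (ler_norm _) _.
by rewrite (bigD1 (i, j)) //= lerDl sumr_ge0.
Qed.

End EntryBounds.

Section HamiltonianEntries.
Variables (R : realType) (Om : metricType R) (n : nat).
Variables (H : Om -> 'M[R]_(n + n)) (Delta : Om -> 'M[R]_n).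
Local Notation C := R[i].
Local Notation A := (hamiltonian_family H Delta).

Lemma hamiltonian_entry_diff (e h : R) (l l' : C) w w' : 0 <= h ->
  (forall i j, (H w i j - H w' i j) ^+ 2 <= e) ->
  (forall i j, (Delta w i j - Delta w' i j) ^+ 2 <= e) ->
  (forall i j, Delta w' i j ^+ 2 <= h) ->
  forall i j, nsq (A l w i j - A l' w' i j) <=
    4 * (1 + nsq l) * e + 4 * nsq (l - l') * h.
Proof.
move=> h0 hH hD Dh i j.
have e0 : 0 <= e by apply: le_trans (sqr_ge0 _) (hH i j).
have l0 := nsq_ge0 l; have ll0 := nsq_ge0 (l - l').
have le0 := mulr_ge0 l0 e0; have lh0 := mulr_ge0 ll0 h0.
have small (x : R) : x ^+ 2 <= e ->
    x ^+ 2 <= 4 * (1 + nsq l) * e + 4 * nsq (l - l') * h.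
  by move=> xe; lra.
rewrite /hamiltonian_family.
have [i' ->|i' ->] := split_ordP i; have [j' ->|j' ->] := split_ordP j.
- rewrite !block_mxEul !toCE !mxE -rmorphB nsq_real; exact: small.
- rewrite !block_mxEur !mxE.
  set x := H w _ _; set y := Delta w _ _; set x' := H w' _ _; set y' := Delta w' _ _.
  have -> : x%:C%C + l * y%:C%C - (x'%:C%C + l' * y'%:C%C) =
      (x - x')%:C%C + (l * (y - y')%:C%C + (l - l') * y'%:C%C).
    by rewrite !rmorphB /=; ring.
  apply: le_trans (nsqD _ _) _.
  have h2 := nsqD (l * (y - y')%:C%C) ((l - l') * y'%:C%C).
  rewrite !nsqM !nsq_real in h2; rewrite nsq_real.
  have h3 : (x - x') ^+ 2 <= e by exact: hH.
  have h4 : nsq l * (y - y') ^+ 2 <= nsq l * e by rewrite ler_wpM2l // hD.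
  have h5 : nsq (l - l') * y' ^+ 2 <= nsq (l - l') * h by rewrite ler_wpM2l // Dh.
  lra.
- rewrite !block_mxEdl !toCE !mxE -rmorphB nsq_real; exact: small.
- rewrite !block_mxEdr !mxE -opprD -rmorphB /= nsqN nsq_real; exact: small.
Qed.

Lemma hamiltonian_entry_bound (h : R) (l : C) w :
  (forall i j, H w i j ^+ 2 <= h) -> (forall i j, Delta w i j ^+ 2 <= h) ->
  forall i j, nsq (A l w i j) <= 2 * (1 + nsq l) * h.
Proof.
move=> hH hD i j; have l0 := nsq_ge0 l.
have h0 : 0 <= h by apply: le_trans (sqr_ge0 _) (hH i j).
have lh := mulr_ge0 l0 h0.
have small (x : R) : x ^+ 2 <= h -> x ^+ 2 <= 2 * (1 + nsq l) * h.
  by move=> xe; lra.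
rewrite /hamiltonian_family.
have [i' ->|i' ->] := split_ordP i; have [j' ->|j' ->] := split_ordP j.
- rewrite !block_mxEul !toCE !mxE nsq_real; exact: small.
- rewrite !block_mxEur !mxE; apply: le_trans (nsqD _ _) _.
  rewrite nsqM !nsq_real.
  have h3 : H w (lshift n i') (rshift n j') ^+ 2 <= h by exact: hH.
  have h4 : nsq l * Delta w i' j' ^+ 2 <= nsq l * h by rewrite ler_wpM2l // hD.
  lra.
- rewrite !block_mxEdl !toCE !mxE nsq_real; exact: small.
- rewrite !block_mxEdr !mxE nsqN nsq_real; exact: small.
Qed.

End HamiltonianEntries.

(** * Decay of sequences and functions *)

Section Sequences.
Variable R : realType.

(** A step lowers [v] by a quarter of [N], hence by at least the fraction 1/(4c) of itself. Since
    [v j.+1] is still nonnegative, [N j <= 4 * v j]; this use of the next value is why [j] stays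
    strictly below [k]. *)
Lemma lyapunov_decay (c : R) : 1 <= c -> exists2 th, 0 < th < 1 &
  forall (N v : nat -> R) k,
    (forall j, 0 <= N j) -> (forall j, v j.+1 <= v j - 4^-1 * N j) ->
    (forall j, v j <= c * N j) -> (forall j, (j <= k)%N -> 0 <= v j) ->
    forall j, (j < k)%N -> N j <= 4 * c * th ^+ j * N 0%N.
Proof.
move=> c1; have c0 : 0 < c by apply: lt_le_trans c1.
pose th := 1 - (4 * c)^-1.
have ic : 0 < (4 * c)^-1 <= 4^-1.
  rewrite invr_gt0 mulr_gt0 //= lef_pV2 ?posrE ?mulr_gt0 //; lra.
have th01 : 0 < th < 1 by rewrite /th; move/andP: ic => [a b]; apply/andP; split; lra.
exists th => // N v k N0 hv vN v0 j jk.
have vdec i : (i < k)%N -> v i.+1 <= th * v i.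
  move=> ik; apply: le_trans (hv i) _.
  have : (4 * c)^-1 * v i <= 4^-1 * N i.
    have -> : 4^-1 * N i = (4 * c)^-1 * (c * N i) by field; exact: lt0r_neq0.
    by rewrite ler_wpM2l // invr_ge0 mulr_ge0 // ltW.
  rewrite /th mulrBl mul1r; lra.
have vth i : (i <= k)%N -> v i <= th ^+ i * v 0%N.
  elim: i => [|i IH] ik; first by rewrite mul1r.
  apply: le_trans (vdec i ik) _; rewrite exprS -mulrA ler_wpM2l ?IH ?(ltnW ik) //.
  by case/andP: th01 => /ltW.
have h1 := hv j; have h2 := v0 j.+1 jk; have h3 := vth j (ltnW jk).
have h4 : th ^+ j * v 0%N <= th ^+ j * (c * N 0%N).
  by rewrite ler_wpM2l ?vN // exprn_ge0 //; case/andP: th01 => /ltW.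
have -> : 4 * c * th ^+ j * N 0%N = 4 * (th ^+ j * (c * N 0%N)) by ring.
lra.
Qed.

(** Here [j] is [t / T] rounded down, and the factor [th^-1] pays for the rounding. *)
Lemma exp_decay_of_geometric (th T : R) : 0 < th < 1 -> 0 < T ->
  exists2 b, 0 < b & forall t : R, 0 <= t -> exists (j : nat) r,
    [/\ 0 <= r, r <= T, t = r + j%:R * T & th ^+ j <= th^-1 * expR (- b * t)].
Proof.
move=> /andP[th0 th1] T0; exists (- (ln th) / T).
  by rewrite divr_gt0 // oppr_gt0 ln_lt0 // th0 th1.
move=> t t0; have tT : 0 <= t / T by rewrite divr_ge0 // ltW.
exists (Num.truncn (t / T)), (t - (Num.truncn (t / T))%:R * T).
have /andP[j1 j2] := truncn_itv tT.
set j := Num.truncn _ in j1 j2 *.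
split.
- by rewrite subr_ge0 -ler_pdivlMr.
- rewrite lerBlDr -[X in X + _]mul1r -mulrDl -ler_pdivrMr //.
  by rewrite addrC -natr1 in j2 *; exact: ltW.
- by rewrite subrK.
have lth : ln th < 0 by rewrite ln_lt0 // th0 th1.
rewrite -{1 2}(lnK th0) -expRN -expRM_natl -expRD ler_expR.
have -> : - (- ln th / T) * t = ln th * (t / T) by ring.
rewrite -natr1 in j2.
have : 0 <= - ln th * (j%:R + 1 - t / T).
  by rewrite mulr_ge0 ?oppr_ge0 ?subr_ge0 ?(ltW lth) ?(ltW j2).
rewrite mulrBr mulrDr; lra.
Qed.

End Sequences.

Section StepDichotomy.
Variables (R : realType) (Om : metricType R) (s : R -> Om -> Om) (m : nat).
Local Notation C := R[i].

(* What is needed of an exponential dichotomy: projections onto the two bundles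
   and the contraction and expansion over one large time step [T]. *)
Definition step_dichotomy (A : Om -> 'M[C]_m) (T c : R)
    (Pp Pm : Om -> 'cV[C]_m -> 'cV[C]_m) : Prop :=
  [/\ forall w x y, Pp w (x + y) = Pp w x + Pp w y /\ Pm w (x + y) = Pm w x + Pm w y,
      forall w x, Pp w x + Pm w x = x,
      forall w x, sqn (Pp w x) <= c * sqn x /\ sqn (Pm w x) <= c * sqn x
    & forall w y, linsol (fun t => A (s t w)) y ->
        sqn (Pp (s T w) (y T)) <= 8^-1 * sqn (Pp w (y 0)) /\
        8 * sqn (Pm w (y 0)) <= sqn (Pm (s T w) (y T))].

(** Plain convergence to 0 at +oo; the exponential rate is recovered in [weyl_plus_uniform]. *)
Definition decays (z : R -> 'cV[C]_m) : Prop :=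
  forall e : R, 0 < e -> exists t0, forall t, t0 <= t -> sqn (z t) < e.

End StepDichotomy.

Section Limits.
Variable R : realType.
Local Notation C := R[i].

Lemma cauchy_mx_cvg (T : Type) (F : set_system T) (m k : nat)
    (f : T -> 'M[C]_(m, k)) : ProperFilter F ->
  (forall e : R, 0 < e -> exists2 A : set T, F A &
     forall x y, A x -> A y -> forall i j, nsq (f x i j - f y i j) < e) ->
  cvg (f x @[x --> F]).
Proof.
move=> FF h.
have key (p : C -> R) i j : (forall x, p x ^+ 2 <= nsq x) ->
    (forall x y, p (x - y) = p x - p y) -> exists l : R, p (f x i j) @[x --> F] --> l.
  move=> p1 p2.
  suff /cvg_ex [l hl] : cvg (p (f x i j) @[x --> F]) by exists l.
  apply: cauchy_cvg; apply: cauchy_exP => e e0.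
  have [A FA hA] := h _ (exprn_gt0 2 e0); have [x0 Ax0] := filter_ex FA.
  exists (p (f x0 i j)).
  suff : F [set x | ball (p (f x0 i j)) e (p (f x i j))] by [].
  apply: filterS FA => x Ax; rewrite /= -ball_normE /ball_ /= -p2.
  rewrite -ltr_sqr ?nnegrE ?(ltW e0) // real_normK ?num_real //.
  by apply: le_lt_trans (p1 _) _; exact: hA.
have [L hL] : {L : 'I_m * 'I_k -> C & forall ij, f x ij.1 ij.2 @[x --> F] --> L ij}.
  apply: (@choice _ _ (fun ij l => f x ij.1 ij.2 @[x --> F] --> l)) => -[i j].
  have [|x y|a ha] := @key (@complex.Re R) i j; [by move=> x; rewrite lerDl sqr_ge0 | exact: cReB |].
  have [|x y|b hb] := @key (@complex.Im R) i j; [by move=> x; rewrite lerDr sqr_ge0 | exact: cImB |].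
  by exists (Complex a b); apply/cvgC_ReIm.
apply/cvg_ex; exists (\matrix_(i, j) L (i, j)); apply/cvg_mx_entries => i j.
by rewrite mxE; exact: hL (i, j).
Qed.

(** Compare [F] and [- F] on [[S, t]] with the primitive [- (X / b) * expR (- b * u)] of the bound,
    for [t] so large that [F t] is negligible. *)
Lemma tail_bound (F dF : R -> R) (X b S : R) : 0 < b -> 0 <= X -> 0 <= S ->
  (forall t : R, is_derive t 1 F (dF t)) ->
  (forall t, 0 <= t -> `|dF t| <= X * expR (- b * t)) ->
  (forall e : R, 0 < e -> exists t0, forall t, t0 <= t -> `|F t| < e) ->
  `|F S| <= X / b * expR (- b * S).
Proof.
move=> b0 X0 S0 hF hd hl; apply/ler_addgt0Pr => e e0.
have [t0 ht] := hl e e0; pose t := Num.max t0 S.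
have St : S <= t by rewrite le_max lexx orbT.
have Ft : `|F t| < e by apply: ht; rewrite le_max lexx.
have hE (u : R) : is_derive u 1 (fun u => - (X / b) * expR (- b * u)) (X * expR (- b * u)).
  have := rderivZ (- (X / b)) (rderiv_expM (- b) u); congr is_derive.
  by field; exact: lt0r_neq0.
have pos u : S <= u <= t -> 0 <= u by case/andP => Su _; exact: le_trans Su.
have g1 : F t - F S <= - (X / b) * expR (- b * t) - - (X / b) * expR (- b * S).
  apply: (deriv_le_le St (fun u _ => hF u) (fun u _ => hE u)) => u ut.
  exact: le_trans (ler_norm _) (hd u (pos u ut)).
have g2 : - F t - - F S <= - (X / b) * expR (- b * t) - - (X / b) * expR (- b * S).
  apply: (deriv_le_le St (fun u _ => rderivN (hF u)) (fun u _ => hE u)) => u ut.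
  by apply: le_trans (hd u (pos u ut)); rewrite -normrN ler_norm.
have g3 : 0 <= X / b * expR (- b * t) by rewrite mulr_ge0 ?expR_ge0 // divr_ge0 // ltW.
move: Ft; rewrite ltr_norml ler_norml => /andP[k1 k2]; apply/andP; split; lra.
Qed.

(** The final count in [weyl_quotient_cauchy]: a quarter of [r] for each of the two tails beyond
    [S], and a quarter for the increment on [[0, S]]. *)
Lemma norm_le_of_increment (F0 FS x y d r : R) : `|x| <= r / 4 -> `|y| <= r / 4 ->
  FS = x - y -> FS - F0 <= d -> - FS - - F0 <= d -> d <= r / 4 -> `|F0| <= r.
Proof.
rewrite !ler_norml => /andP[a1 a2] /andP[a3 a4] e f1 f2 dr.
by apply/andP; split; lra.
Qed.

End Limits.

(** * The monotone form *)

Section MonotoneFamily.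
Variables (R : realType) (Om : metricType R) (s : R -> Om -> Om) (n : nat).
Variables (H : Om -> 'M[R]_(n + n)) (Delta : Om -> 'M[R]_n).
Hypothesis Om_compact : compact [set: Om].
Hypothesis s_flow : continuous_flow s.
Hypothesis H_cont : continuous H.
Hypothesis H_sp : forall w, in_sp (H w).
Hypothesis Delta_cont : continuous Delta.
Hypothesis Delta_sym : forall w, (Delta w)^T = Delta w.
Hypothesis Delta_pos : forall w, posdef (Delta w).
Local Notation C := R[i].
Local Notation Re := (@complex.Re R).
Local Notation Im := (@complex.Im R).
Local Notation A := (hamiltonian_family H Delta).
Local Notation sol l w Z := (linsol (fun t => A l (s t w)) Z).
Local Notation vec := 'cV[C]_(n + n).

Lemma flow0 w : s 0 w = w. Proof. by case: s_flow. Qed.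
Lemma flowD t u w : s (t + u) w = s t (s u w). Proof. by case: s_flow. Qed.

Lemma flow_orbit_continuous w : continuous (fun t => s t w).
Proof.
move=> t; have [c _ _] := s_flow.
apply: (@continuous_comp _ _ _ (fun u : R => (u, w)) (fun p => s p.1 p.2)).
  exact: (@cvg_pair _ _ _ (nbhs t) (nbhs t) (nbhs w) _ _ _ (fun u => u) (fun=> w) cvg_id (cvg_cst w)).
exact: c.
Qed.

Lemma family_bounds : exists2 h, 0 <= h & forall w,
  (forall i j, H w i j ^+ 2 <= h) /\ (forall i j, Delta w i j ^+ 2 <= h).
Proof.
have [a a0 Ha] := mx_bounded Om_compact (fun i j => mx_continuous_entry (i:=i) (j:=j) H_cont).
have [b b0 Hb] := mx_bounded Om_compact (fun i j => mx_continuous_entry (i:=i) (j:=j) Delta_cont).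
exists (a ^+ 2 + b ^+ 2) => [|w]; first by rewrite addr_ge0 // sqr_ge0.
split=> i j; rewrite -[X in X <= _]real_normK ?num_real //.
  by apply: (@le_trans _ _ (a ^+ 2)); rewrite ?lerDl ?sqr_ge0 // ler_sqr ?nnegrE.
by apply: (@le_trans _ _ (b ^+ 2)); rewrite ?lerDr ?sqr_ge0 // ler_sqr ?nnegrE.
Qed.

Lemma hamiltonian_bound (B : R) : 0 <= B -> exists2 c, 0 <= c &
  forall l, nsq l <= B -> forall w i j, nsq (A l w i j) <= c.
Proof.
move=> B0; have [h h0 hh] := family_bounds.
exists (2 * (1 + B) * h) => [|l lB w i j].
  by rewrite !mulr_ge0 // addr_ge0.
have [a b] := hh w; apply: le_trans (hamiltonian_entry_bound l a b i j) _.
by rewrite ler_wpM2r // ler_wpM2l // lerD2l.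
Qed.

Lemma hamiltonian_cont l w : cont_entries (fun t => A l (s t w)).
Proof.
have cH i j : continuous (fun t : R => H (s t w) i j).
  move=> t; apply: (@continuous_comp _ _ _ (s ^~ w) (fun w => H w i j)).
    exact: flow_orbit_continuous.
  exact: mx_continuous_entry.
have cD i j : continuous (fun t : R => Delta (s t w) i j).
  move=> t; apply: (@continuous_comp _ _ _ (s ^~ w) (fun w => Delta w i j)).
    exact: flow_orbit_continuous.
  exact: mx_continuous_entry.
have c0 : continuous (fun _ : R => 0 : R) by move=> t; exact: cvg_cst.
move=> i j; rewrite /hamiltonian_family.
have [i' ->|i' ->] := split_ordP i; have [j' ->|j' ->] := split_ordP j.
- by split; under eq_fun do rewrite block_mxEul !mxE /=; [exact: cH | exact: c0].
- split; under eq_fun do rewrite block_mxEur !mxE ?cReD ?cImD ?cReM ?cImM /= ?mulr0 ?subr0 ?add0r.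
    move=> t; apply: cvgD; first exact: cH.
    by apply: cvgM; [exact: cvg_cst | exact: cD].
  by move=> t; apply: cvgM; [exact: cvg_cst | exact: cD].
- by split; under eq_fun do rewrite block_mxEdl !mxE /=; [exact: cH | exact: c0].
- split; under eq_fun do rewrite block_mxEdr !mxE ?cReN ?cImN /=.
    by move=> t; apply: cvgN; exact: cH.
  by move=> t; apply: cvgN; exact: c0.
Qed.

Lemma sol_exists k l w (Z0 : 'M[C]_(n + n, k)) : exists Z, Z 0 = Z0 /\ sol l w Z.
Proof.
have [c _ hc] := hamiltonian_bound (nsq_ge0 l).
by apply: linsol_exists (hamiltonian_cont l w) _ => t i j; apply: hc.
Qed.

Lemma sol_unique k l w (Z W : R -> 'M[C]_(n + n, k)) :
  sol l w Z -> sol l w W -> Z 0 = W 0 -> Z =1 W.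
Proof.
have [c _ hc] := hamiltonian_bound (nsq_ge0 l).
by apply: linsol_unique => t i j; apply: hc.
Qed.

Lemma sol_shift k l w (Z : R -> 'M[C]_(n + n, k)) (c : R) : sol l w Z ->
  sol l (s c w) (fun t => Z (t + c)).
Proof.
move=> h; have := linsol_shift c h.
by under [X in linsol X]eq_fun do rewrite flowD.
Qed.

Lemma sol_growth (B : R) : 0 <= B -> exists2 L, 0 <= L &
  forall l w (z : R -> 'cV[C]_(n + n)) t, nsq l <= B -> 0 <= t -> sol l w z ->
    sqn (z t) <= expR (L * t) * sqn (z 0).
Proof.
move=> B0; have [c c0 hc] := hamiltonian_bound B0.
exists (2 + ((n + n) * (n + n))%:R * c) => [|l w z t lB t0 hz].
  by rewrite addr_ge0 // mulr_ge0.
by apply: linsol_growth c0 t0 _ hz => u i j; apply: hc.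
Qed.

Lemma Delta_coercive : exists2 c, 0 < c &
  forall w (x : 'cV[C]_n), sqn x <= c * dform (Delta w) x.
Proof.
have ci i j : continuous (fun w => invmx (Delta w) i j).
  move=> w; apply: cvg_invmx => [w'||k l]; try exact: posdef_unit.
  exact: mx_continuous_entry.
have [c c0 hc] := mx_bounded Om_compact ci.
exists (c * n%:R + 1) => [|w x]; first by rewrite ltr_pwDr // mulr_ge0.
have q0 y : 0 <= qform (Delta w) y y.
  have [->|/(Delta_pos w).2/ltW//] := eqVneq y 0; by rewrite /qform mulmx0 mxE.
rewrite dformE mulrDl mul1r.
have h1 := posdef_coercive (map_mx Re x) (Delta_pos w) (hc w).
have h2 := posdef_coercive (map_mx Im x) (Delta_pos w) (hc w).
have -> : sqn x = \sum_i (map_mx Re x) i 0 ^+ 2 + \sum_i (map_mx Im x) i 0 ^+ 2.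
  by rewrite -big_split; apply: eq_bigr => i _; rewrite !mxE.
have h3 := q0 (map_mx Re x); have h4 := q0 (map_mx Im x).
rewrite mulrDr; lra.
Qed.

Definition Qs (l : C) (z : 'cV[C]_(n + n)) : R := Num.sg (Im l) * Qf z.

Lemma Qs_derive l w (z : R -> 'cV[C]_(n + n)) : sol l w z ->
  forall t : R, is_derive t 1 (fun u => Qs l (z u))
    (2 * `|Im l| * dform (Delta (s t w)) (dsubmx (z t))).
Proof.
move=> h t; have := rderivZ (Num.sg (Im l)) (Qf_derive H_sp Delta_sym h t).
congr is_derive.
by rewrite normrEsg; ring.
Qed.

Lemma Qs_le l z : `|Qs l z| <= sqn z.
Proof.
rewrite /Qs normrM normr_sg; case: eqP => _ /=.
  by rewrite mul0r sqn_ge0.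
by rewrite mul1r Qf_le.
Qed.

Lemma dform_ge0 w (x : 'cV[C]_n) : 0 <= dform (Delta w) x.
Proof.
rewrite dformE addr_ge0 //; set y := map_mx _ _.
  have [->|/(Delta_pos w).2/ltW//] := eqVneq y 0; by rewrite /qform mulmx0 mxE.
have [->|/(Delta_pos w).2/ltW//] := eqVneq y 0; by rewrite /qform mulmx0 mxE.
Qed.

Lemma Qs_mono l w (z : R -> 'cV[C]_(n + n)) t u : sol l w z -> t <= u ->
  Qs l (z t) <= Qs l (z u).
Proof.
move=> h tu; apply: (deriv_ge0_le tu (fun t _ => Qs_derive h t)) => v _.
by rewrite !mulr_ge0 ?dform_ge0.
Qed.

(** The parameter regions on which constants are uniform; each nonreal parameter has a neighbourhood
    inside one of them, by [near_Lam]. *)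
Definition Lam (b0 B : R) (l : C) : Prop := b0 <= `|Im l| /\ nsq l <= B.

Section Uniform.
Variables (b0 B : R).
Hypotheses (b0_gt0 : 0 < b0) (B_ge0 : 0 <= B).

Lemma second_component_le : exists2 k, 0 < k & forall l w (x : 'cV[C]_n),
  Lam b0 B l -> sqn x <= k * (2 * `|Im l| * dform (Delta w) x).
Proof.
have [c c0 hc] := Delta_coercive.
exists (c / (2 * b0)) => [|l w x [lb _]]; first by rewrite divr_gt0 // mulr_gt0.
apply: le_trans (hc w x) _; set d := dform _ _; have d0 : 0 <= d := dform_ge0 w x.
have -> : c / (2 * b0) * (2 * `|Im l| * d) = c * d * (`|Im l| / b0).
  by field; exact: lt0r_neq0.
rewrite ler_peMr ?mulr_ge0 ?(ltW c0) //.
by rewrite ler_pdivlMr // mul1r.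
Qed.

(* Integrate the derivative of (T - t) |z2(t)|^2 over [0, T]. *)
Lemma graph_estimate (T : R) : 0 < T -> exists2 K, 0 <= K &
  forall l w (z : R -> 'cV[C]_(n + n)), Lam b0 B l -> sol l w z ->
  sqn (dsubmx (z 0)) <= 4^-1 * sqn (z 0) + K * (Qs l (z T) - Qs l (z 0)).
Proof.
move=> T0; have [k k0 hk] := second_component_le.
have [L L0 hL] := sol_growth B_ge0.
have [c c0 hc] := hamiltonian_bound B_ge0.
pose m := ((n + n) * (n + n))%:R * c.
have m0 : 0 <= m by rewrite mulr_ge0.
pose E := m * expR (L * T).
have E0 : 0 <= E by rewrite mulr_ge0 ?expR_ge0.
(* [E] bounds the squared derivative of z2 relative to [sqn (z 0)]. This Young weight makes the
   resulting error [T * e * E] at most 1/4. *)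
pose e := (4 * T * E + 4)^-1.
have e0 : 0 < e by rewrite invr_gt0 ltr_wpDl // mulr_ge0 // mulr_ge0 // ltW.
have eE : T * e * E <= 4^-1.
  have p0 : 0 < 4 * T * E + 4 by rewrite ltr_wpDl // mulr_ge0 // mulr_ge0 // ltW.
  rewrite /e mulrAC ler_pdivrMr //.
  have : 0 <= T * E by rewrite mulr_ge0 // ltW.
  lra.
have K0 : 0 <= (1 + T / e) * k / T.
  rewrite ltW // divr_gt0 // mulr_gt0 // addr_gt0 // divr_gt0 //.
exists ((1 + T / e) * k / T) => // l w z ll hz.
pose dQ t := 2 * `|Im l| * dform (Delta (s t w)) (dsubmx (z t)).
pose psi t := (T - t) * sqn (dsubmx (z t)) + ((1 + T / e) * k * Qs l (z t) + T * e * E * sqn (z 0) * t).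
pose D t := dsubmx (A l (s t w) *m z t).
pose dpsi t := ((-1) * sqn (dsubmx (z t)) + (T - t) * (2 * rdot (dsubmx (z t)) (D t)))
   + ((1 + T / e) * k * dQ t + T * e * E * sqn (z 0) * 1).
have hpsi (t : R) : is_derive t 1 psi (dpsi t).
  apply: rderivD.
    apply: rderivM; first by have := rderivB (rderiv_cst T t) (is_derive_id t 1); rewrite sub0r.
    exact: sqn_derive (tderive_dsub (hz t)).
  apply: rderivD; apply: rderivZ; exact: Qs_derive.
have : psi 0 <= psi T.
  apply: (deriv_ge0_le (ltW T0) (fun t _ => hpsi t)) => t /andP[t0 tT].
  have h1 := hk l (s t w) (dsubmx (z t)) ll; rewrite -/(dQ t) in h1.
  have h2 : sqn (D t) <= E * sqn (z 0).
    apply: (@le_trans _ _ (sqn (A l (s t w) *m z t))).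
      by rewrite [X in _ <= X]sqn_split lerDr sqn_ge0.
    apply: le_trans (sqn_mulmx (z t) (hc l ll.2 (s t w))) _; rewrite -/m /E -mulrA ler_wpM2l //.
    apply: le_trans (hL l w z t ll.2 t0 hz) _; rewrite ler_wpM2r ?sqn_ge0 //.
    by rewrite ler_expR ler_wpM2l.
  have ie0 : 0 < e^-1 by rewrite invr_gt0.
  have h3 := rdot_youngN (dsubmx (z t)) (D t) ie0; rewrite invrK in h3.
  rewrite /dpsi.
  have q0 := sqn_ge0 (dsubmx (z t)); have D0 := sqn_ge0 (D t).
  move: h1 h2 h3 q0 D0; move: (sqn _) (sqn (D t)) (rdot _ _) (sqn (z 0)) (dQ t).
  move=> x y r z0 d h1 h2 h3 x0 y0.
  have g1 : (T - t) * (2 * r) >= - (T * (e^-1 * x + e * y)).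
    have g0 : (T - t) * (- (2 * r)) <= (T - t) * (e^-1 * x + e * y).
      by rewrite ler_wpM2l // subr_ge0.
    have g2 : (T - t) * (e^-1 * x + e * y) <= T * (e^-1 * x + e * y).
      by rewrite ler_wpM2r // ?gerBl // addr_ge0 // mulr_ge0 // ltW.
    lra.
  have g3 : T * (e * y) <= T * e * E * z0.
    by rewrite mulrA -[X in _ <= X]mulrA ler_wpM2l // ltW // mulr_gt0.
  have g4 : (1 + T / e) * x <= (1 + T / e) * (k * d).
    by rewrite ler_wpM2l // addr_ge0 // mulr_ge0 ?(ltW T0) // ltW.
  move: g1 g3 g4; rewrite !mulrDr !mulrDl !mul1r mulr1 !mulrA; lra.
rewrite /psi subrr mul0r add0r subr0 mulr0 addr0 => h.
rewrite -(ler_pM2l T0) mulrDr.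
have g1 : T * e * E * sqn (z 0) * T <= T * (4^-1 * sqn (z 0)).
  rewrite mulrC ler_pM2l // ler_wpM2r ?sqn_ge0 //.
have -> : T * ((1 + T / e) * k / T * (Qs l (z T) - Qs l (z 0))) =
  (1 + T / e) * k * (Qs l (z T) - Qs l (z 0)).
  by field; rewrite !lt0r_neq0.
rewrite mulrBr; lra.
Qed.

(* The difference z - y is driven by (l - l0) Delta z2, whose square is bounded by
   a multiple of the derivative of [Qs]. *)
Lemma perturbation_estimate (l0 : C) (T : R) : 0 <= T -> exists2 K, 0 <= K &
  forall l w (z y : R -> 'cV[C]_(n + n)), Lam b0 B l -> sol l w z ->
    sol l0 w y -> y 0 = z 0 ->
  sqn (z T - y T) <= K * (Qs l (z T) - Qs l (z 0)).
Proof.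
move=> T0; have [k k0 hk] := second_component_le.
have [c c0 hc] := hamiltonian_bound (nsq_ge0 l0).
have [h h0 hh] := family_bounds.
(* The factors bound |l - l0|^2, the action of [Delta] on squared norms, and |z2|^2 by the
   derivative of [Qs]. *)
pose b := 2 * (B + nsq l0) * ((n * n)%:R * h) * k.
have b'0 : 0 <= 2 * (B + nsq l0) * ((n * n)%:R * h).
  by rewrite !mulr_ge0 // addr_ge0 // nsq_ge0.
have b_ge0 : 0 <= b by rewrite mulr_ge0 // ltW.
exists (expR ((2 + ((n + n) * (n + n))%:R * c) * T) * b) => [|l w z y ll hz hy e0].
  by rewrite mulr_ge0 ?expR_ge0.
pose f u := (A l (s u w) - A l0 (s u w)) *m z u.
have := @forced_growth _ _ (fun u => A l0 (s u w)) c b T (fun u => z u - y u) f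
  (fun u => Qs l (z u)) (fun u => 2 * `|Im l| * dform (Delta (s u w)) (dsubmx (z u)))
  c0 b_ge0 T0.
rewrite e0 subrr sqn0 add0r mulrA; apply => [u i j|u|u _|u _|u _].
- exact: hc.
- have := tderiveB (hz u) (hy u); congr is_tderive.
  by rewrite /f mulmxBr mulmxBl [RHS]addrC subrKA.
- exact: Qs_derive.
- by rewrite !mulr_ge0 ?dform_ge0.
have -> : f u = col_mx ((l - l0) *: (toC (Delta (s u w)) *m dsubmx (z u))) 0.
  rewrite /f mulmxBl !hamiltonian_mulmx opp_col_mx add_col_mx subrr.
  by rewrite opprD addrACA subrr add0r scalerBl.
rewrite sqn_col_mx sqn0 addr0 sqnZ.
have n1 : nsq (l - l0) <= 2 * (B + nsq l0).
  have := nsqD l (- l0); rewrite nsqN; have := ll.2; lra.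
have n2 : sqn (toC (Delta (s u w)) *m dsubmx (z u)) <= (n * n)%:R * h * sqn (dsubmx (z u)).
  by apply: sqn_mulmx => i j; rewrite toCE nsq_real; exact: (hh _).2.
have n3 := hk l (s u w) (dsubmx (z u)) ll.
apply: le_trans (ler_pM (nsq_ge0 _) (sqn_ge0 _) n1 n2) _.
by rewrite [X in X <= _]mulrA /b -[X in _ <= X]mulrA ler_wpM2l.
Qed.

End Uniform.

(** * The Weyl function at +oo *)

Section WeylPlus.
Variables (l0 : C) (T c : R) (Pp Pm : Om -> vec -> vec).
Hypothesis T_gt0 : 0 < T.
Hypothesis c_ge0 : 0 <= c.
Hypothesis step : step_dichotomy s (A l0) T c Pp Pm.

Definition lyap (K : R) (l : C) (w : Om) (z : vec) : R :=
  K * Qs l z + (sqn (Pm w z) - sqn (Pp w z)).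

Lemma lyap_le K l w z : 0 <= K -> `|lyap K l w z| <= (K + c) * sqn z.
Proof.
move=> K0; have [_ _ /(_ w z) [hp hm] _] := step; rewrite mulrDl.
apply: le_trans (ler_normD _ _) _; apply: lerD.
  by rewrite normrM (ger0_norm K0) ler_wpM2l // Qs_le.
have := sqn_ge0 (Pm w z); have := sqn_ge0 (Pp w z).
by rewrite ler_norml => *; apply/andP; split; lra.
Qed.

Section Uniform.
Variables (b0 B : R).
Hypotheses (b0_gt0 : 0 < b0) (B_ge0 : 0 <= B).

Lemma lyap_step : exists2 K, c <= K & forall l w (z : R -> vec),
  Lam b0 B l -> sol l w z ->
  lyap K l w (z 0) + 4^-1 * sqn (z 0) <= lyap K l (s T w) (z T).
Proof.
have [K0 K00 hK] := perturbation_estimate b0_gt0 B_ge0 l0 (ltW T_gt0).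
(* Replacing [z T] by [y T] costs [2 * c] in the [Pp] term and [c] in the [Pm] term, times the
   squared distance, hence [3 * c * K0]. The additional [c] secures [c <= K] for [lyap_terminal]. *)
exists (3 * c * K0 + c) => [|l w z ll hz].
  by rewrite lerDr !mulr_ge0.
have [y [y0 hy]] := sol_exists l0 w (z 0).
have he := hK l w z y ll hz hy y0.
have [add pq bd st] := step; have [st1 st2] := st w y hy.
have zE : z T = y T + (z T - y T) by rewrite addrC subrK.
have [addp addm] := add (s T w) (y T) (z T - y T); rewrite -zE in addp addm.
have [bp bm] := bd (s T w) (z T - y T).
have p1 : sqn (Pp (s T w) (z T)) <= 2 * sqn (Pp (s T w) (y T)) + 2 * sqn (Pp (s T w) (z T - y T)).
  by rewrite addp sqnD.
have p2 : sqn (Pm (s T w) (y T)) <= 2 * sqn (Pm (s T w) (z T)) + 2 * sqn (Pm (s T w) (z T - y T)).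
  have -> : Pm (s T w) (y T) = Pm (s T w) (z T) - Pm (s T w) (z T - y T).
    by rewrite addm addrK.
  exact: sqnB.
have p3 : sqn (z 0) <= 2 * sqn (Pp w (z 0)) + 2 * sqn (Pm w (z 0)).
  by rewrite -{1}(pq w (z 0)) sqnD.
rewrite y0 in st1 st2.
have m1 : 0 <= Qs l (z T) - Qs l (z 0).
  by rewrite subr_ge0; apply: Qs_mono hz (ltW T_gt0).
have cQ : 0 <= c * (Qs l (z T) - Qs l (z 0)) by rewrite mulr_ge0.
have ce : c * sqn (z T - y T) <= c * (K0 * (Qs l (z T) - Qs l (z 0))).
  by rewrite ler_wpM2l.
have a1 := sqn_ge0 (Pp w (z 0)); have a2 := sqn_ge0 (Pm w (z 0)).
rewrite /lyap.
move: (sqn _) (sqn (Pm w (z 0))) (sqn (Pp w (z 0))) (sqn (Pp (s T w) (z T)))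
  (sqn (Pm (s T w) (z T))) (sqn (Pp (s T w) (y T))) (sqn (Pm (s T w) (y T)))
  (sqn (Pp (s T w) (z T - y T))) (sqn (Pm (s T w) (z T - y T))) (sqn (z T - y T))
  (Qs l (z T)) (Qs l (z 0)) he st1 st2 bp bm p1 p2 p3 m1 cQ ce a1 a2.
move=> *; lra.
Qed.

Lemma lyap_step_at K : (forall l w (z : R -> vec), Lam b0 B l -> sol l w z ->
    lyap K l w (z 0) + 4^-1 * sqn (z 0) <= lyap K l (s T w) (z T)) ->
  forall l w (z : R -> vec) t, Lam b0 B l -> sol l w z ->
    lyap K l (s t w) (z t) + 4^-1 * sqn (z t) <= lyap K l (s (t + T) w) (z (t + T)).
Proof.
move=> h l w z t ll hz; have := h l (s t w) _ ll (sol_shift t hz).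
by rewrite add0r -flowD [T + t]addrC.
Qed.

(** As [Qs] is nonpositive at time [T], its increase is at most [- Qs l (z 0)]. [Qf_young] with
    [e = 4 * K + 1] puts the weight [K / e <= 1/4] on |z2(0)|^2; together with the 1/4 of
    [graph_estimate], half of |z2(0)|^2 is absorbed. *)
Lemma graph_bound : exists2 K, 0 <= K & forall l w (z : R -> vec),
  Lam b0 B l -> sol l w z -> Qs l (z T) <= 0 ->
  sqn (dsubmx (z 0)) <= K * sqn (usubmx (z 0)).
Proof.
have [K K0 hK] := graph_estimate b0_gt0 B_ge0 T_gt0.
pose e := 4 * K + 1; have e0 : 0 < e by rewrite ltr_wpDl // mulr_ge0.
exists (2 * (4^-1 + K * e)) => [|l w z ll hz zT].
  by rewrite !mulr_ge0 ?addr_ge0 ?mulr_ge0 // ltW.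
have := hK l w z ll hz; rewrite (sqn_split (z 0)).
have : - Qs l (z 0) <= e * sqn (usubmx (z 0)) + e^-1 * sqn (dsubmx (z 0)).
  apply: le_trans (ler_norm _) _; rewrite normrN /Qs normrM normr_sg.
  apply: le_trans (Qf_young (z 0) e0); rewrite ler_piMl //.
  by case: (_ != 0); rewrite ?lexx ?ler01.
have : K * e^-1 <= 4^-1 by rewrite ler_pdivrMr // /e; lra.
move=> h1 h2 h3.
have h4 : K * (Qs l (z T) - Qs l (z 0)) <= K * (e * sqn (usubmx (z 0)) + e^-1 * sqn (dsubmx (z 0))).
  by rewrite ler_wpM2l // (le_trans _ h2) // gerDr.
have h5 : K * e^-1 * sqn (dsubmx (z 0)) <= 4^-1 * sqn (dsubmx (z 0)).
  by rewrite ler_wpM2r // sqn_ge0.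
move: h3 h4 h5; rewrite !mulrDr !mulrDl !mulrA; lra.
Qed.

(** [Qs] vanishes when z1(0) = 0. Applied to the difference of two solutions with the same first
    component at 0, this bounds the difference of their slopes by the form at a later time. *)
Lemma graph_diff : exists2 K, 0 <= K & forall l w (z : R -> vec),
  Lam b0 B l -> sol l w z -> usubmx (z 0) = 0 ->
  forall t, T <= t -> sqn (dsubmx (z 0)) <= K * Qs l (z t).
Proof.
have [K K0 hK] := graph_estimate b0_gt0 B_ge0 T_gt0.
exists (2 * K) => [|l w z ll hz z1 t Tt]; first by rewrite mulr_ge0.
have := hK l w z ll hz; rewrite (sqn_split (z 0)) z1 sqn0 add0r.
have -> : Qs l (z 0) = 0.
  rewrite /Qs /Qf /bJ z1 mulmx0 /mxconj.
  have -> : usubmx (map_mx (@conjc R) (z 0)) = mxconj (usubmx (z 0)).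
    by apply/matrixP => i j; rewrite !mxE.
  by rewrite z1 /mxconj map_mx0 trmx0 mul0mx subrr mxE mulr0.
have h1 : K * Qs l (z T) <= K * Qs l (z t) by rewrite ler_wpM2l //; apply: Qs_mono hz Tt.
rewrite subr0; have := sqn_ge0 (dsubmx (z 0)); lra.
Qed.

(* On the terminal plane z2 = i sg(Im l) z1 the form [Qs] equals [- sqn]. *)
Definition terminal (l : C) (z : vec) : Prop :=
  dsubmx z = (Complex 0 (Num.sg (Im l))) *: usubmx z.

Lemma sgr_sqr l : Lam b0 B l -> Num.sg (Im l) * Num.sg (Im l) = 1.
Proof.
move=> [lb _]; rewrite -expr2 sqr_sg.
suff -> : Im l != 0 by [].
by rewrite -normr_gt0; apply: lt_le_trans lb.
Qed.

(** The contribution of [x] alone is [- sqn x], which absorbs the mixed terms. Hence [graph_diff]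
    can be exploited at a time when only one of the two solutions lies in the terminal plane and the
    other is small. *)
Lemma terminal_diff l (x y : vec) : Lam b0 B l -> terminal l x ->
  Qs l (x - y) <= 2 * sqn y.
Proof.
move=> /sgr_sqr g /matrixP hx.
rewrite /Qs QfE mulrA mulr_sumr (sqn_split y) /sqn -big_split /= mulr_sumr.
apply: ler_sum => i _; have := hx i 0; rewrite !mxE.
case: (x (rshift n i) 0) => a b; case: (x (lshift n i) 0) => p q.
rewrite /nsq; case: (y (rshift n i) 0) => a' b'; case: (y (lshift n i) 0) => p' q' /=.
case=> -> ->; rewrite !mul0r sub0r add0r.
move: g; move: (Num.sg _) => g gg.
have -> : g * 2 * ((- (g * q) - a') * (q - q') - (g * p - b') * (p - p')) =
  2 * (- (g * g) * q ^+ 2 + (g * g) * q * q' - g * a' * q + g * a' * q'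
   - (g * g) * p ^+ 2 + (g * g) * p * p' + g * b' * p - g * b' * p') by ring.
rewrite gg.
have g1 : g * g = 1 := gg.
have k1 := sqr_ge0 (2 * q - (q' - g * a')); have k2 := sqr_ge0 (2 * p - (p' + g * b')).
have k3 := sqr_ge0 (q' - g * a'); have k4 := sqr_ge0 (p' + g * b').
have e1 : (g * a') ^+ 2 = a' ^+ 2 by rewrite exprMn expr2 g1 mul1r.
have e2 : (g * b') ^+ 2 = b' ^+ 2 by rewrite exprMn expr2 g1 mul1r.
have k5 := sqr_ge0 (q' + g * a'); have k6 := sqr_ge0 (p' - g * b').
nra.
Qed.

Lemma terminal_Qs l (x : vec) : Lam b0 B l -> terminal l x -> Qs l x = - sqn x.
Proof.
move=> /sgr_sqr g /matrixP hx.
rewrite /Qs QfE mulrA mulr_sumr (sqn_split x) /sqn -big_split /= -sumrN.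
apply: eq_bigr => i _; have := hx i 0; rewrite !mxE.
rewrite /nsq; case: (x (rshift n i) 0) => a b; case: (x (lshift n i) 0) => p q /=.
case=> -> ->; rewrite !mul0r sub0r add0r.
move: g; move: (Num.sg _) => g gg.
have -> : g * 2 * (- (g * q) * q - g * p * p) = - 2 * (g * g) * (p ^+ 2 + q ^+ 2) by ring.
have -> : (- (g * q)) ^+ 2 + (g * p) ^+ 2 = (g * g) * (p ^+ 2 + q ^+ 2) by ring.
by rewrite gg; ring.
Qed.

(** The form contributes [- K * sqn z], which outweighs [sqn (Pm w z) <= c * sqn z]. *)
Lemma lyap_terminal K l w (z : vec) : Lam b0 B l -> c <= K -> terminal l z ->
  lyap K l w z <= 0.
Proof.
move=> ll cK hz; rewrite /lyap (terminal_Qs ll hz).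
have [_ _ /(_ w z) [_ hm] _] := step; have := sqn_ge0 (Pp w z).
have : c * sqn z <= K * sqn z by rewrite ler_wpM2r // sqn_ge0.
rewrite mulrN; lra.
Qed.

(** Minus the Lyapunov function decreases from step to step; being nonnegative at step [k], it is so
    at all earlier steps, and [lyapunov_decay] applies with constants independent of [k]. *)
Lemma discrete_decay : exists K th C1, [/\ c <= K, 0 < th < 1, 0 <= C1
  & forall l w (z : R -> vec), Lam b0 B l -> sol l w z -> forall k : nat,
    lyap K l (s (k%:R * T) w) (z (k%:R * T)) <= 0 -> forall j, (j < k)%N ->
    sqn (z (j%:R * T)) <= C1 * th ^+ j * sqn (z 0)].
Proof.
have [K cK hK] := lyap_step.
have K0 : 0 <= K := le_trans c_ge0 cK.
have [th th01 hth] := @lyapunov_decay R (K + c + 1) (ler_wpDl (addr_ge0 K0 c_ge0) (lexx 1)).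
exists K, th, (4 * (K + c + 1)); split => //.
  by rewrite mulr_ge0 // !addr_ge0.
move=> l w z ll hz k hk.
pose N j := sqn (z (j%:R * T)); pose v j := - lyap K l (s (j%:R * T) w) (z (j%:R * T)).
have hv j : v j.+1 <= v j - 4^-1 * N j.
  have := lyap_step_at hK (j%:R * T) ll hz.
  have -> : j%:R * T + T = j.+1%:R * T by rewrite -natr1 mulrDl mul1r.
  rewrite /v /N; lra.
have N0 j : 0 <= N j by exact: sqn_ge0.
have N00 : N 0%N = sqn (z 0) by rewrite /N mul0r.
move=> j jk; have := hth N v k N0 hv; rewrite N00; apply => // i.
  have := lyap_le l (s (i%:R * T) w) (z (i%:R * T)) K0.
  rewrite -normrN => /(le_trans (ler_norm _)) h; apply: le_trans h _.
  by rewrite ler_wpM2r ?sqn_ge0 // lerDl.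
move=> ik; have : v k <= v i.
  rewrite -(subnKC ik); elim: (k - i)%N => [|d IH]; first by rewrite addn0.
  by rewrite addnS; apply: le_trans IH; have := hv (i + d)%N; have := N0 (i + d)%N; lra.
by apply: le_trans; rewrite /v oppr_ge0.
Qed.

Lemma sol_zero l w (z : R -> vec) (t : R) : sol l w z -> z 0 = 0 -> z t = 0.
Proof.
move=> hz z0; apply: (sol_unique hz (W := fun=> 0)).
  by move=> u; rewrite mulmx0; exact: tderive_cst.
exact: z0.
Qed.

(** Solve backwards from a frame of the terminal plane at time [k * T]. Its first component at 0 is
    invertible: if it kills [y], [graph_diff] bounds |z2(0)|^2 by a multiple of the nonpositive
    terminal value of [Qs], so the solution is zero. *)
Lemma approximant l w (k : nat) : Lam b0 B l -> (0 < k)%N ->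
  exists M : 'M[C]_n, forall (z : R -> vec) x, sol l w z ->
    z 0 = col_mx x (M *m x) -> terminal l (z (k%:R * T)).
Proof.
move=> ll k0; pose g : C := Complex 0 (Num.sg (Im l)).
pose tau := k%:R * T.
have Ttau : T <= tau by rewrite ler_peMl ?(ltW T_gt0) // ler1n.
have [W' [W0 hW']] := sol_exists l (s tau w)
  (col_mx 1%:M (g%:M) : 'M[C]_(n + n, n)).
have hW : sol l w (fun t => W' (t - tau)).
  have := sol_shift (- tau) hW'.
  by rewrite -flowD addNr flow0.
set W := fun t => W' (t - tau) in hW.
have Wtau : W tau = col_mx 1%:M (g%:M) by rewrite /W subrr.
have term (y : 'cV[C]_n) : terminal l (W tau *m y).
  by rewrite /terminal Wtau mul_col_mx col_mxKd col_mxKu mul1mx mul_scalar_mx.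
have [Kg Kg0 hKg] := graph_diff.
have inj (y : 'cV[C]_n) : usubmx (W 0) *m y = 0 -> y = 0.
  move=> h; have hy := linsolM y hW.
  have u0 : usubmx (W 0 *m y) = 0 by rewrite -mul_usub_mx.
  have := hKg l w _ ll hy u0 tau Ttau.
  rewrite (terminal_Qs ll (term y)) => hq.
  have d0 : dsubmx (W 0 *m y) = 0.
    apply: sqn_le0; apply: le_trans hq _.
    by rewrite mulrN oppr_le0 mulr_ge0 // sqn_ge0.
  have z0 : W 0 *m y = 0 by rewrite -[LHS]vsubmxK u0 d0 col_mx0.
  have := sol_zero tau hy z0.
  by rewrite Wtau mul_col_mx mul1mx -[X in _ = X]col_mx0 => /eq_col_mx [].
have Xu : usubmx (W 0) \in unitmx.
  rewrite -unitmx_tr -row_free_unit -kermx_eq0; apply/negPn/negP => /rowV0Pn [v /sub_kermxP vD v0].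
  have : v^T = 0 by apply: inj; rewrite -[LHS]trmxK trmx_mul trmxK vD trmx0.
  by move=> h; move: v0; rewrite -[v]trmxK h trmx0 eqxx.
exists (dsubmx (W 0) *m invmx (usubmx (W 0))) => z x hz z0.
have := sol_unique hz (linsolM (invmx (usubmx (W 0)) *m x) hW).
move=> /(_ _ tau) ->; first exact: term.
have split y : W 0 *m y = col_mx (usubmx (W 0) *m y) (dsubmx (W 0) *m y).
  by rewrite -mul_col_mx vsubmxK.
by rewrite z0 split !mulmxA mulmxV // mul1mx.
Qed.

Lemma sqn_delta m (j : 'I_m) : sqn (delta_mx j 0 : 'cV[C]_m) = 1.
Proof.
rewrite /sqn (bigD1 j) //= big1 ?addr0 => [|i ij]; rewrite mxE ?eqxx.
  by rewrite /nsq /= expr1n expr0n addr0.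
by rewrite (negbTE ij) nsq0.
Qed.

Lemma nsq_entry_le m k (M : 'M[C]_(m, k)) i j :
  nsq (M i j) <= sqn (M *m (delta_mx j 0 : 'cV[C]_k)).
Proof. by rewrite -colE; have := nsq_le_sqn (col j M) i; rewrite mxE. Qed.

(** Real and imaginary parts converge separately, each at the cost [r p], whence the factor 2. *)
Lemma mx_cauchy_rate_lim m k (Mk : nat -> 'M[C]_(m, k)) (r : nat -> R) :
  (forall p q, (p <= q)%N -> forall i j, nsq ((Mk p - Mk q) i j) <= r p) ->
  exists M, forall p i j, nsq ((M - Mk p) i j) <= 2 * r p.
Proof.
move=> h.
have sq (x y : R) : x ^+ 2 <= y -> `|x| <= Num.sqrt y.
  by move=> xy; rewrite -sqrtr_sqr ler_wsqrtr.
have sq' (x : R) y : 0 <= y -> `|x| <= Num.sqrt y -> x ^+ 2 <= y.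
  move=> y0 xy; rewrite -(sqr_sqrtr y0) -[x ^+ 2]real_normK ?num_real //.
  by rewrite ler_sqr ?nnegrE ?sqrtr_ge0.
have r0 p : 'I_m -> 'I_k -> 0 <= r p.
  by move=> i j; apply: le_trans (nsq_ge0 _) (h p p (leqnn _) i j).
have key (f : C -> R) : (forall x, f x ^+ 2 <= nsq x) ->
    (forall x y, f (x - y) = f x - f y) ->
    exists L : 'I_m -> 'I_k -> R, forall p i j, (f (Mk p i j) - L i j) ^+ 2 <= r p.
  move=> f1 f2.
  have [L hL] : {L : 'I_m * 'I_k -> R & forall ij p,
      `|f (Mk p ij.1 ij.2) - L ij| <= Num.sqrt (r p)}.
    apply: (@choice _ _ (fun ij l => forall p, `|f (Mk p ij.1 ij.2) - l| <= Num.sqrt (r p))).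
    move=> [i j]; apply: (@cauchy_rate_lim _ (fun p => f (Mk p i j))) => p q pq.
    by apply: sq; rewrite -f2; apply: le_trans (f1 _) _; have := h p q pq i j; rewrite !mxE.
  exists (fun i j => L (i, j)) => p i j; apply: sq'; [exact: r0 i j | exact: hL (i, j) p].
have [x|x y|Lr hr] := key Re; [by rewrite lerDl sqr_ge0 | exact: cReB |].
have [x|x y|Li hi] := key Im; [by rewrite lerDr sqr_ge0 | exact: cImB |].
exists (\matrix_(i, j) Complex (Lr i j) (Li i j)) => p i j.
rewrite !mxE /nsq cReB cImB /=.
have := hr p i j; have := hi p i j.
rewrite -[(_ - Li _ _) ^+ 2]sqrrN opprB -[(_ - Lr _ _) ^+ 2]sqrrN opprB; lra.
Qed.

Lemma weyl_exists : exists C2 th, [/\ 0 <= C2, 0 < th < 1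
  & forall l w, Lam b0 B l -> exists M : 'M[C]_n, forall z : R -> vec,
    sol l w z -> dsubmx (z 0) = M *m usubmx (z 0) -> forall j : nat,
    sqn (z (j%:R * T)) <= C2 * th ^+ j * sqn (z 0)].
Proof.
have [K [th [C1 [cK th01 C10 hdec]]]] := discrete_decay.
have [Kg Kg0 hKg] := graph_diff.
have [Kb Kb0 hKb] := graph_bound.
have [L L0 hL] := sol_growth B_ge0.
have th0 : 0 <= th by case/andP: th01 => /ltW.
have th1 : 0 <= th < 1 by case/andP: th01 => /ltW -> ->.
pose C3 := C1 * (1 + Kb).
have C30 : 0 <= C3 by rewrite mulr_ge0 // addr_ge0.
exists (2 * C3), th; split => //; first by rewrite mulr_ge0.
move=> l w ll.
(* The index is shifted by one: [Mk k] has terminal time [k.+1 * T], so that [approximant] covers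
   [k = 0]. *)
have [Mk hMk] : {Mk : nat -> 'M[C]_n & forall k (z : R -> vec) x, sol l w z ->
    z 0 = col_mx x (Mk k *m x) -> terminal l (z (k.+1%:R * T))}.
  apply: (@choice _ _ (fun k M => forall (z : R -> vec) x, sol l w z ->
    z 0 = col_mx x (M *m x) -> terminal l (z (k.+1%:R * T)))) => k.
  exact: approximant.
have Qle k (z : R -> vec) x : sol l w z -> z 0 = col_mx x (Mk k *m x) ->
    Qs l (z T) <= 0.
  move=> hz z0; have := terminal_Qs ll (hMk k z x hz z0) => e.
  apply: le_trans (Qs_mono hz _) _.
    by apply: (_ : T <= k.+1%:R * T); rewrite ler_peMl ?(ltW T_gt0) // ler1n.
  by rewrite e oppr_le0 sqn_ge0.
have init k (z : R -> vec) x : sol l w z -> z 0 = col_mx x (Mk k *m x) ->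
    sqn (z 0) <= (1 + Kb) * sqn x.
  move=> hz z0; have := hKb l w z ll hz (Qle k z x hz z0).
  by rewrite (sqn_split (z 0)) z0 col_mxKu col_mxKd mulrDl mul1r lerD2l.
have dec k (z : R -> vec) x : sol l w z -> z 0 = col_mx x (Mk k *m x) ->
    forall j, (j <= k)%N -> sqn (z (j%:R * T)) <= C3 * th ^+ j * sqn x.
  move=> hz z0 j jk.
  have hT := lyap_terminal (s (k.+1%:R * T) w) ll cK (hMk k z x hz z0).
  apply: le_trans (hdec l w z ll hz k.+1 hT j jk) _.
  have -> : C3 * th ^+ j * sqn x = C1 * th ^+ j * ((1 + Kb) * sqn x) by rewrite /C3; ring.
  by rewrite ler_wpM2l ?mulr_ge0 ?exprn_ge0 // (init k z x).
pose D := Kg * (2 * C3).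
have D0 : 0 <= D by rewrite mulr_ge0 // mulr_ge0.
(* At the earlier terminal time [p.+1 * T] the solution of index [p] is terminal and the one of
   index [q] has decayed, so [terminal_diff] and [graph_diff] compare the two matrices. *)
have rate p q x : (p <= q)%N -> sqn ((Mk p - Mk q) *m x) <= D * th ^+ p.+1 * sqn x.
  rewrite leq_eqVlt => /predU1P[->|pq].
    by rewrite subrr mul0mx sqn0 mulr_ge0 ?sqn_ge0 // mulr_ge0 // exprn_ge0.
  have [z [z0 hz]] := sol_exists l w (col_mx x (Mk p *m x)).
  have [y [y0 hy]] := sol_exists l w (col_mx x (Mk q *m x)).
  have d0 : z 0 - y 0 = col_mx 0 ((Mk p - Mk q) *m x).
    by rewrite z0 y0 opp_col_mx add_col_mx subrr mulmxBl.
  have Tp : T <= p.+1%:R * T by rewrite ler_peMl ?(ltW T_gt0) // ler1n.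
  have := hKg l w _ ll (linsolB hz hy) _ _ Tp; rewrite /= d0 col_mxKu col_mxKd => /(_ erefl) h.
  apply: le_trans h _.
  have -> : D * th ^+ p.+1 * sqn x = Kg * (2 * (C3 * th ^+ p.+1 * sqn x)) by rewrite /D; ring.
  rewrite ler_wpM2l //.
  apply: le_trans (terminal_diff _ ll (hMk p z x hz z0)) _.
  by rewrite ler_wpM2l // (dec q y x hy y0).
have [p q pq i j|M hM] := @mx_cauchy_rate_lim n n Mk (fun p => D * th ^+ p.+1).
  by apply: le_trans (nsq_entry_le _ i j) _; have := rate p q (delta_mx j 0) pq; rewrite sqn_delta mulr1.
exists M => z hz z2 j; set x := usubmx (z 0) in z2.
have xz : sqn x <= sqn (z 0) by rewrite (sqn_split (z 0)) lerDl sqn_ge0.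
(* For fixed [j], compare with the approximant of index [j + k]: its decay bound at step [j] does
   not involve [k], and the error tends to 0 with [k], whatever the growth factor of [j] is. *)
have main k : sqn (z (j%:R * T)) <= 2 * (C3 * th ^+ j * sqn x) +
    2 * (expR (L * (j%:R * T)) * ((n * n)%:R * (2 * (D * th ^+ (j + k).+1)) * sqn x)).
  have [y [y0 hy]] := sol_exists l w (col_mx x (Mk (j + k)%N *m x)).
  have -> : z (j%:R * T) = y (j%:R * T) + (z (j%:R * T) - y (j%:R * T)) by rewrite addrC subrK.
  apply: le_trans (sqnD _ _) _; apply: lerD; rewrite ler_wpM2l //.
    by apply: (dec (j + k)%N y x hy y0); exact: leq_addr.
  have jT : 0 <= j%:R * T by rewrite mulr_ge0 // ltW.
  apply: le_trans (hL l w _ _ ll.2 jT (linsolB hz hy)) _.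
  rewrite ler_wpM2l ?expR_ge0 //.
  have -> : z 0 - y 0 = col_mx 0 ((M - Mk (j + k)%N) *m x).
    by rewrite y0 -[z 0]vsubmxK -/x z2 opp_col_mx add_col_mx subrr mulmxBl.
  by rewrite sqn_col_mx sqn0 add0r; apply: sqn_mulmx => i' j'; exact: hM.
have : sqn (z (j%:R * T)) - 2 * (C3 * th ^+ j * sqn x) <= 0.
  apply: (@le0_geometric _ _ (2 * (expR (L * (j%:R * T)) * ((n * n)%:R * (2 * (D * th ^+ j.+1)) * sqn x))) th) => // k.
  rewrite lerBlDl; apply: le_trans (main k) _.
  rewrite lerD2l le_eqVlt -addSn exprD; apply/orP; left; apply/eqP; ring.
have : C3 * th ^+ j * sqn x <= C3 * th ^+ j * sqn (z 0).
  by rewrite ler_wpM2l // mulr_ge0 // exprn_ge0.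
have -> : 2 * C3 * th ^+ j * sqn (z 0) = 2 * (C3 * th ^+ j * sqn (z 0)) by ring.
lra.
Qed.

End Uniform.

Lemma exp_decays m (z : R -> 'cV[C]_m) (X b : R) : 0 < b ->
  (forall t, 0 <= t -> sqn (z t) <= X * expR (- b * t)) -> decays z.
Proof.
move=> b0 h e e0; exists (`|X| / e / b) => t tt.
have t0 : 0 <= t by apply: le_trans tt; rewrite !divr_ge0 // ltW.
apply: le_lt_trans (h t t0) _.
apply: (@le_lt_trans _ _ (`|X| * expR (- b * t))).
  by rewrite ler_wpM2r ?expR_ge0 // ler_norm.
rewrite mulNr expRN ltr_pdivrMr ?expR_gt0 //.
apply: (@lt_le_trans _ _ (e * (1 + b * t))); last first.
  by rewrite ler_wpM2l ?expR_ge1Dx // ltW.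
rewrite -ltr_pdivrMl // mulrC ltr_pwDl //.
by move: tt; rewrite ler_pdivrMr // [t * b]mulrC.
Qed.

(** [Qs] is nondecreasing along the solution and tends to 0. *)
Lemma decays_Qs_le0 l w (z : R -> vec) t : sol l w z -> decays z -> Qs l (z t) <= 0.
Proof.
move=> hz dz; rewrite leNgt; apply/negP => q0.
have [t0 ht] := dz _ q0.
have := ht (Num.max t0 t); rewrite le_max lexx => /(_ isT) h3.
have tm : t <= Num.max t0 t by rewrite le_max lexx orbT.
have h2 := Qs_mono hz tm.
have := le_trans (ler_norm _) (Qs_le l (z (Num.max t0 t))).
by move=> /(le_trans h2); rewrite leNgt h3.
Qed.

Lemma Lam_self l : Im l != 0 -> Lam `|Im l| (nsq l) l.
Proof. by []. Qed.

(** The Lyapunov function tends to 0 at both ends and never decreases over a step, so it is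
    nonnegative at 0 and nonpositive at [T]; the strict increase between these times then forces
    [z 0 = 0]. *)
Lemma two_ended_decay l w (z : R -> vec) : Im l != 0 -> sol l w z -> decays z ->
  decays (fun t => z (- t)) -> z 0 = 0.
Proof.
move=> l0' hz dp dm.
have b0 : 0 < `|Im l| by rewrite normr_gt0.
have [K cK hK] := lyap_step b0 (nsq_ge0 l).
have ll := Lam_self l0'; have K0 : 0 <= K := le_trans c_ge0 cK.
pose V t := lyap K l (s t w) (z t).
have hV t : V t + 4^-1 * sqn (z t) <= V (t + T) := lyap_step_at hK t ll hz.
have bV t : `|V t| <= (K + c) * sqn (z t) := lyap_le l (s t w) (z t) K0.
have up t (k : nat) : V t <= V (t + k%:R * T).
  elim: k => [|k IH]; first by rewrite mul0r addr0.
  apply: le_trans IH _; have := hV (t + k%:R * T); have := sqn_ge0 (z (t + k%:R * T)).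
  have -> : t + k%:R * T + T = t + k.+1%:R * T by rewrite -natr1 mulrDl mul1r addrA.
  lra.
have small (f : R -> vec) (e : R) : decays f -> 0 < e -> exists t0, forall t, t0 <= t ->
    (K + c) * sqn (f t) < e.
  move=> df e0; have p0 : 0 < K + c + 1 by rewrite ltr_wpDl // addr_ge0.
  have [t0 ht] := df (e / (K + c + 1)) (divr_gt0 e0 p0).
  exists t0 => t /ht h; have := h; rewrite ltr_pdivlMr // => h'.
  by have := sqn_ge0 (f t); nra.
have large (t0 : R) : exists k : nat, t0 <= k%:R * T.
  exists (Num.truncn (`|t0| / T)).+1.
  have := truncnS_gt (`|t0| / T); rewrite ltr_pdivrMr // => /ltW.
  by apply: le_trans; exact: ler_norm.
have V1 : V T <= 0.
  rewrite leNgt; apply/negP => v0.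
  have [t0 ht] := small z (V T) dp v0; have [k hk] := large t0.
  have tk : t0 <= T + k%:R * T by apply: le_trans hk _; rewrite lerDr ltW.
  have := ht _ tk; rewrite ltNge => /negP; apply.
  apply: le_trans (up T k) _; exact: le_trans (ler_norm _) (bV _).
have V0 : 0 <= V 0.
  rewrite leNgt -oppr_gt0; apply/negP => v0.
  have [t0 ht] := small _ (- V 0) dm v0; have [k hk] := large t0.
  have := ht _ hk; rewrite ltNge => /negP; apply.
  have := up (- (k%:R * T)) k; rewrite addNr => h.
  apply: (@le_trans _ _ (- V (- (k%:R * T)))); first by rewrite lerN2.
  by apply: le_trans (bV _); rewrite -normrN ler_norm.
apply: sqn_le0; have := hV 0; rewrite add0r; lra.
Qed.

(** The graph of [M] is the set of initial values of decaying solutions; this determines [M]. *)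
Definition is_weyl (w : Om) (l : C) (M : 'M[C]_n) : Prop := forall z : R -> vec,
  sol l w z -> (decays z <-> dsubmx (z 0) = M *m usubmx (z 0)).

Lemma weyl_plus_uniform (b0 B : R) : 0 < b0 -> 0 <= B ->
  exists K C2 b, [/\ 0 <= K, 0 <= C2, 0 < b & forall l w, Lam b0 B l ->
    (exists M, is_weyl w l M) /\
    forall z : R -> vec, sol l w z -> decays z ->
      sqn (dsubmx (z 0)) <= K * sqn (usubmx (z 0)) /\
      forall t, 0 <= t -> sqn (z t) <= C2 * expR (- b * t) * sqn (z 0)].
Proof.
move=> b0_gt0 B_ge0.
have [C2 [th [C20 th01 hM]]] := weyl_exists b0_gt0 B_ge0.
have [Kb Kb0 hKb] := graph_bound b0_gt0 B_ge0.
have [L L0 hL] := sol_growth B_ge0.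
have [b b_gt0 hb] := exp_decay_of_geometric th01 T_gt0.
have ith : 0 <= th^-1 by rewrite invr_ge0; case/andP: th01 => /ltW.
(* Growth within one step, times the discrete constant, times the rounding loss of
   [exp_decay_of_geometric]. *)
pose C3 := expR (L * T) * (C2 * th^-1).
have C30 : 0 <= C3 by rewrite mulr_ge0 ?expR_ge0 // mulr_ge0.
exists Kb, C3, b; split => // l w ll.
have [M hMz] := hM l w ll.
have exp_bound (z : R -> vec) : sol l w z -> dsubmx (z 0) = M *m usubmx (z 0) ->
    forall t, 0 <= t -> sqn (z t) <= C3 * expR (- b * t) * sqn (z 0).
  move=> hz z2 t t0; have [j [r [r0 rT tE thj]]] := hb t t0.
  have jT : 0 <= j%:R * T by rewrite mulr_ge0 // ltW.
  have := hL l _ _ r ll.2 r0 (sol_shift (j%:R * T) hz); rewrite add0r -tE => h1.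
  apply: le_trans h1 _.
  have h2 : expR (L * r) <= expR (L * T) by rewrite ler_expR ler_wpM2l.
  have h3 : sqn (z (j%:R * T)) <= (C2 * th^-1) * expR (- b * t) * sqn (z 0).
    apply: le_trans (hMz z hz z2 j) _; rewrite ler_wpM2r ?sqn_ge0 //.
    by rewrite -mulrA ler_wpM2l.
  apply: le_trans (ler_pM (expR_ge0 _) (sqn_ge0 _) h2 h3) _.
  by rewrite /C3 !mulrA.
have graph_decays (z : R -> vec) : sol l w z -> dsubmx (z 0) = M *m usubmx (z 0) -> decays z.
  move=> hz z2; apply: (@exp_decays _ z (C3 * sqn (z 0)) b) => // t t0.
  by rewrite mulrAC exp_bound.
have decay_bound (z : R -> vec) : sol l w z -> decays z ->
    sqn (dsubmx (z 0)) <= Kb * sqn (usubmx (z 0)).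
  by move=> hz dz; apply: hKb ll hz (decays_Qs_le0 T hz dz).
have decays_graph (z : R -> vec) : sol l w z -> decays z -> dsubmx (z 0) = M *m usubmx (z 0).
  move=> hz dz.
  have [y [y0 hy]] := sol_exists l w
    (col_mx (usubmx (z 0)) (M *m usubmx (z 0))).
  have dy : decays y by apply: graph_decays => //; rewrite y0 col_mxKd col_mxKu.
  have dd : decays (fun t => z t - y t).
    move=> e e0; have e4 : 0 < e / 4 by rewrite divr_gt0.
    have [t1 h1] := dz _ e4; have [t2 h2] := dy _ e4.
    exists (Num.max t1 t2) => t; rewrite ge_max => /andP[/h1 g1 /h2 g2].
    by have := sqnB (z t) (y t); lra.
  have := decay_bound _ (linsolB hz hy) dd.
  have -> : z 0 - y 0 = col_mx 0 (dsubmx (z 0) - M *m usubmx (z 0)).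
    by rewrite y0 -{1}[z 0]vsubmxK opp_col_mx add_col_mx subrr.
  rewrite col_mxKu col_mxKd sqn0 mulr0 => /sqn_le0/eqP.
  by rewrite subr_eq0 => /eqP.
split; first by exists M => z hz; split; [exact: decays_graph | exact: graph_decays].
move=> z hz dz; split; first exact: decay_bound.
by apply: exp_bound => //; exact: decays_graph.
Qed.

Lemma weyl_plus : exists M : Om -> C -> 'M[C]_n,
  forall w l, Im l != 0 -> is_weyl w l (M w l).
Proof.
have [M hM] : {M : Om * C -> 'M[C]_n & forall p, Im p.2 != 0 -> is_weyl p.1 p.2 (M p)}.
  apply: (@choice _ _ (fun p M => Im p.2 != 0 -> is_weyl p.1 p.2 M)) => -[w l] /=.
  have [e|l1] := eqVneq (Im l) 0; first by exists 0 => /= h; case/eqP: h.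
  have b0 : 0 < `|Im l| by rewrite normr_gt0.
  have [K [C2 [b [_ _ _ h]]]] := weyl_plus_uniform b0 (nsq_ge0 l).
  by have [[M hM] _] := h l w (Lam_self l1); exists M.
by exists (fun w l => M (w, l)) => w l; exact: hM (w, l).
Qed.

Lemma nsq_dot k (x y : 'cV[C]_k) : nsq ((x^T *m y) 0 0) <= k%:R * sqn x * sqn y.
Proof.
rewrite mxE; apply: le_trans (nsq_sum _) _; rewrite card_ord -mulrA ler_wpM2l //.
rewrite {1}/sqn mulr_suml; apply: ler_sum => i _; rewrite mxE nsqM.
by rewrite ler_wpM2l ?nsq_ge0 ?nsq_le_sqn.
Qed.

Lemma sqn_usub_le (z : vec) : sqn (usubmx z) <= sqn z.
Proof. by rewrite [X in _ <= X]sqn_split lerDl sqn_ge0. Qed.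

Lemma sqn_dsub_le (z : vec) : sqn (dsubmx z) <= sqn z.
Proof. by rewrite [X in _ <= X]sqn_split lerDr sqn_ge0. Qed.

Lemma nsq_bJ (x y : vec) : nsq (bJ x y 0 0) <= 4 * n%:R * sqn x * sqn y.
Proof.
rewrite /bJ !mxE; apply: le_trans (nsqD _ _) _; rewrite nsqN.
have key (a b : 'cV[C]_n) : sqn a <= sqn x -> sqn b <= sqn y ->
    nsq ((a^T *m b) 0 0) <= n%:R * sqn x * sqn y.
  move=> ax by_; apply: le_trans (nsq_dot a b) _.
  by rewrite -!mulrA ler_wpM2l // ler_pM ?sqn_ge0.
have := key _ _ (sqn_dsub_le x) (sqn_usub_le y).
have := key _ _ (sqn_usub_le x) (sqn_dsub_le y).
rewrite !mxE; lra.
Qed.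

Lemma bJ_decays_lim (x y : R -> vec) : decays x -> decays y ->
  forall e : R, 0 < e -> exists t0, forall t, t0 <= t -> nsq (bJ (x t) (y t) 0 0) < e.
Proof.
move=> dx dy e e0.
pose k : R := 4 * n%:R + 1; have k0 : 0 < k by rewrite ltr_wpDl // mulr_ge0.
have [t1 h1] := dx _ (divr_gt0 e0 k0); have [t2 h2] := dy 1 ltr01.
exists (Num.max t1 t2) => t; rewrite ge_max => /andP[/h1 g1 /h2 g2].
apply: le_lt_trans (nsq_bJ _ _) _.
rewrite ltr_pdivlMr // in g1.
have a1 := sqn_ge0 (x t); have a2 := sqn_ge0 (y t).
apply: (@le_lt_trans _ _ (k * sqn (x t))); last by rewrite mulrC.
rewrite -mulrA; apply: ler_pM => //; rewrite ?mulr_ge0 //; first by rewrite /k lerDl.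
by rewrite -[X in _ <= X]mulr1 ler_wpM2l // ltW.
Qed.

(** At equal parameters the form is constant in time, and along decaying solutions it tends to 0.
    This isotropy is the symmetry of [M] in [weyl_sym]. *)
Lemma bJ_decays0 l w (x y : R -> vec) : sol l w x -> sol l w y ->
  decays x -> decays y -> bJ (x 0) (y 0) 0 0 = 0.
Proof.
move=> hx hy dx dy; have hd := bJ_derive H_sp Delta_sym hx hy.
have cst t : bJ (x 0) (y 0) 0 0 = bJ (x t) (y t) 0 0.
  apply: complex_eqP.
    apply: (@is_derive_0_is_cst R (fun u => Re (bJ (x u) (y u) 0 0))) => u.
    by have [h _] := hd u 0 0; move: h; rewrite subrr scale0r mxE.
  apply: (@is_derive_0_is_cst R (fun u => Im (bJ (x u) (y u) 0 0))) => u.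
  by have [_ h] := hd u 0 0; move: h; rewrite subrr scale0r mxE.
apply: nsq_eq0; apply/eqP; rewrite eq_le nsq_ge0 andbT leNgt; apply/negP => p0.
have [t0 ht] := bJ_decays_lim dx dy p0.
by have := ht t0 (lexx _); rewrite -cst ltxx.
Qed.

Lemma weyl_sol_exists w l M x : is_weyl w l M -> exists z : R -> vec,
  [/\ sol l w z, decays z & z 0 = col_mx x (M *m x)].
Proof.
move=> hM; have [z [z0 hz]] := sol_exists l w (col_mx x (M *m x)).
exists z; split => //; apply: (hM z hz).2.
by rewrite z0 col_mxKd col_mxKu.
Qed.

Lemma mx_entryE m k (M : 'M[C]_(m, k)) i j :
  M i j = ((delta_mx i 0 : 'cV_m)^T *m (M *m (delta_mx j 0 : 'cV_k))) 0 0.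
Proof. by rewrite trmx_delta -rowE -colE !mxE. Qed.

Lemma weyl_sym w l M : is_weyl w l M -> M^T = M.
Proof.
move=> hM; apply/matrixP => i j.
have [x [hx dx x0]] := weyl_sol_exists (delta_mx i 0) hM.
have [y [hy dy y0]] := weyl_sol_exists (delta_mx j 0) hM.
have := bJ_decays0 hx hy dx dy; rewrite /bJ x0 y0 !col_mxKd !col_mxKu mxE.
rewrite [X in _ + X]mxE -mx_entryE trmx_mul -mulmxA -mx_entryE => /eqP.
by rewrite subr_eq0 => /eqP.
Qed.

(** At the initial value [(x, M x)] with real [x], [Qs] is -2 sg(Im l) times the form of [mxIm M] at
    [x], and [Qs] is nonpositive on decaying solutions. *)
Lemma weyl_herglotz_sign w l M : is_weyl w l M -> possemidef (Im l *: mxIm M).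
Proof.
move=> hM; have Ms := weyl_sym hM.
split.
  by apply/matrixP => i j; rewrite !mxE; have /matrixP/(_ i j) := Ms; rewrite mxE => ->.
move=> x; have [z [hz dz z0]] := weyl_sol_exists (toC x) hM.
have := decays_Qs_le0 0 hz dz.
rewrite /Qs QfE z0.
have -> : \sum_i (Re (col_mx (toC x) (M *m toC x) (rshift n i) 0) *
     Im (col_mx (toC x) (M *m toC x) (lshift n i) 0) -
     Im (col_mx (toC x) (M *m toC x) (rshift n i) 0) *
     Re (col_mx (toC x) (M *m toC x) (lshift n i) 0)) = - qform (mxIm M) x x.
  rewrite qformE -sumrN; apply: eq_bigr => i _; rewrite col_mxEu col_mxEd toCE /= mulr0 sub0r.
  rewrite mxE cIm_sum mulr_suml; congr (- _); apply: eq_bigr => j _.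
  by rewrite toCE cImM mxE /= mulr0 add0r; ring.
have -> : (x^T *m (Im l *: mxIm M) *m x) 0 0 = Im l * qform (mxIm M) x x.
  by rewrite -scalemxAr -scalemxAl mxE.
move: (qform _ _ _) => q h; rewrite [X in X * q]numEsg.
have : 0 <= `|Im l| by [].
move: h; move: (Num.sg _) => g.
have -> : g * (2 * - q) = - (2 * (g * q)) by ring.
rewrite oppr_le0 => h a; rewrite mulrAC mulr_ge0 //; lra.
Qed.

(** The tube lemma over the compact time segment [[0, S]]. *)
Lemma flow_tube (f : Om -> R) (w0 : Om) (S e : R) : continuous f -> 0 < e ->
  \forall w \near w0, forall u, 0 <= u <= S -> `|f (s u w) - f (s u w0)| < e.
Proof.
move=> cf e0; have [cs _ _] := s_flow.
have e2 : 0 < e / 2 by rewrite divr_gt0.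
have nearP (u : R) : u \in `[0, S]%classic -> \forall u' \near u & w \near w0,
    `|f (s u' w) - f (s u' w0)| < e.
  move=> _.
  have h1 : \forall p \near (u, w0), `|f (s u w0) - f (s p.1 p.2)| < e / 2.
    have : f (s p.1 p.2) @[p --> (u, w0)] --> f (s u w0).
      by apply: (continuous_comp (cs (u, w0))); exact: cf.
    by move/cvgrPdist_lt; apply.
  have h2 : \forall p \near (u, w0), `|f (s u w0) - f (s p.1 w0)| < e / 2.
    have : f (s p.1 w0) @[p --> (u, w0)] --> f (s u w0).
      apply: (@cvg_comp _ _ _ fst (fun u' => f (s u' w0)) _ (nbhs u)).
        exact: cvg_fst.
      by apply: (continuous_comp (@flow_orbit_continuous w0 u)); exact: cf.
    by move/cvgrPdist_lt; apply.
  have : \forall p \near (u, w0), `|f (s p.1 p.2) - f (s p.1 w0)| < e.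
    near=> p.
    have a : `|f (s u w0) - f (s p.1 p.2)| < e / 2 by near: p.
    have b : `|f (s u w0) - f (s p.1 w0)| < e / 2 by near: p.
    have := ler_distD (f (s u w0)) (f (s p.1 p.2)) (f (s p.1 w0)).
    rewrite distrC in a; lra.
  by case=> -[P Q] /= [hP hQ] PQ; exists (P, Q) => //.
suff : \forall w \near w0, `[0, S]%classic `<=` (fun u => `|f (s u w) - f (s u w0)| < e).
  by apply: filterS => w h u uS; apply: h; rewrite /= in_itv.
have /compact_near_coveringP nc := @segment_compact R 0 S.
apply: (nc Om (nbhs w0) (fun w u => `|f (s u w) - f (s u w0)| < e)) => u uS.
by apply: nearP; rewrite inE.
Unshelve. all: by end_near. Qed.

(** The difference solves the nearby system with the forcing (A_l - A_l1) y, which is small along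
    the orbits by [flow_tube]; [forced_growth] applies with [q u = u]. The bound is relative to
    [sqn (y 0)], hence one neighbourhood serves all initial values. *)
Lemma continuous_dependence (w0 : Om) (l1 : C) (S e : R) : 0 < e ->
  \forall p \near (w0, l1), forall z y : R -> vec, sol p.2 p.1 z -> sol l1 w0 y ->
    z 0 = y 0 -> forall t, 0 <= t <= S -> sqn (z t - y t) <= e * sqn (y 0).
Proof.
move=> e0.
pose B := 2 * nsq l1 + 2; have B0 : 0 <= B by have := nsq_ge0 l1; rewrite /B; lra.
have [L L0 hL] := sol_growth B0.
have [c1 c10 hc] := hamiltonian_bound B0.
have [h h0 hh] := family_bounds.
pose N : R := ((n + n) * (n + n))%:R.
have N0 : 0 <= N by [].
pose S' := `|S| + 1; have S'0 : 0 < S' by rewrite ltr_wpDl.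
pose E := expR ((2 + N * c1) * S') * (N * expR (L * S') * S') + 1.
have E0 : 0 < E by rewrite ltr_wpDl // !mulr_ge0 ?expR_ge0 // ltW.
pose a := e / E; have a0 : 0 < a by rewrite divr_gt0.
(* Half of the tolerance [a] goes to the change of the base point through [a1], half to the change
   of the parameter through [a2], following the two terms of [hamiltonian_entry_diff]. *)
pose a1 := a / 2 / (4 * (1 + B)).
have B1 : 0 < 4 * (1 + B) by rewrite mulr_gt0 // ltr_pwDl.
have a10 : 0 < a1 by rewrite divr_gt0 // divr_gt0.
pose a2 := a / 2 / (4 * h + 1).
have h1 : 0 < 4 * h + 1 by rewrite ltr_wpDl // mulr_ge0.
have a20 : 0 < a2 by rewrite divr_gt0 // divr_gt0.
have s10 : 0 < Num.sqrt a1 by rewrite sqrtr_gt0.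
have tube m k (M : Om -> 'M[R]_(m, k)) : continuous M ->
    \forall w \near w0, forall i j u, 0 <= u <= S' -> (M (s u w) i j - M (s u w0) i j) ^+ 2 <= a1.
  move=> cM; apply: filter_forall => i; apply: filter_forall => j.
  apply: filterS (flow_tube w0 S' (mx_continuous_entry (i:=i) (j:=j) cM) s10) => w hw u uS.
  rewrite -[X in X <= _]real_normK ?num_real // -(sqr_sqrtr (ltW a10)).
  by rewrite ler_sqr ?nnegrE ?sqrtr_ge0 // ltW // hw.
have nl : \forall l \near l1, nsq (l - l1) < Num.min a2 1.
  have /cvgC_nsqP : (fun l : C => l) @ nbhs l1 --> l1 by exact: cvg_id.
  by apply; rewrite lt_min a20 ltr01.
have near1 : \forall p \near (w0, l1),
   [/\ forall i j u, 0 <= u <= S' -> (H (s u p.1) i j - H (s u w0) i j) ^+ 2 <= a1,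
       forall i j u, 0 <= u <= S' -> (Delta (s u p.1) i j - Delta (s u w0) i j) ^+ 2 <= a1
     & nsq (p.2 - l1) < Num.min a2 1].
  have nh : \forall w \near w0,
     (forall i j u, 0 <= u <= S' -> (H (s u w) i j - H (s u w0) i j) ^+ 2 <= a1) /\
     (forall i j u, 0 <= u <= S' -> (Delta (s u w) i j - Delta (s u w0) i j) ^+ 2 <= a1).
    by apply: filterI; [exact: tube H_cont | exact: tube Delta_cont].
  exists ([set w | (forall i j u, 0 <= u <= S' -> (H (s u w) i j - H (s u w0) i j) ^+ 2 <= a1) /\
     (forall i j u, 0 <= u <= S' -> (Delta (s u w) i j - Delta (s u w0) i j) ^+ 2 <= a1)],
     [set l | nsq (l - l1) < Num.min a2 1]) => //=.
  by move=> [w l] /= [[q1 q2] q3].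
apply: filterS near1 => -[w l] /= [hH hD hl] z y hz hy zy t /andP[t0 tS].
move: hl; rewrite lt_min => /andP[hl2 hl1].
have lB : nsq l <= B.
  by have := nsqD (l - l1) l1; rewrite subrK /B; lra.
have l1B : nsq l1 <= B by have := nsq_ge0 l1; rewrite /B; lra.
have tS' : t <= S' by apply: le_trans tS _; have := ler_norm S; rewrite /S'; lra.
pose f u := (A l (s u w) - A l1 (s u w0)) *m y u.
have entry u : 0 <= u <= S' -> forall i j, nsq ((A l (s u w) - A l1 (s u w0)) i j) <= a.
  move=> uS i j; rewrite mxE [X in _ + X]mxE.
  have [_ Db] := hh (s u w0).
  apply: le_trans (hamiltonian_entry_diff l l1 h0 (fun i j => hH i j u uS) (fun i j => hD i j u uS) Db i j) _.
  have g1 : 4 * (1 + nsq l) * a1 <= a / 2.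
    rewrite /a1 mulrA ler_pdivrMr // mulrC ler_wpM2l ?(ltW (divr_gt0 a0 _)) //.
    by rewrite ler_wpM2l // lerD2l.
  have g2 : 4 * nsq (l - l1) * h <= a / 2.
    have k1 : 4 * nsq (l - l1) * h <= 4 * a2 * h by rewrite ler_wpM2r // ler_wpM2l // ltW.
    apply: le_trans k1 _; rewrite mulrAC /a2 mulrA ler_pdivrMr // mulrC.
    by rewrite ler_wpM2l ?(ltW (divr_gt0 a0 _)) // lerDl.
  have -> : a = a / 2 + a / 2 by exact: splitr.
  lra.
pose b := N * a * (expR (L * S') * sqn (y 0)).
have b_ge0 : 0 <= b.
  apply: mulr_ge0; first by apply: mulr_ge0 => //; exact: ltW.
  by apply: mulr_ge0; rewrite ?expR_ge0 ?sqn_ge0.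
have := @forced_growth _ _ (fun u => A l (s u w)) c1 b t (fun u => z u - y u) f
  (fun u => u) (fun=> 1) c10 b_ge0 t0.
rewrite zy subrr sqn0 add0r subr0 => fg.
apply: le_trans (fg _ _ _ _ _) _ => [u i j|u|u _|u /andP[u0 ut]|].
- exact: hc.
- have := tderiveB (hz u) (hy u); congr is_tderive.
  by rewrite /f mulmxBr mulmxBl subrKA.
- exact: ler01.
- have uS : 0 <= u <= S' by rewrite u0 (le_trans ut tS').
  apply: le_trans (sqn_mulmx (y u) (entry u uS)) _.
  rewrite mulr1; apply: ler_wpM2l; first by apply: mulr_ge0 => //; exact: ltW.
  apply: le_trans (hL l1 w0 y u l1B u0 hy) _; rewrite ler_wpM2r ?sqn_ge0 //.
  by rewrite ler_expR ler_wpM2l // (le_trans ut tS').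
rewrite -/N; apply: (@le_trans _ _ (expR ((2 + N * c1) * S') * (b * S'))).
  have Nc0 : 0 <= 2 + N * c1 by rewrite addr_ge0 // mulr_ge0.
  apply: ler_pM; first exact: expR_ge0.
  - exact: mulr_ge0.
  - by rewrite ler_expR ler_wpM2l.
  - by rewrite ler_wpM2l.
have -> : expR ((2 + N * c1) * S') * (b * S') = a * ((E - 1) * sqn (y 0)).
  by rewrite /b /E; ring.
have -> : e = a * E by rewrite /a mulfVK // lt0r_neq0.
rewrite -mulrA; apply: ler_wpM2l; first exact: ltW.
by rewrite ler_wpM2r ?sqn_ge0 // gerBl.
Qed.

(** * Continuity and holomorphy in the parameter *)

Section Regularity.
Variable M : Om -> C -> 'M[C]_n.
Hypothesis M_weyl : forall w l, Im l != 0 -> is_weyl w l (M w l).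

Lemma near_Lam (l1 : C) : Im l1 != 0 ->
  \forall l \near l1, Lam (`|Im l1| / 2) (2 * nsq l1 + 2) l.
Proof.
move=> n1; have i0 : 0 < `|Im l1| by rewrite normr_gt0.
have /cvgC_nsqP h : (fun l : C => l) @ nbhs l1 --> l1 by exact: cvg_id.
pose a := `|Im l1| / 2; have a0 : 0 < a by rewrite divr_gt0.
have := h (Num.min (a ^+ 2) 1); rewrite lt_min exprn_gt0 // ltr01 => /(_ isT).
apply: filterS => l; rewrite lt_min => /andP[g1 g2]; split; last first.
  by have := nsqD (l - l1) l1; rewrite subrK; lra.
have : `|Im (l - l1)| < a.
  rewrite -ltr_sqr ?nnegrE ?(ltW a0) // real_normK ?num_real //.
  by apply: le_lt_trans g1; rewrite lerDr sqr_ge0.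
rewrite cImB; have := ler_distD 0 (Im l1) (Im l); rewrite subr0 sub0r normrN distrC.
rewrite -/a; have : `|Im l1| = a + a by exact: splitr.
have := ler_dist_dist (Im l) (Im l1); have := ler_norm (`|Im l1| - `|Im l|).
rewrite (distrC `|Im l1|); lra.
Qed.

Lemma Lam_neq0 (b0 B : R) l : 0 < b0 -> Lam b0 B l -> Im l != 0.
Proof. by move=> b00 [lb _]; rewrite -normr_gt0; apply: lt_le_trans lb. Qed.

Lemma exp_small (k b e S : R) : 0 < b -> 0 < e ->
  exists t, [/\ S <= t, 0 <= t & k * expR (- b * t) < e].
Proof.
move=> b0 e0; exists (Num.max (`|S|) (`|k| / e / b)).
have p0 : 0 <= `|k| / e / b by rewrite !divr_ge0 // ltW.
split.
- by rewrite le_max ler_norm.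
- by rewrite le_max normr_ge0.
set t := Num.max _ _; have tt : `|k| / e / b <= t by rewrite le_max lexx orbT.
apply: (@le_lt_trans _ _ (`|k| * expR (- b * t))).
  by rewrite ler_wpM2r ?expR_ge0 // ler_norm.
rewrite mulNr expRN ltr_pdivrMr ?expR_gt0 //.
apply: (@lt_le_trans _ _ (e * (1 + b * t))); last first.
  by rewrite ler_wpM2l ?expR_ge1Dx // ltW.
rewrite -ltr_pdivrMl // mulrC ltr_pwDl //.
by move: tt; rewrite ler_pdivrMr // [t * b]mulrC.
Qed.

(** Let [u] solve the nearby system from the initial value of the Weyl solution [y] at [(w0, l1)].
    By [graph_diff], the form of [z - u] at time [t] bounds the change of the Weyl matrix. Fix [t]
    so large that [z] and [y] have decayed, and only then the neighbourhood on which [u] follows [y]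
    up to [t]. *)
Lemma weyl_continuous (w0 : Om) (l1 : C) (e : R) : Im l1 != 0 -> 0 < e ->
  \forall p \near (w0, l1), forall i j, nsq (M p.1 p.2 i j - M w0 l1 i j) < e.
Proof.
move=> n1 e0.
have b0_gt0 : 0 < `|Im l1| / 2 by rewrite divr_gt0 // normr_gt0.
have B_ge0 : 0 <= 2 * nsq l1 + 2 by have := nsq_ge0 l1; lra.
have [K [C2 [b [K0 C20 b_gt0 hW]]]] := weyl_plus_uniform b0_gt0 B_ge0.
have [Kg Kg0 hKg] := graph_diff b0_gt0 B_ge0.
(* The form of [z - u] is at most 2|z|^2 + 4|y|^2 + 4|u - y|^2 at time [t]: hence the 6 here and the
   4 in [E]. *)
have [t [Tt t0 tsmall]] := exp_small (Kg * (6 * C2 * (1 + K))) T b_gt0 (divr_gt0 e0 (ltr0n R 2)).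
pose E := Kg * (4 * (1 + K)) + 1.
have K1 : 0 <= 1 + K by rewrite addr_ge0.
have E0 : 0 < E by rewrite ltr_wpDl // mulr_ge0 // mulr_ge0.
pose d := e / 2 / E; have d0 : 0 < d by rewrite !divr_gt0.
have nL : \forall p \near (w0, l1), Lam (`|Im l1| / 2) (2 * nsq l1 + 2) p.2.
  have := near_Lam n1 => h.
  by apply: (@cvg_snd _ _ (nbhs w0) (nbhs l1)).
have ll1 : Lam (`|Im l1| / 2) (2 * nsq l1 + 2) l1 by exact: (nbhs_singleton (near_Lam n1)).
apply: filterS2 nL (continuous_dependence w0 l1 t d0) => -[w l] /= ll hdep i j.
pose x : 'cV[C]_n := delta_mx j 0.
have nl := Lam_neq0 b0_gt0 ll.
have [z [hz dz z0]] := weyl_sol_exists x (@M_weyl w l nl).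
have [y [hy dy y0]] := weyl_sol_exists x (@M_weyl w0 l1 n1).
have [u [u0 hu]] := sol_exists l w (y 0).
have [zK zE] := (hW l w ll).2 z hz dz; have [yK yE] := (hW l1 w0 ll1).2 y hy dy.
have sz0 : sqn (z 0) <= 1 + K.
  by move: zK; rewrite (sqn_split (z 0)) z0 col_mxKd col_mxKu sqn_delta; lra.
have sy0 : sqn (y 0) <= 1 + K.
  by move: yK; rewrite (sqn_split (y 0)) y0 col_mxKd col_mxKu sqn_delta; lra.
have zu0 : z 0 - u 0 = col_mx 0 ((M w l - M w0 l1) *m x).
  by rewrite u0 z0 y0 opp_col_mx add_col_mx subrr mulmxBl.
have := hKg l w _ ll (linsolB hz hu) _ t Tt; rewrite /= zu0 col_mxKu col_mxKd => /(_ erefl) hq.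
have -> : M w l i j - M w0 l1 i j = (M w l - M w0 l1) i j by rewrite !mxE.
apply: le_lt_trans (nsq_entry_le _ i j) _; rewrite -/x.
apply: le_lt_trans hq _.
apply: (@le_lt_trans _ _ (Kg * (6 * C2 * (1 + K) * expR (- b * t) + 4 * d * (1 + K)))).
  rewrite ler_wpM2l //; apply: le_trans (ler_norm _) _; apply: le_trans (Qs_le _ _) _.
  have := sqnB (z t) (u t); have := sqnD (u t - y t) (y t); rewrite subrK.
  have := hdep u y hu hy u0 t; rewrite t0 lexx => /(_ isT) g1.
  have g2 := zE t t0; have g3 := yE t t0.
  have p0 : 0 <= C2 * expR (- b * t) by rewrite mulr_ge0 ?expR_ge0.
  have g4 : C2 * expR (- b * t) * sqn (z 0) <= C2 * expR (- b * t) * (1 + K) by rewrite ler_wpM2l.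
  have g5 : C2 * expR (- b * t) * sqn (y 0) <= C2 * expR (- b * t) * (1 + K) by rewrite ler_wpM2l.
  have g6 : d * sqn (y 0) <= d * (1 + K) by rewrite ler_wpM2l // ltW.
  have -> : 6 * C2 * (1 + K) * expR (- b * t) = 6 * (C2 * expR (- b * t) * (1 + K)) by ring.
  rewrite -mulrA; lra.
rewrite mulrDr mulrA.
have g7 : Kg * (4 * d * (1 + K)) <= e / 2.
  have -> : e / 2 = d * E by rewrite /d mulfVK // lt0r_neq0.
  have -> : Kg * (4 * d * (1 + K)) = d * (E - 1) by rewrite /E; ring.
  by rewrite ler_wpM2l // ?gerBl // ltW.
lra.
Qed.

(** Change the coefficients and the initial slope one after the other: [u] solves at [l] from the
    initial value of [y], so [u - y] is small by [continuous_dependence] and [z - u] by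
    [weyl_continuous] and growth. *)
Lemma weyl_sol_continuous (w : Om) (l1 : C) (S e : R) : Im l1 != 0 -> 0 < e ->
  \forall l \near l1, forall (z y : R -> vec) x, sol l w z -> sol l1 w y ->
    decays z -> decays y -> usubmx (z 0) = x -> usubmx (y 0) = x ->
    forall t, 0 <= t <= S -> sqn (z t - y t) <= e * sqn x.
Proof.
move=> n1 e0.
have b0_gt0 : 0 < `|Im l1| / 2 by rewrite divr_gt0 // normr_gt0.
have B_ge0 : 0 <= 2 * nsq l1 + 2 by have := nsq_ge0 l1; lra.
have [K [C2 [b [K0 C20 b_gt0 hW]]]] := weyl_plus_uniform b0_gt0 B_ge0.
have [L L0 hL] := sol_growth B_ge0.
pose E1 := 4 * (1 + K) + 1; have E10 : 0 < E1 by rewrite ltr_wpDl // mulr_ge0 // addr_ge0.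
pose S' := `|S|.
pose E2 := 4 * expR (L * S') * (n * n)%:R + 1.
have E20 : 0 < E2 by rewrite ltr_wpDl // mulr_ge0 // mulr_ge0 // expR_ge0.
have d1 : 0 < e / E1 by rewrite divr_gt0.
have d2 : 0 < e / E2 by rewrite divr_gt0.
have ll1 : Lam (`|Im l1| / 2) (2 * nsq l1 + 2) l1 by exact: (nbhs_singleton (near_Lam n1)).
have slice (P : set (Om * C)) : (\forall p \near (w, l1), P p) -> \forall l \near l1, P (w, l).
  case=> -[P1 P2] /= [h1 h2] h12; apply: filterS h2 => l Pl.
  by apply: h12; split => //=; exact: (nbhs_singleton h1).
have c1 := slice _ (continuous_dependence w l1 S' d1).
have c2 := slice _ (weyl_continuous w n1 d2).
apply: filterS3 (near_Lam n1) c1 c2 => l ll /= hdep hM z y x hz hy dz dy zx yx t /andP[t0 tS].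
have nl := Lam_neq0 b0_gt0 ll.
have tS' : 0 <= t <= S' by rewrite t0 (le_trans tS) // ler_norm.
have [u [u0 hu]] := sol_exists l w (y 0).
have g1 := hdep u y hu hy u0 t tS'.
have z2 := (M_weyl nl hz).1 dz; have y2 := (M_weyl n1 hy).1 dy.
have sy0 : sqn (y 0) <= (1 + K) * sqn x.
  have [h _] := (hW l1 w ll1).2 y hy dy.
  by rewrite (sqn_split (y 0)) yx mulrDl mul1r lerD2l -yx.
have zu0 : z 0 - u 0 = col_mx 0 ((M w l - M w l1) *m x).
  rewrite u0 -[z 0]vsubmxK -[y 0]vsubmxK z2 y2 zx yx.
  by rewrite opp_col_mx add_col_mx subrr mulmxBl.
have g2 : sqn (z t - u t) <= expR (L * S') * ((n * n)%:R * (e / E2) * sqn x).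
  apply: le_trans (hL l w _ t ll.2 t0 (linsolB hz hu)) _; rewrite zu0.
  apply: ler_pM; rewrite ?expR_ge0 ?sqn_ge0 //.
    by rewrite ler_expR ler_wpM2l //; case/andP: tS'.
  rewrite sqn_col_mx sqn0 add0r; apply: sqn_mulmx => i j; rewrite !mxE; exact/ltW/hM.
have := sqnD (z t - u t) (u t - y t); rewrite subrKA.
have g3 : e / E1 * sqn (y 0) <= e / E1 * ((1 + K) * sqn x) by rewrite ler_wpM2l // ltW.
have g4 : 2 * (e / E1 * ((1 + K) * sqn x)) <= e / 2 * sqn x.
  have -> : 2 * (e / E1 * ((1 + K) * sqn x)) = (e / E1) * (2 * (1 + K)) * sqn x by ring.
  rewrite ler_wpM2r ?sqn_ge0 //.
  have -> : e / 2 = e / E1 * (E1 / 2) by field; rewrite lt0r_neq0.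
  by rewrite ler_wpM2l ?(ltW d1) // /E1; lra.
have g5 : 2 * (expR (L * S') * ((n * n)%:R * (e / E2) * sqn x)) <= e / 2 * sqn x.
  have -> : 2 * (expR (L * S') * ((n * n)%:R * (e / E2) * sqn x)) =
    (e / E2) * (2 * expR (L * S') * (n * n)%:R) * sqn x by ring.
  rewrite ler_wpM2r ?sqn_ge0 //.
  have -> : e / 2 = e / E2 * (E2 / 2) by field; rewrite lt0r_neq0.
  by rewrite ler_wpM2l ?(ltW d2) // /E2; lra.
have : e * sqn x = e / 2 * sqn x + e / 2 * sqn x by rewrite -mulrDl -splitr.
lra.
Qed.

(** The constant is written as a square because its root enters the modulus bound of
    [tail_bound]. *)
Lemma Delta_dot_bound : exists2 k, 1 <= k & forall w (x y : vec),
  nsq (((dsubmx x)^T *m toC (Delta w) *m dsubmx y) 0 0) <= k ^+ 2 * (sqn x * sqn y).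
Proof.
have [h h0 hh] := family_bounds.
pose k0 := n%:R * ((n * n)%:R * h).
have k00 : 0 <= k0 by rewrite !mulr_ge0.
exists (k0 + 1) => [|w x y]; first by rewrite lerDr.
rewrite -mulmxA; apply: le_trans (nsq_dot _ _) _.
apply: (@le_trans _ _ (k0 * (sqn x * sqn y))).
  have e1 : sqn (toC (Delta w) *m dsubmx y) <= (n * n)%:R * h * sqn y.
    apply: (@le_trans _ _ ((n * n)%:R * h * sqn (dsubmx y))).
      by apply: sqn_mulmx => i j; rewrite toCE nsq_real; exact: (hh _).2.
    by rewrite ler_wpM2l ?sqn_dsub_le // mulr_ge0.
  have -> : k0 * (sqn x * sqn y) = n%:R * (sqn x * ((n * n)%:R * h * sqn y)).
    by rewrite /k0; ring.
  rewrite -mulrA ler_wpM2l //; apply: ler_pM; rewrite ?sqn_ge0 ?sqn_dsub_le //.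
have : 0 <= sqn x * sqn y by rewrite mulr_ge0 ?sqn_ge0.
have : k0 <= (k0 + 1) ^+ 2 by have := sqr_ge0 k0; rewrite sqrrD1; lra.
by move=> a p; rewrite ler_wpM2r.
Qed.

(* The difference quotient of the Weyl function is, up to sign, the value at 0
   of a function whose derivative is the integrand z2^T Delta z2'. *)
Lemma quotient_derive l m w (z y : R -> vec) : sol l w z -> sol m w y -> m != l ->
  forall t : R, is_cderive (fun u => (m - l)^-1 * bJ (z u) (y u) 0 0) t
    (((dsubmx (z t))^T *m toC (Delta (s t w)) *m dsubmx (y t)) 0 0).
Proof.
move=> hz hy ml t; have h := bJ_derive H_sp Delta_sym hz hy t 0 0.
have := cderiveM (cderive_cst (m - l)^-1 t) h; rewrite mul0r add0r mxE.
by rewrite mulKf // subr_eq0.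
Qed.

Lemma weyl_quotient l m w i j (z y : R -> vec) : Im l != 0 ->
  z 0 = col_mx (delta_mx i 0) (M w l *m delta_mx i 0) ->
  y 0 = col_mx (delta_mx j 0) (M w m *m delta_mx j 0) ->
  (m - l)^-1 * bJ (z 0) (y 0) 0 0 = - ((m - l)^-1 * (M w m i j - M w l i j)).
Proof.
move=> nl -> ->; rewrite /bJ !col_mxKd !col_mxKu.
have subE (a b : 'M[C]_1) : (a - b) 0 0 = a 0 0 - b 0 0 by rewrite !mxE.
rewrite subE -mx_entryE.
rewrite trmx_mul -mulmxA (weyl_sym (@M_weyl w l nl)).
by rewrite -mx_entryE -mulrN opprB.
Qed.

(** Up to sign each quotient is the value at 0 of a function that vanishes at +oo and has the
    integrand as derivative. Beyond [S] both are small by decay uniform in the parameter; on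
    [[0, S]] the integrands are close because [y] and [y'] both stay near the Weyl solution [u] at
    [l]. *)
Lemma weyl_quotient_cauchy w l (e : R) : Im l != 0 -> 0 < e ->
  \forall m \near l & m' \near l, m != l -> m' != l -> forall i j,
    nsq ((m - l)^-1 * (M w m i j - M w l i j) -
         (m' - l)^-1 * (M w m' i j - M w l i j)) < e.
Proof.
move=> nl e0.
have b0_gt0 : 0 < `|Im l| / 2 by rewrite divr_gt0 // normr_gt0.
have B_ge0 : 0 <= 2 * nsq l + 2 by have := nsq_ge0 l; lra.
have [K [C2 [b [K0 C20 b_gt0 hW]]]] := weyl_plus_uniform b0_gt0 B_ge0.
have [k k1 hk] := Delta_dot_bound; have k0 : 0 <= k by apply: le_trans k1.
have K1 : 0 <= 1 + K by rewrite addr_ge0.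
pose X := k * (C2 * (1 + K)); have X0 : 0 <= X by rewrite mulr_ge0 // mulr_ge0.
pose r := Num.sqrt (e / 4); have r0 : 0 < r by rewrite sqrtr_gt0 divr_gt0.
have r2 : r ^+ 2 = e / 4 by rewrite sqr_sqrtr // divr_ge0 // ltW.
have [S [_ S0 hS]] := exp_small (X / b) 0 b_gt0 (divr_gt0 r0 (ltr0n R 4)).
pose d := r / 4 / (S + 1); have S1 : 0 < S + 1 by rewrite ltr_wpDl.
have d0 : 0 < d by rewrite !divr_gt0.
pose E := k ^+ 2 * (C2 * (1 + K)) * 4 + 1.
have E0 : 0 < E by rewrite ltr_wpDl // !mulr_ge0.
pose e1 := d ^+ 2 / E; have e10 : 0 < e1 by rewrite divr_gt0 // exprn_gt0.
have ll1 : Lam (`|Im l| / 2) (2 * nsq l + 2) l by exact: (nbhs_singleton (near_Lam nl)).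
have good := filterI (near_Lam nl)
  (weyl_sol_continuous w S nl e10).
pose G := [set m | Lam (`|Im l| / 2) (2 * nsq l + 2) m /\
   forall (z y : R -> vec) x, sol m w z -> sol l w y ->
    decays z -> decays y -> usubmx (z 0) = x -> usubmx (y 0) = x ->
    forall t, 0 <= t <= S -> sqn (z t - y t) <= e1 * sqn x].
exists (G, G) => [|[m m'] /= [[lm cm] [lm' cm']] ml ml' i j]; first by split; exact: good.
have nm := Lam_neq0 b0_gt0 lm; have nm' := Lam_neq0 b0_gt0 lm'.
have [z [hz dz z0]] := weyl_sol_exists (delta_mx i 0) (@M_weyl w l nl).
have [u [hu du u0]] := weyl_sol_exists (delta_mx j 0) (@M_weyl w l nl).
have [y [hy dy y0]] := weyl_sol_exists (delta_mx j 0) (@M_weyl w m nm).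
have [y' [hy' dy' y'0]] := weyl_sol_exists (delta_mx j 0) (@M_weyl w m' nm').
have bound q (v : R -> vec) p : Lam (`|Im l| / 2) (2 * nsq l + 2) q -> sol q w v -> decays v ->
    v 0 = col_mx (delta_mx p 0) (M w q *m delta_mx p 0) ->
    forall t, 0 <= t -> sqn (v t) <= C2 * (1 + K) * expR (- b * t).
  move=> lq hv dv v0 t t0; have [g1 g2] := (hW q w lq).2 v hv dv.
  apply: le_trans (g2 t t0) _; rewrite [X in _ <= X]mulrAC; apply: ler_wpM2l.
    by apply: mulr_ge0 => //; exact: expR_ge0.
  by move: g1; rewrite (sqn_split (v 0)) v0 col_mxKu col_mxKd sqn_delta; lra.
have bz := bound l z i ll1 hz dz z0.
pose g q (v : R -> vec) t := (q - l)^-1 * bJ (z t) (v t) 0 0.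
pose dg (v : R -> vec) t := ((dsubmx (z t))^T *m toC (Delta (s t w)) *m dsubmx (v t)) 0 0.
have hg q v : sol q w v -> q != l -> forall t, is_cderive (g q v) t (dg v t).
  by move=> hv ql; exact: quotient_derive.
have dgB t : 0 <= t <= S -> nsq (dg y t - dg y' t) <= d ^+ 2.
  move=> /andP[t0 tS].
  have -> : dg y t - dg y' t = ((dsubmx (z t))^T *m toC (Delta (s t w)) *m dsubmx (y t - y' t)) 0 0.
    have -> : dsubmx (y t - y' t) = dsubmx (y t) - dsubmx (y' t).
      by apply/matrixP => a a'; rewrite !mxE.
    by rewrite mulmxBr [RHS]mxE; congr (_ + _); rewrite [RHS]mxE.
  apply: le_trans (hk (s t w) (z t) (y t - y' t)) _.
  have q1 : sqn (y t - y' t) <= 4 * e1.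
    have tt : 0 <= t <= S by rewrite t0.
    have a1 := cm y u _ hy hu dy du (erefl _) _ t tt; have a2 := cm' y' u _ hy' hu dy' du (erefl _) _ t tt.
    rewrite y0 u0 !col_mxKu in a1; rewrite y'0 u0 !col_mxKu in a2.
    have := a1 erefl; have := a2 erefl; rewrite sqn_delta.
    have := sqnB (y t - u t) (y' t - u t).
    have -> : y t - u t - (y' t - u t) = y t - y' t by rewrite opprB addrA subrK.
    lra.
  have q2 : sqn (z t) <= C2 * (1 + K).
    apply: le_trans (bz t t0) _; rewrite ler_piMr ?mulr_ge0 //.
    by rewrite -expR0 ler_expR mulNr oppr_le0 mulr_ge0 // ltW.
  have q3 := ler_pM (sqn_ge0 _) (sqn_ge0 _) q2 q1.
  have q4 := ler_wpM2l (sqr_ge0 k) q3.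
  apply: le_trans q4 _.
  have -> : k ^+ 2 * (C2 * (1 + K) * (4 * e1)) = e1 * (E - 1) by rewrite /E; ring.
  have -> : d ^+ 2 = e1 * E by rewrite /e1 mulfVK // lt0r_neq0.
  by rewrite ler_wpM2l ?gerBl // ltW.
(* Real and imaginary parts are treated through a common projection [p], as the comparison of
   derivatives is for real functions. *)
have key (p : C -> R) : (forall x, p x ^+ 2 <= nsq x) ->
    (forall x y, p (x - y) = p x - p y) ->
    (forall f t a, is_cderive f t a -> is_derive t 1 (fun u => p (f u)) (p a)) ->
    p (g m y 0 - g m' y' 0) ^+ 2 <= e / 4.
  move=> p1 p2 p3.
  have sq_le (a c' : R) : 0 <= c' -> a ^+ 2 <= c' ^+ 2 -> `|a| <= c'.
    by move=> c'0; rewrite -[a ^+ 2]real_normK ?num_real // ler_sqr ?nnegrE.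
  have tail q v : Lam (`|Im l| / 2) (2 * nsq l + 2) q -> q != l -> sol q w v -> decays v ->
      v 0 = col_mx (delta_mx j 0) (M w q *m delta_mx j 0) -> `|p (g q v S)| <= r / 4.
    move=> lq ql hv dv v0; apply: le_trans _ (ltW hS).
    apply: (tail_bound b_gt0 X0 S0 (fun t => p3 _ _ _ (hg q v hv ql t))) => [t t0|d' d'0].
      apply: sq_le; first by rewrite mulr_ge0 ?expR_ge0.
      apply: le_trans (p1 _) _; apply: le_trans (hk _ _ _) _.
      have := ler_pM (sqn_ge0 _) (sqn_ge0 _) (bz t t0) (bound q v j lq hv dv v0 t t0).
      move=> /(ler_wpM2l (sqr_ge0 k)) h; apply: le_trans h _.
      by rewrite le_eqVlt; apply/orP; left; apply/eqP; rewrite /X; ring.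
    pose c2 := nsq (q - l)^-1 + 1; have c20 : 0 < c2 by rewrite ltr_wpDl // nsq_ge0.
    have [t0 ht] := bJ_decays_lim dz dv (divr_gt0 (exprn_gt0 2 d'0) c20).
    exists t0 => t tt; rewrite -ltr_sqr ?nnegrE ?(ltW d'0) // real_normK ?num_real //.
    apply: le_lt_trans (p1 _) _; rewrite /g nsqM.
    have := ht t tt; rewrite ltr_pdivlMr // => h; apply: le_lt_trans h.
    by rewrite mulrC ler_wpM2l ?nsq_ge0 // lerDl.
  have t1 := tail m y lm ml hy dy y0; have t2 := tail m' y' lm' ml' hy' dy' y'0.
  pose F t := p (g m y t - g m' y' t).
  have hF (t : R) : is_derive t 1 F (p (dg y t) - p (dg y' t)).
    have := rderivB (p3 _ _ _ (hg m y hy ml t)) (p3 _ _ _ (hg m' y' hy' ml' t)).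
    by apply: eq_is_derive => v; rewrite /F p2.
  have dF t : 0 <= t <= S -> `|p (dg y t) - p (dg y' t)| <= d.
    by move=> tt; rewrite -p2; apply: sq_le (ltW d0) _; apply: le_trans (p1 _) (dgB t tt).
  have hd (t : R) : is_derive t 1 (fun u : R => d * u) d.
    by have := rderivZ d (is_derive_id t 1); rewrite mulr1.
  have f1 : F S - F 0 <= d * S - d * 0.
    apply: (deriv_le_le S0 (fun t _ => hF t) (fun t _ => hd t)) => t tt.
    exact: le_trans (ler_norm _) (dF t tt).
  have f2 : - F S - - F 0 <= d * S - d * 0.
    apply: (deriv_le_le S0 (fun t _ => rderivN (hF t)) (fun t _ => hd t)) => t tt.
    by apply: le_trans (dF t tt); rewrite -normrN ler_norm.
  have dS : d * S <= r / 4.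
    have -> : r / 4 = d * (S + 1) by rewrite /d mulfVK // lt0r_neq0.
    by rewrite ler_wpM2l ?lerDl // ltW.
  have FS : F S = p (g m y S) - p (g m' y' S) by rewrite /F p2.
  rewrite -/(F 0) -r2 -[X in X <= _]real_normK ?num_real // ler_sqr ?nnegrE ?(ltW r0) //.
  by apply: norm_le_of_increment t1 t2 FS f1 f2 _; rewrite mulr0 subr0.
have eg : g m y 0 - g m' y' 0 = - ((m - l)^-1 * (M w m i j - M w l i j) -
         (m' - l)^-1 * (M w m' i j - M w l i j)).
  by rewrite /g (weyl_quotient nl z0 y0) (weyl_quotient nl z0 y'0) opprB opprK addrC.
rewrite -nsqN -eg.
have h1 : Re (g m y 0 - g m' y' 0) ^+ 2 <= e / 4.
  apply: key; [by move=> x; rewrite lerDl sqr_ge0 | exact: cReB | by move=> f t a []].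
have h2 : Im (g m y 0 - g m' y' 0) ^+ 2 <= e / 4.
  apply: key; [by move=> x; rewrite lerDr sqr_ge0 | exact: cImB | by move=> f t a []].
apply: le_lt_trans (lerD h1 h2) _; have -> : e / 4 + e / 4 = e / 2 by field.
by rewrite ltr_pdivrMr // ltr_pMr // ltr1n.
Qed.

Lemma weyl_holomorphic w l : Im l != 0 -> derivable (M w) l 1.
Proof.
move=> nl; apply: cauchy_mx_cvg => e e0.
have [[P Q] /= [hP hQ] PQ] := weyl_quotient_cauchy w nl e0.
have shift_cvg : (fun h : C => h *: 1 + l) @ nbhs (0 : C) --> l.
  apply/cvgC_nsqP => d d0.
  have /cvgC_nsqP /(_ d d0) : (fun h : C => h) @ nbhs (0 : C) --> (0 : C) by exact: cvg_id.
  by apply: filterS => h; rewrite subr0 addrK /GRing.scale /= mulr1.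
exists [set h | h != 0 /\ P (h *: 1 + l) /\ Q (h *: 1 + l)].
  have ab : nbhs (0 : C) [set h : C | P (h *: 1 + l) /\ Q (h *: 1 + l)].
    by apply: filterI; [exact: shift_cvg _ hP | exact: shift_cvg _ hQ].
  by rewrite /dnbhs /within /=; apply: filterS ab => h [Ph Qh] h0.
move=> h h' [h0 [Ph _]] [h'0 [_ Qh']] i j.
have sE (u : C) : u *: 1 + l - l = u by rewrite addrK /GRing.scale /= mulr1.
have neq (u : C) : u != 0 -> u *: 1 + l != l.
  by move=> u0; rewrite -subr_eq0 sE.
have := PQ (h *: 1 + l, h' *: 1 + l) (conj Ph Qh') (neq _ h0) (neq _ h'0) i j.
by rewrite /= !sE !mxE.
Qed.

End Regularity.

End WeylPlus.
End MonotoneFamily.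

(** * From dichotomies to time steps, and time reversal *)

Section Reduction.
Variables (R : realType) (Om : metricType R) (s : R -> Om -> Om) (n : nat).
Variables (H : Om -> 'M[R]_(n + n)) (Delta : Om -> 'M[R]_n).
Hypothesis Om_compact : compact [set: Om].
Hypothesis s_flow : continuous_flow s.
Hypothesis H_cont : continuous H.
Hypothesis H_sp : forall w, in_sp (H w).
Hypothesis Delta_cont : continuous Delta.
Local Notation C := R[i].
Local Notation Re := (@complex.Re R).
Local Notation Im := (@complex.Im R).
Local Notation A := (hamiltonian_family H Delta).
Local Notation sol l w Z := (linsol (fun t => A l (s t w)) Z).
Local Notation vec := 'cV[C]_(n + n).

Lemma subbundle_linear m (L : set (Om * 'cV[C]_m)) w x y : closed_subbundle L ->
  L (w, x) -> L (w, y) -> L (w, x + y) /\ L (w, x - y).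
Proof.
move=> [_ /(_ w) [k [N0 [v [_ Ow _ /(_ w Ow) [_ hf]]]]]] hx hy.
have [a _ ax] : [set v w *m c | c in [set: 'cV[C]_k]] x by rewrite -hf.
have [b _ bx] : [set v w *m c | c in [set: 'cV[C]_k]] y by rewrite -hf.
have mem z : [set v w *m c | c in [set: 'cV[C]_k]] z -> L (w, z) by rewrite -hf.
split; apply: mem; [exists (a + b) | exists (a - b)] => //.
  by rewrite mulmxDr ax bx.
by rewrite mulmxBr ax bx.
Qed.

Lemma fundamental_sol l (U : R -> Om -> 'M[C]_(n + n)) w (z : R -> vec) :
  fundamental_matrix s (A l) U -> sol l w z -> forall t, z t = U t w *m z 0.
Proof.
move=> fU hz; have [U0 hU] := fU w.
apply: (sol_unique Om_compact H_cont Delta_cont hz (linsolM (z 0) hU)).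
by rewrite U0 mul1mx.
Qed.

Lemma fundamental_inv l (U : R -> Om -> 'M[C]_(n + n)) w (z : vec) t :
  fundamental_matrix s (A l) U -> U (- t) (s t w) *m (U t w *m z) = z.
Proof.
move=> fU; have [U0 hU] := fU w.
have := fundamental_sol fU (sol_shift s_flow t (linsolM z hU)) (- t).
by rewrite addNr add0r U0 mul1mx => <-.
Qed.

Lemma ed_step l : exp_dichotomy s (A l) -> exists T c Pp Pm,
  [/\ 0 < T, 0 <= c & step_dichotomy s (A l) T c Pp Pm].
Proof.
move=> [Lp [Lm [sp sm ws [U [fU ip im [eta [beta [eta1 beta0 hp hm]]]]]]]].
have [PP hPP] : {PP : Om * vec -> vec * vec & forall p,
    [/\ Lp (p.1, (PP p).1), Lm (p.1, (PP p).2) & p.2 = (PP p).1 + (PP p).2]}.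
  apply: (@choice _ _ (fun p q => [/\ Lp (p.1, q.1), Lm (p.1, q.2) & p.2 = q.1 + q.2])).
  by move=> [w z]; have [zp [zm h]] := (ws w).1 z; exists (zp, zm).
pose Pp w z := (PP (w, z)).1; pose Pm w z := (PP (w, z)).2.
have LP w z : Lp (w, Pp w z) by have [] := hPP (w, z).
have LM w z : Lm (w, Pm w z) by have [] := hPP (w, z).
have PPE w z : Pp w z + Pm w z = z by have [] := hPP (w, z).
have uniq w z zp zm : Lp (w, zp) -> Lm (w, zm) -> z = zp + zm ->
    Pp w z = zp /\ Pm w z = zm.
  move=> hzp hzm e.
  have d : Pp w z - zp = zm - Pm w z.
    by apply/eqP; rewrite subr_eq addrAC eq_sym subr_eq addrC -e PPE.
  have d0 : Pp w z - zp = 0.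
    apply: (ws w).2.
      exact: (subbundle_linear sp (LP w z) hzp).2.
    by rewrite d; exact: (subbundle_linear sm hzm (LM w z)).2.
  split; apply/eqP; rewrite -subr_eq0; first by rewrite d0.
  by rewrite -oppr_eq0 opprB -d d0.
have eta0 : 0 < eta by apply: lt_le_trans eta1.
(* Squaring 1/4 gives 1/16, below the factor 1/8 of [step_dichotomy]. *)
have [T [_ T0 hT]] : exists T, [/\ 1 <= T, 0 <= T & eta * expR (- beta * T) < 4^-1].
  by apply: exp_small => //; rewrite invr_gt0.
pose T' := T + 1.
have T'0 : 0 < T' by rewrite ltr_wpDl.
pose q := eta * expR (- beta * T').
have q0 : 0 <= q by rewrite mulr_ge0 ?expR_ge0 // ltW.
have q4 : q <= 4^-1.
  apply: le_trans (ltW hT); rewrite ler_wpM2l ?(ltW eta0) // ler_expR.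
  by rewrite !mulNr lerN2 ler_wpM2l ?(ltW beta0) // /T' lerDl.
have q2 : q ^+ 2 <= 8^-1.
  apply: (@le_trans _ _ (4^-1 ^+ 2)); first by rewrite ler_sqr ?nnegrE // invr_ge0.
  by rewrite expr2; lra.
have cp w z : Lp (w, z) -> sqn (U T' w *m z) <= 8^-1 * sqn z.
  move=> hz; apply: le_trans ((enorm_le _ _ q0).1 (hp T' w z (ltW T'0) hz)) _.
  by rewrite ler_wpM2r ?sqn_ge0.
have cm w z : Lm (w, z) -> 8 * sqn z <= sqn (U T' w *m z).
  move=> hz; have := hm (- T') (s T' w) (U T' w *m z) _ (im T' w z hz).
  rewrite (fundamental_inv w z T' fU) oppr_le0 mulrN -mulNr => /(_ (ltW T'0)).
  move=> /(enorm_le _ _ q0) h.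
  have : sqn z <= 8^-1 * sqn (U T' w *m z).
    by apply: le_trans h _; rewrite ler_wpM2r ?sqn_ge0.
  lra.
have [L L0 hL] := sol_growth s Om_compact H_cont Delta_cont (nsq_ge0 l).
pose E := expR (L * T'); have E0 : 0 <= E := expR_ge0 _.
(* The step itself bounds the projections: the expanded [Pm w z] is the difference of the image of
   [z], of bounded growth, and the contracted [Pp w z], which is in turn bounded by [z] and
   [Pm w z]. *)
have bd w z : sqn (Pp w z) <= (4 * E + 4) * sqn z /\ sqn (Pm w z) <= (4 * E + 4) * sqn z.
  have h1 := cp _ _ (LP w z); have h2 := cm _ _ (LM w z).
  have h3 : sqn (U T' w *m z) <= E * sqn z.
    have [U0 hU] := fU w; have := hL l w _ T' (lexx _) (ltW T'0) (linsolM z hU).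
    by rewrite U0 mul1mx.
  have h4 : sqn (U T' w *m Pm w z) <= 2 * sqn (U T' w *m z) + 2 * sqn (U T' w *m Pp w z).
    have -> : U T' w *m Pm w z = U T' w *m z - U T' w *m Pp w z.
      by rewrite -mulmxBr -{2}(PPE w z) addrAC subrr add0r.
    exact: sqnB.
  have h5 : sqn (Pp w z) <= 2 * sqn z + 2 * sqn (Pm w z).
    have -> : Pp w z = z - Pm w z by rewrite -{2}(PPE w z) addrK.
    exact: sqnB.
  have z0 := sqn_ge0 z; have Ez : 0 <= E * sqn z by rewrite mulr_ge0.
  have m0 := sqn_ge0 (Pm w z).
  by split; rewrite mulrDl -mulrA; lra.
exists T', (4 * E + 4), Pp, Pm; split => //.
  by rewrite addr_ge0 // mulr_ge0.
split => //.
- move=> w x y.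
  apply: uniq; first exact: (subbundle_linear sp (LP w x) (LP w y)).1.
    exact: (subbundle_linear sm (LM w x) (LM w y)).1.
  by rewrite addrACA !PPE.
- move=> w y hy; rewrite (fundamental_sol fU hy T').
  have e : U T' w *m y 0 = U T' w *m Pp w (y 0) + U T' w *m Pm w (y 0).
    by rewrite -mulmxDr PPE.
  have [-> ->] := uniq _ _ _ _ (ip T' w _ (LP w (y 0))) (im T' w _ (LM w (y 0))) e.
  by split; [apply: cp | apply: cm].
Qed.

(* Time reversal combined with z2 -> - z2 gives a family of the same form. *)
Definition flip k (Z : 'M[C]_(n + n, k)) : 'M[C]_(n + n, k) :=
  col_mx (usubmx Z) (- dsubmx Z).

Definition rev_flow (t : R) (w : Om) : Om := s (- t) w.

(** Only [H1] changes sign. [Delta] and the parameter stay the same, so the results at +oo apply to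
    the reversed family and carry over to -oo. *)
Definition rev_H (w : Om) : 'M[R]_(n + n) :=
  block_mx (- ulsubmx (H w)) (ursubmx (H w)) (dlsubmx (H w)) (ulsubmx (H w))^T.

Local Notation rsol l w Z :=
  (linsol (fun t => hamiltonian_family rev_H Delta l (rev_flow t w)) Z).

Lemma flipK k (Z : 'M[C]_(n + n, k)) : flip (flip Z) = Z.
Proof. by rewrite /flip col_mxKu col_mxKd opprK vsubmxK. Qed.

Lemma flipD k (Z W : 'M[C]_(n + n, k)) : flip (Z + W) = flip Z + flip W.
Proof.
rewrite /flip add_col_mx -opprD; congr col_mx; last congr (- _);
by apply/matrixP => i j; rewrite !mxE.
Qed.

Lemma sqn_flip (z : vec) : sqn (flip z) = sqn z.
Proof. by rewrite /flip sqn_col_mx sqnN -sqn_split. Qed.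

Lemma tderive_flip k (Z : R -> 'M[C]_(n + n, k)) t D : is_tderive Z t D ->
  is_tderive (fun u => flip (Z u)) t (flip D).
Proof.
move=> h i j; rewrite /flip.
have [i' ->|i' ->] := split_ordP i.
  have [a b] := h (lshift n i') j.
  have e u : col_mx (usubmx (Z u)) (- dsubmx (Z u)) (lshift n i') j = Z u (lshift n i') j.
    by rewrite col_mxEu mxE.
  rewrite col_mxEu mxE.
  by split; [apply: eq_is_derive a | apply: eq_is_derive b] => u; rewrite e.
have [a b] := h (rshift n i') j.
have e u : col_mx (usubmx (Z u)) (- dsubmx (Z u)) (rshift n i') j = - Z u (rshift n i') j.
  by rewrite col_mxEd !mxE.
rewrite col_mxEd !mxE cReN cImN.
split; [apply: eq_is_derive (rderivN a) | apply: eq_is_derive (rderivN b)] => u;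
by rewrite e ?cReN ?cImN.
Qed.

Lemma rev_mulmx k l w (Z : 'M[C]_(n + n, k)) :
  hamiltonian_family rev_H Delta l w *m flip Z = - flip (A l w *m Z).
Proof.
rewrite !hamiltonian_mulmx /rev_H block_mxKul block_mxKur block_mxKdl /flip.
rewrite !col_mxKu !col_mxKd opp_col_mx opprK.
have -> : toC (- ulsubmx (H w)) = - toC (ulsubmx (H w)).
  by apply/matrixP => i j; rewrite !mxE rmorphN.
congr col_mx.
  by rewrite mulNmx !mulmxN scalerN -!opprD.
have -> : (- toC (ulsubmx (H w)))^T = - (toC (ulsubmx (H w)))^T.
  by apply/matrixP => i j; rewrite !mxE.
by rewrite mulmxN opprK mulNmx.
Qed.

Lemma rev_sol k l w (Z : R -> 'M[C]_(n + n, k)) : sol l w Z ->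
  rsol l w (fun t => flip (Z (- t))).
Proof.
move=> h t; rewrite rev_mulmx /rev_flow.
have -> : - flip (A l (s (- t) w) *m Z (- t)) = flip (- (A l (s (- t) w) *m Z (- t))).
  rewrite /flip opp_col_mx; congr col_mx; first by apply/matrixP => i j; rewrite !mxE.
  by congr (- _); apply/matrixP => i j; rewrite !mxE.
by apply: tderive_flip; exact: tderive_opp (h (- t)).
Qed.

Lemma sol_rev k l w (Z : R -> 'M[C]_(n + n, k)) : rsol l w Z ->
  sol l w (fun t => flip (Z (- t))).
Proof.
move=> h t.
have -> : A l (s t w) *m flip (Z (- t)) = flip (- (hamiltonian_family rev_H Delta l (s t w) *m Z (- t))).
  have := rev_mulmx l (s t w) (flip (Z (- t))); rewrite flipK => ->.
  by rewrite opprK flipK.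
apply: tderive_flip; have := tderive_opp (h (- t)).
by rewrite /rev_flow opprK.
Qed.

Lemma rev_continuous_flow : continuous_flow rev_flow.
Proof.
have [c f0 fD] := s_flow; split.
- move=> [t w]; apply: (@continuous_comp _ _ _ (fun p : R * Om => (- p.1, p.2)) (fun p => s p.1 p.2)).
    apply: (@cvg_pair _ _ _ (nbhs (t, w)) (nbhs (- t)) (nbhs w) _ _ _ (fun p => - p.1) (fun p => p.2)).
      by apply: cvgN; exact: cvg_fst.
    exact: cvg_snd.
  exact: c.
- by move=> w; rewrite /rev_flow oppr0.
- by move=> t u w; rewrite /rev_flow opprD fD.
Qed.

Lemma rev_H_continuous : continuous rev_H.
Proof.
have cH i j : continuous (fun w => H w i j) by apply: mx_continuous_entry.
move=> w; apply/cvg_mx_entries => i j; rewrite /rev_H.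
have [i' ->|i' ->] := split_ordP i; have [j' ->|j' ->] := split_ordP j.
- rewrite block_mxEul !mxE; under eq_fun do rewrite block_mxEul !mxE.
  by apply: cvgN; exact: cH.
- by rewrite block_mxEur !mxE; under eq_fun do rewrite block_mxEur !mxE; exact: cH.
- by rewrite block_mxEdl !mxE; under eq_fun do rewrite block_mxEdl !mxE; exact: cH.
- by rewrite block_mxEdr !mxE; under eq_fun do rewrite block_mxEdr !mxE; exact: cH.
Qed.

Lemma rev_H_sp w : in_sp (rev_H w).
Proof.
have [H2 H3 _] := in_sp_blocks (H_sp w).
rewrite /in_sp /rev_H /Jmx tr_block_mx !mulmx_block add_block_mx H2 H3 trmxK linearN /=.
rewrite !(mulmx0, mul0mx, mulmx1, mul1mx, mulmxN, mulNmx, addr0, add0r) opprK.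
by rewrite !subrr addNr block_mx0.
Qed.

(** Read backwards, the expansion on [Pm] is a contraction, so the projections change roles. *)
Lemma rev_step l T c Pp Pm : step_dichotomy s (A l) T c Pp Pm ->
  step_dichotomy rev_flow (hamiltonian_family rev_H Delta l) T c
    (fun w z => flip (Pm w (flip z))) (fun w z => flip (Pp w (flip z))).
Proof.
move=> [add pq bd st]; split.
- by move=> w x y; have [a b] := add w (flip x) (flip y); rewrite !flipD a b !flipD.
- by move=> w x; rewrite -flipD addrC pq flipK.
- by move=> w x; have [a b] := bd w (flip x); rewrite !sqn_flip -(sqn_flip x).
move=> w y /sol_rev hy; rewrite !sqn_flip.
have := st (s (- T) w) _ (sol_shift s_flow (- T) hy).
rewrite -(flowD s_flow) subrr (flow0 s_flow) add0r opprK oppr0 /rev_flow.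
move=> [a b]; split => //; lra.
Qed.

Lemma decays_flip (z : R -> vec) : decays (fun t => flip (z t)) <-> decays z.
Proof.
by split=> h e e0; have [t0 ht] := h e e0; exists t0 => t /ht; rewrite sqn_flip.
Qed.

Definition is_weyl_minus (w : Om) (l : C) (M : 'M[C]_n) : Prop := forall z : R -> vec,
  sol l w z -> (decays (fun t => z (- t)) <-> dsubmx (z 0) = M *m usubmx (z 0)).

Lemma weyl_minus_rev w l M : is_weyl rev_flow rev_H Delta w l M ->
  is_weyl_minus w l (- M).
Proof.
move=> h z hz; rewrite -decays_flip.
rewrite (h _ (rev_sol hz)) oppr0 /flip col_mxKu col_mxKd mulNmx.
by split=> [<-|->]; rewrite opprK.
Qed.

End Reduction.

(** * Dichotomy from the two Weyl functions *)

Section BothWeylFunctions.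
Variables (R : realType) (Om : metricType R) (s : R -> Om -> Om) (n : nat).
Variables (H : Om -> 'M[R]_(n + n)) (Delta : Om -> 'M[R]_n).
Hypothesis Om_compact : compact [set: Om].
Hypothesis s_flow : continuous_flow s.
Hypothesis H_cont : continuous H.
Hypothesis H_sp : forall w, in_sp (H w).
Hypothesis Delta_cont : continuous Delta.
Hypothesis Delta_sym : forall w, (Delta w)^T = Delta w.
Hypothesis Delta_pos : forall w, posdef (Delta w).
Local Notation C := R[i].
Local Notation Re := (@complex.Re R).
Local Notation Im := (@complex.Im R).
Local Notation A := (hamiltonian_family H Delta).
Local Notation sol l w Z := (linsol (fun t => A l (s t w)) Z).
Local Notation vec := 'cV[C]_(n + n).

Definition two_sided_weyl (Mp Mm : Om -> C -> 'M[C]_n) : Prop :=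
  forall w l, Im l != 0 -> is_weyl s H Delta w l (Mp w l) /\
    is_weyl_minus s H Delta w l (Mm w l).

Definition uniform_decay (l : C) (K C2 b : R) : Prop := forall w (z : R -> vec), sol l w z ->
  (decays z -> sqn (dsubmx (z 0)) <= K * sqn (usubmx (z 0)) /\
     forall t, 0 <= t -> sqn (z t) <= C2 * expR (- b * t) * sqn (z 0)) /\
  (decays (fun t => z (- t)) -> sqn (dsubmx (z 0)) <= K * sqn (usubmx (z 0)) /\
     forall t, t <= 0 -> sqn (z t) <= C2 * expR (b * t) * sqn (z 0)).

Lemma weyl_both l0 : exp_dichotomy s (A l0) -> exists Mp Mm,
  [/\ two_sided_weyl Mp Mm,
    forall w l, Im l != 0 -> [/\ (Mp w l)^T = Mp w l, (Mm w l)^T = Mm w l,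
      possemidef (Im l *: mxIm (Mp w l)) & possemidef (- Im l *: mxIm (Mm w l))],
    forall w l, Im l != 0 -> derivable (Mp w) l 1 /\ derivable (Mm w) l 1,
    forall w l e, Im l != 0 -> 0 < e -> \forall p \near (w, l),
      (forall i j, nsq (Mp p.1 p.2 i j - Mp w l i j) < e) /\
      (forall i j, nsq (Mm p.1 p.2 i j - Mm w l i j) < e)
  & forall l, Im l != 0 ->
      (exists K C2 b, [/\ 0 <= K, 0 <= C2, 0 < b & uniform_decay l K C2 b]) /\
      forall w (z : R -> vec), sol l w z -> decays z -> decays (fun t => z (- t)) -> z 0 = 0].
Proof.
move=> ed; have [T [c [Pp [Pm [T0 c0 step]]]]] := ed_step Om_compact s_flow H_cont Delta_cont ed.
have rflow := rev_continuous_flow s_flow.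
have rcont := rev_H_continuous H_cont.
have rsp := rev_H_sp H_sp.
have rstep := rev_step s_flow step.
have [Mp hp] := weyl_plus Om_compact s_flow H_cont H_sp Delta_cont Delta_sym Delta_pos T0 c0 step.
have [Mr hr] := weyl_plus Om_compact rflow rcont rsp Delta_cont Delta_sym Delta_pos T0 c0 rstep.
have hm w l (nl : Im l != 0) := weyl_minus_rev (hr w l nl).
exists Mp, (fun w l => - Mr w l); split.
- by move=> w l nl; split; [exact: hp | exact: hm].
- move=> w l nl; split.
  + exact: (weyl_sym Om_compact s_flow H_cont H_sp Delta_cont Delta_sym (hp w l nl)).
  + apply/matrixP => i j; rewrite !mxE.
    by have /matrixP/(_ i j) := weyl_sym Om_compact rflow rcont rsp Delta_cont Delta_sym (hr w l nl); rewrite mxE => ->.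
  + exact: (weyl_herglotz_sign Om_compact s_flow H_cont H_sp Delta_cont Delta_sym Delta_pos (hp w l nl)).
  have := weyl_herglotz_sign Om_compact rflow rcont rsp Delta_cont Delta_sym Delta_pos (hr w l nl).
  suff -> : - Im l *: mxIm (- Mr w l) = Im l *: mxIm (Mr w l) by [].
  by apply/matrixP => i j; rewrite !mxE cImN mulrNN.
- move=> w l nl; split.
    exact: (weyl_holomorphic Om_compact s_flow H_cont H_sp Delta_cont Delta_sym Delta_pos T0 c0 step hp).
  apply: derivableN.
  exact: (weyl_holomorphic Om_compact rflow rcont rsp Delta_cont Delta_sym Delta_pos T0 c0 rstep hr).
- move=> w l e nl e0; apply: filterI.
    exact: (weyl_continuous Om_compact s_flow H_cont H_sp Delta_cont Delta_sym Delta_pos T0 c0 step hp).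
  have := weyl_continuous Om_compact rflow rcont rsp Delta_cont Delta_sym Delta_pos T0 c0 rstep hr w nl e0.
  by apply: filterS => p h i j; rewrite !mxE -opprD nsqN.
move=> l nl; have b0 : 0 < `|Im l| by rewrite normr_gt0.
split; last first.
  move=> w z; exact: (two_ended_decay Om_compact s_flow H_cont H_sp Delta_cont Delta_sym Delta_pos T0 c0 step nl).
have [K1 [C1 [b1 [K10 C10 b10 h1]]]] := weyl_plus_uniform Om_compact s_flow H_cont H_sp
  Delta_cont Delta_sym Delta_pos T0 c0 step b0 (nsq_ge0 l).
have [K2 [C2 [b2 [K20 C20 b20 h2]]]] := weyl_plus_uniform Om_compact rflow rcont rsp
  Delta_cont Delta_sym Delta_pos T0 c0 rstep b0 (nsq_ge0 l).
exists (K1 + K2), (C1 + C2), (Num.min b1 b2); split; rewrite ?addr_ge0 //.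
  by rewrite lt_min b10 b20.
have eb t (b : R) (Ci : R) : 0 <= t -> 0 <= Ci -> Ci <= C1 + C2 -> Num.min b1 b2 <= b ->
    Ci * expR (- b * t) <= (C1 + C2) * expR (- Num.min b1 b2 * t).
  move=> t0 Ci0 Cle ble; apply: ler_pM => //; rewrite ?expR_ge0 //.
  by rewrite ler_expR !mulNr lerN2 ler_wpM2r.
have [m1 m2] : Num.min b1 b2 <= b1 /\ Num.min b1 b2 <= b2 by rewrite !ge_min !lexx orbT.
move=> w z hz; split=> dz.
  have [g1 g2] := (h1 l w (Lam_self nl)).2 z hz dz; split.
    by apply: le_trans g1 _; rewrite ler_wpM2r ?sqn_ge0 // lerDl.
  move=> t t0; apply: le_trans (g2 t t0) _; rewrite ler_wpM2r ?sqn_ge0 //.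
  by apply: eb => //; rewrite lerDl.
have [g1 g2] := (h2 l w (Lam_self nl)).2 _ (rev_sol hz) ((decays_flip _).2 dz).
rewrite oppr0 /flip col_mxKu col_mxKd sqnN in g1; split.
  by apply: le_trans g1 _; rewrite ler_wpM2r ?sqn_ge0 // lerDr.
move=> t t0; have t0' : 0 <= - t by rewrite oppr_ge0.
have := g2 _ t0'; rewrite !sqn_flip opprK oppr0 => h; apply: le_trans h _.
rewrite ler_wpM2r ?sqn_ge0 //; apply: le_trans (eb _ _ _ t0' C20 _ m2) _.
  by rewrite lerDr.
by rewrite mulrNN.
Qed.

Variables Mp Mm : Om -> C -> 'M[C]_n.
Hypothesis hMM : two_sided_weyl Mp Mm.

Lemma col_basis_graph (M : 'M[C]_n) (V : set vec) :
  (forall z, V z <-> dsubmx z = M *m usubmx z) -> col_basis (col_mx 1%:M M) V.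
Proof.
move=> hV; split.
  apply/eqP; rewrite eqn_leq rank_leq_col /=.
  rewrite -[X in (X <= _)%N](@mxrank1 C n); apply: mxrankS.
  have := submxMl (row_mx 1%:M 0 : 'M[C]_(n, n + n)) (col_mx 1%:M M).
  by rewrite mul_row_col mul1mx mul0mx addr0.
apply/seteqP; split=> [z /hV hz|z [c _ <-]].
  by exists (usubmx z) => //; rewrite mul_col_mx mul1mx -hz vsubmxK.
by apply/hV; rewrite mul_col_mx mul1mx col_mxKu col_mxKd.
Qed.

Definition graph_bundle (M : Om -> 'M[C]_n) : set (Om * vec) :=
  [set p | dsubmx p.2 = M p.1 *m usubmx p.2].

Lemma graph_bundle_closed (M : Om -> 'M[C]_n) : continuous M ->
  closed_subbundle (graph_bundle M).
Proof.
move=> cM; have cMij i j (w : Om) : M w' i j @[w' --> w] --> M w i j.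
  by have /cvg_mx_entries := cM w; apply.
split; last first.
  move=> w0; exists n, setT, (fun w => col_mx 1%:M (M w)); split => //.
  - exact: openT.
  - apply: continuous_subspaceT => w; apply/cvg_mx_entries => i j.
    have [i' ->|i' ->] := split_ordP i.
      by under eq_fun do rewrite col_mxEu; rewrite col_mxEu; exact: cvg_cst.
    by under eq_fun do rewrite col_mxEd; rewrite col_mxEd; exact: cMij.
  by move=> w _; apply: col_basis_graph => z; split.
pose F i (p : Om * vec) : C := p.2 (rshift n i) 0 - \sum_j M p.1 i j * p.2 (lshift n j) 0.
have FE i p : F i p = (dsubmx p.2 - M p.1 *m usubmx p.2) i 0.
  have subE (a b : 'cV[C]_n) k : (a - b) k 0 = a k 0 - b k 0 by rewrite !mxE.
  rewrite subE [dsubmx _ _ _]mxE [(_ *m _) _ _]mxE.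
  by congr (_ - _); apply: eq_bigr => j _; rewrite [usubmx _ _ _]mxE.
have coord (k : 'I_(n + n)) (p : Om * vec) :
    (fun q : Om * vec => q.2 k 0 : C) @ nbhs p --> p.2 k 0.
  have : (fun q : Om * vec => q.2) @ nbhs p --> p.2 by exact: cvg_snd.
  by move/cvg_mx_entries; apply.
have cF i : continuous (F i).
  move=> p; apply: cvgB; first exact: coord.
  apply: cvg_big_sum => j _; apply: cvgM; last exact: coord.
  apply: (@cvg_comp _ _ _ fst (fun w => M w i j) _ (nbhs p.1)); [exact: cvg_fst | exact: cMij].
have -> : graph_bundle M = \bigcap_(i in [set: 'I_n]) (F i @^-1` [set 0]).
  apply/seteqP; split=> p /= h.
    by move=> i _ /=; rewrite FE h subrr mxE.
  apply/eqP; rewrite -subr_eq0; apply/eqP/matrixP => i j; rewrite ord1.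
  by rewrite -FE mxE; exact: h.
apply: closed_bigI => i _; apply: preimage_closed; first by move=> p _; exact: cF.
apply: accessible_closed_set1; apply: hausdorff_accessible; exact: norm_hausdorff.
Qed.

Lemma weyl_graph_sol w l z : exists y : R -> vec, y 0 = z /\ sol l w y.
Proof. exact: sol_exists. Qed.

Section FixedParameter.
Variable l : C.
Hypothesis nl : Im l != 0.
Variables (K C2 b : R).
Hypotheses (C2_ge0 : 0 <= C2) (b_gt0 : 0 < b).
Hypothesis decay : uniform_decay l K C2 b.
Hypothesis two_ended : forall w (z : R -> vec), sol l w z -> decays z ->
  decays (fun t => z (- t)) -> z 0 = 0.
Hypothesis Mp_cont : continuous (Mp ^~ l).
Hypothesis Mm_cont : continuous (Mm ^~ l).

Let Lp := graph_bundle (Mp ^~ l).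
Let Lm := graph_bundle (Mm ^~ l).

Lemma bundles_disjoint w z : Lp (w, z) -> Lm (w, z) -> z = 0.
Proof.
move=> zp zm; have [y [y0 hy]] := weyl_graph_sol w l z; have [hp hm] := hMM w nl.
rewrite -y0; apply: (two_ended hy); first by apply: (hp y hy).2; rewrite y0.
by apply: (hm y hy).2; rewrite y0.
Qed.

Lemma graph_bundleP (M : Om -> 'M[C]_n) w a :
  graph_bundle M (w, col_mx a (M w *m a)).
Proof. by rewrite /graph_bundle /= col_mxKu col_mxKd. Qed.

(** Two n-dimensional graphs that meet only in 0: the square matrix [B], whose columns span them, is
    injective, hence invertible. *)
Lemma bundles_sum w z : exists zp zm, [/\ Lp (w, zp), Lm (w, zm) & z = zp + zm].
Proof.
pose B : 'M[C]_(n + n) := block_mx 1%:M 1%:M (Mp w l) (Mm w l).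
have BE (a c : 'cV[C]_n) : B *m col_mx a c = col_mx a (Mp w l *m a) + col_mx c (Mm w l *m c).
  by rewrite mul_block_col !mul1mx add_col_mx.
have Bu : B \in unitmx.
  rewrite -unitmx_tr -row_free_unit -kermx_eq0; apply/negPn/negP => /rowV0Pn [v /sub_kermxP vD v0].
  have Bv : B *m v^T = 0 by rewrite -[LHS]trmxK trmx_mul trmxK vD trmx0.
  pose a := usubmx v^T; pose c := dsubmx v^T.
  have e : col_mx a (Mp w l *m a) + col_mx c (Mm w l *m c) = 0 by rewrite -BE vsubmxK.
  have e' : col_mx a (Mp w l *m a) = col_mx (- c) (Mm w l *m - c).
    by rewrite mulmxN -opp_col_mx; apply/eqP; rewrite -addr_eq0 e.
  have : col_mx a (Mp w l *m a) = 0.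
    apply: (@bundles_disjoint w); first exact: (graph_bundleP (Mp ^~ l)).
    by rewrite e'; exact: (graph_bundleP (Mm ^~ l)).
  move=> h; have h' := h; rewrite e' in h'.
  move: h h'; rewrite -[X in _ = X]col_mx0 => /eq_col_mx [a0 _].
  rewrite -[X in _ = X]col_mx0 => /eq_col_mx [c0 _].
  move: v0; rewrite -[v]trmxK -[v^T]vsubmxK -/a -/c a0.
  by rewrite -[c]opprK c0 oppr0 col_mx0 trmx0 eqxx.
pose y := invmx B *m z.
exists (col_mx (usubmx y) (Mp w l *m usubmx y)), (col_mx (dsubmx y) (Mm w l *m dsubmx y)).
split; [exact: (graph_bundleP (Mp ^~ l)) | exact: (graph_bundleP (Mm ^~ l)) |].
by rewrite -BE vsubmxK /y mulmxA mulmxV // mul1mx.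
Qed.

Lemma weyl_dichotomy_splitting : dichotomy_splitting s (A l) Lp Lm.
Proof.
have [U hU] : {U : Om -> R -> 'M[C]_(n + n) & forall w, U w 0 = 1%:M /\ sol l w (U w)}.
  apply: (@choice _ _ (fun w (U : R -> 'M[C]_(n + n)) => U 0 = 1%:M /\ sol l w U)) => w.
  exact: sol_exists.
have solU w (z : vec) : sol l w (fun t => U w t *m z) := linsolM z (hU w).2.
have U0 w (z : vec) : U w 0 *m z = z by rewrite (hU w).1 mul1mx.
have decp w z : Lp (w, z) -> decays (fun t => U w t *m z).
  by move=> hz; have [hp _] := hMM w nl; apply: (hp _ (solU w z)).2; rewrite U0.
have decm w z : Lm (w, z) -> decays (fun t => U w (- t) *m z).
  by move=> hz; have [_ hm] := hMM w nl; apply: (hm _ (solU w z)).2; rewrite U0.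
split.
- exact: (graph_bundle_closed Mp_cont).
- exact: (graph_bundle_closed Mm_cont).
- by move=> w; split=> [z|z]; [exact: bundles_sum | exact: bundles_disjoint].
exists (fun t w => U w t); split.
- by move=> w; have := hU w.
- move=> t w z /decp dz; have [hp _] := hMM (s t w) nl.
  have := (hp _ (sol_shift s_flow t (solU w z))).1; rewrite /= add0r; apply.
  move=> e e0; have [t0 ht] := dz e e0; exists (t0 - t) => u; rewrite lerBlDr.
  exact: ht.
- move=> t w z /decm dz; have [_ hm] := hMM (s t w) nl.
  have := (hm _ (sol_shift s_flow t (solU w z))).1; rewrite /= add0r; apply.
  move=> e e0; have [t0 ht] := dz e e0; exists (t0 + t) => u; rewrite -lerBrDr.
  by move=> /ht; rewrite opprB addrC.
have eta2 (x : R) : C2 * expR (2 * x) <= ((C2 + 1) * expR x) ^+ 2.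
  rewrite exprMn -expRM_natl ler_wpM2r ?expR_ge0 //.
  by apply: (@le_trans _ _ (C2 + 1)); rewrite ?lerDl // ler_eXnr // lerDr.
have C21 : 0 <= C2 + 1 by rewrite addr_ge0.
(* [decay] bounds squared norms: the rate is halved, and [C2 + 1] is at least 1 with a square at
   least [C2]. *)
exists (C2 + 1), (b / 2); split.
- by rewrite lerDr.
- by rewrite divr_gt0.
- move=> t w z t0 /decp dz; apply/enorm_le; first by rewrite mulr_ge0 // expR_ge0.
  have [_ /(_ t t0)] := (decay (solU w z)).1 dz; rewrite U0 => h; apply: le_trans h _.
  rewrite ler_wpM2r ?sqn_ge0 //; apply: le_trans (eta2 _).
  by have -> : 2 * (- (b / 2) * t) = - b * t by field.
move=> t w z t0 /decm dz; apply/enorm_le; first by rewrite mulr_ge0 // expR_ge0.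
have [_ /(_ t t0)] := (decay (solU w z)).2 dz; rewrite U0 => h; apply: le_trans h _.
rewrite ler_wpM2r ?sqn_ge0 //; apply: le_trans (eta2 _).
by have -> : 2 * (b / 2 * t) = b * t by field.
Qed.

(** The bundles of an arbitrary splitting consist of decaying solutions, so they lie in the graph
    bundles; since they already span the space and the graph bundles meet only in 0, they are equal
    to them. *)
Lemma weyl_functions_two_sided : weyl_functions s (A l) (Mp ^~ l) (Mm ^~ l).
Proof.
split; first by exists Lp, Lm; exact: weyl_dichotomy_splitting.
move=> Lp' Lm' [sp sm ws [U [fU ip im [eta [beta [eta1 beta0 hp hm]]]]]] w.
have eta0 : 0 <= eta by apply: le_trans eta1.
have b2 : 0 < 2 * beta by rewrite mulr_gt0.
have [U0 hU] := fU w; have [wp wm] := hMM w nl.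
have inp z : fiber Lp' w z -> Lp (w, z).
  move=> hz; have := (wp _ (linsolM z hU)).1; rewrite /= U0 mul1mx; apply.
  apply: (@exp_decays _ _ _ (eta ^+ 2 * sqn z) _ b2) => t t0.
  have q0 : 0 <= eta * expR (- beta * t) by rewrite mulr_ge0 // expR_ge0.
  have := (enorm_le _ _ q0).1 (hp t w z t0 hz); rewrite exprMn -expRM_natl.
  have -> : 2 * (- beta * t) = - (2 * beta) * t by ring.
  by rewrite mulrAC.
have inm z : fiber Lm' w z -> Lm (w, z).
  move=> hz; have := (wm _ (linsolM z hU)).1; rewrite /= U0 mul1mx; apply.
  apply: (@exp_decays _ _ _ (eta ^+ 2 * sqn z) _ b2) => t t0.
  have q0 : 0 <= eta * expR (beta * - t) by rewrite mulr_ge0 // expR_ge0.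
  have t0' : - t <= 0 by rewrite oppr_le0.
  have := (enorm_le _ _ q0).1 (hm (- t) w z t0' hz); rewrite exprMn -expRM_natl.
  have -> : 2 * (beta * - t) = - (2 * beta) * t by ring.
  by rewrite mulrAC.
split; apply: col_basis_graph => z.
  split=> [|hz]; first exact: inp.
  have [zp [zm [hzp hzm e]]] := (ws w).1 z.
  have d : zm = 0.
    apply: (@bundles_disjoint w); last exact: inm.
    have -> : zm = z - zp by rewrite e addrC addKr.
    have := inp _ hzp; rewrite /Lp /graph_bundle /= => hp'.
    have uB : usubmx (z - zp) = usubmx z - usubmx zp by apply/matrixP => i j; rewrite !mxE.
    have dB : dsubmx (z - zp) = dsubmx z - dsubmx zp by apply/matrixP => i j; rewrite !mxE.
    by rewrite uB dB hz hp' mulmxBr.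
  by rewrite e d addr0.
split=> [|hz]; first exact: inm.
have [zp [zm [hzp hzm e]]] := (ws w).1 z.
have d : zp = 0.
  apply: (@bundles_disjoint w); first exact: inp.
  have -> : zp = z - zm by rewrite e addrK.
  have := inm _ hzm; rewrite /Lm /graph_bundle /= => hm'.
  have uB : usubmx (z - zm) = usubmx z - usubmx zm by apply/matrixP => i j; rewrite !mxE.
  have dB : dsubmx (z - zm) = dsubmx z - dsubmx zm by apply/matrixP => i j; rewrite !mxE.
  by rewrite uB dB hz hm' mulmxBr.
by rewrite e d add0r.
Qed.

End FixedParameter.

(** * Failure of the Atkinson condition *)

(** The omega-limit set of [w] is a nonempty compact invariant part of [M], hence all of [M], and
    [D] vanishes on it by continuity. *)
Lemma minimal_vanishing (M : set Om) (D : Om -> C) w : minimal_set s M -> M w ->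
  continuous D ->
  (forall e : R, 0 < e -> exists t0, forall t, t0 <= t -> nsq (D (s t w)) < e) ->
  forall w', M w' -> D w' = 0.
Proof.
move=> [_ Mc Mi Mmin] Mw cD hD.
pose F := (fun t : R => s t w) @ +oo%R.
have MF : F M.
  exists 0; split => // t _ /=; rewrite -(Mi t); exact: imageP.
pose K := M `&` cluster F.
have cs t : continuous (s t).
  move=> w1; have [c _ _] := s_flow.
  apply: (@continuous_comp _ _ _ (fun v : Om => (t, v)) (fun p => s p.1 p.2)).
    exact: (@cvg_pair _ _ _ (nbhs w1) (nbhs t) (nbhs w1) _ _ _ (fun=> t) (fun u => u) (cvg_cst t) cvg_id).
  exact: c.
have K0 : K !=set0 by exact: Mc MF.
have Kc : compact K.
  by apply: compact_closedI => //; rewrite clusterE; apply: closed_bigI => ? ?; exact: closed_closure.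
have Kin t v : K v -> K (s t v).
  move=> [Mv cv]; split; first by rewrite -(Mi t); exact: imageP.
  move=> P Q [t0 [_ hP]] hQ.
  have hQ' : nbhs v (s t @^-1` Q) by exact: cs.
  have hP' : F [set u | exists2 r, t0 < r + t & u = s r w].
    exists (t0 - t); split; first exact: num_real.
    by move=> r /= tr; exists r => //; rewrite -ltrBlDr.
  have [u [[r tr ->] Qu]] := cv _ _ hP' hQ'.
  exists (s t (s r w)); split => //.
  by rewrite -(flowD s_flow) addrC; exact: hP.
have Ki : flow_invariant s K.
  move=> t; apply/seteqP; split=> [_ [v Kv <-]|v Kv]; first exact: Kin.
  exists (s (- t) v); first exact: Kin.
  by rewrite -(flowD s_flow) subrr (flow0 s_flow).
have KM : K = M by apply: Mmin => //; exact: subIsetl.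
move=> w' Mw'; have [_ cw] : K w' by rewrite KM.
apply: nsq_eq0; apply/eqP; rewrite eq_le nsq_ge0 andbT leNgt; apply/negP => p0.
have e0 : 0 < nsq (D w') / 8 by rewrite divr_gt0.
have [t0 ht] := hD _ e0.
have hP : F [set u | nsq (D u) < nsq (D w') / 8].
  exists t0; split; first exact: num_real.
  by move=> t /ltW /ht.
have hQ : nbhs w' [set u | nsq (D u - D w') < nsq (D w') / 8].
  by have /cvgC_nsqP := cD w'; apply.
have [u [/= h1 h2]] := cw _ _ hP hQ.
have e : D u + (D w' - D u) = D w' by rewrite addrC subrK.
have := nsqD (D u) (D w' - D u); rewrite e; rewrite nsqB in h2; lra.
Qed.

Lemma continuous_integral_gt0 (f : R -> R) (t0 : R) : continuous f ->
  (forall t, 0 <= f t) -> 0 < f t0 ->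
  (0 < \int[lebesgue_measure]_t (f t)%:E)%E.
Proof.
move=> cf f0 ft.
have e0 : 0 < f t0 / 2 by rewrite divr_gt0.
have [d d0 hd] : exists2 d : R, 0 < d & forall t, `|t0 - t| < d -> f t0 / 2 <= f t.
  have /cvgrPdist_lt/(_ _ e0) := cf t0.
  move=> /nbhs_ballP [d d0 h]; exists d => // t /h /=.
  by rewrite ltr_norml => /andP[_]; lra.
pose I := `](t0 - d), (t0 + d)[%classic.
have mI : measurable I by exact: measurable_itv.
have mf := (measurable_EFinP setT f).2 (continuous_measurable_fun cf).
apply: (@lt_le_trans _ _ (\int[lebesgue_measure]_(t in I) (f t0 / 2)%:E)%E).
  have lI : lebesgue_measure I = (d + d)%:E.
    rewrite /I; etransitivity; first exact: lebesgue_measure_itv.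
    rewrite /= lte_fin; have -> : t0 - d < t0 + d by lra.
    by rewrite -EFinB; congr EFin; ring.
  rewrite integral_cst //; apply: (@lt_le_trans _ _ ((f t0 / 2)%:E * (d + d)%:E)%E).
    by rewrite -EFinM lte_fin mulr_gt0 // addr_gt0.
  by rewrite -lI.
apply: (@le_trans _ _ (\int[lebesgue_measure]_(t in I) (f t)%:E)%E).
  apply: ge0_le_integral => //.
  - by move=> t _; rewrite lee_fin ltW.
  - exact: (measurable_funS measurableT (@subsetT _ I) mf).
  move=> t; rewrite /I /= in_itv /= => /andP[t1 t2]; rewrite lee_fin; apply: hd.
  by rewrite ltr_norml; apply/andP; split; lra.
by apply: ge0_subset_integral => // t _; rewrite lee_fin.
Qed.

Section Orbit.
Hypothesis Mp_cont : forall l, Im l != 0 -> continuous (Mp ^~ l).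
Hypothesis Mm_cont : forall l, Im l != 0 -> continuous (Mm ^~ l).
Hypothesis decay : forall l, Im l != 0 ->
  exists K C2 b, [/\ 0 <= K, 0 <= C2, 0 < b & uniform_decay l K C2 b].
Hypothesis two_ended : forall l, Im l != 0 -> forall w (z : R -> vec), sol l w z ->
  decays z -> decays (fun t => z (- t)) -> z 0 = 0.

Lemma toC_hamiltonian w : toC (H w) = A 0 w.
Proof.
have [_ _ h4] := in_sp_blocks (H_sp w).
rewrite /hamiltonian_family scale0r addr0 -[in LHS](submxK (H w)) h4.
rewrite /toC map_block_mx; congr block_mx.
by apply/matrixP => i j; rewrite !mxE rmorphN.
Qed.

Lemma sol_indep l m w (z : R -> vec) : (forall t, dsubmx (z t) = 0) ->
  sol l w z -> sol m w z.
Proof.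
move=> z2 hz t; have := hz t; congr is_tderive.
by rewrite !hamiltonian_mulmx z2 !mulmx0 !scaler0.
Qed.

Lemma sol_nonzero l w (z : R -> vec) t : sol l w z -> z 0 != 0 -> z t != 0.
Proof.
move=> hz; apply: contra => /eqP zt.
have := sol_zero Om_compact H_cont Delta_cont (- t) (sol_shift s_flow t hz).
by rewrite add0r addNr => /(_ zt) ->.
Qed.

Lemma det_cvg (M : Om -> 'M[C]_n) : continuous M -> continuous (fun w => \det (M w)).
Proof. by move=> cM w; apply: cvg_det => i j; have /cvg_mx_entries := cM w; apply. Qed.

Lemma mx_nsq_bounded m k (M : Om -> 'M[C]_(m, k)) :
  (forall i j, continuous (fun w => M w i j)) ->
  exists2 c : R, 0 <= c & forall w i j, nsq (M w i j) <= c.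
Proof.
move=> cM.
have cr i j : continuous (fun w => (map_mx Re (M w)) i j).
  have -> : (fun w => (map_mx Re (M w)) i j) = (fun w => Re (M w i j)).
    by apply/funext => w; rewrite mxE.
  by move=> w; exact: ((cvgC_ReIm _ _ _).1 (cM i j w)).1.
have ci i j : continuous (fun w => (map_mx Im (M w)) i j).
  have -> : (fun w => (map_mx Im (M w)) i j) = (fun w => Im (M w i j)).
    by apply/funext => w; rewrite mxE.
  by move=> w; exact: ((cvgC_ReIm _ _ _).1 (cM i j w)).2.
have [a a0 ha] := mx_bounded Om_compact cr; have [b b0 hb] := mx_bounded Om_compact ci.
exists (a ^+ 2 + b ^+ 2) => [|w i j]; first by rewrite addr_ge0 ?sqr_ge0.
have := ha w i j; have := hb w i j; rewrite !mxE => h1 h2; rewrite /nsq.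
rewrite -[X in X + _]real_normK ?num_real // -[X in _ + X]real_normK ?num_real //.
by rewrite lerD // ler_sqr ?nnegrE.
Qed.

Lemma det_eq0_of_kernel (M : 'M[C]_n) (v : 'cV[C]_n) : v != 0 -> M *m v = 0 -> \det M = 0.
Proof.
move=> v0 Mv; have : \det M *: v = 0.
  by rewrite -mul_scalar_mx -mul_adj_mx -mulmxA Mv mulmx0.
by move/eqP; rewrite scaler_eq0 (negbTE v0) orbF => /eqP.
Qed.

(** If [z] does not decay, split it as [yp + ym] with [ym] nonzero. From z2 = 0 follows M^- x = (M^-
    - M^+) b, where [x] and [b] are the first components of [z] and [yp]. Multiplying by the
    adjugate of M^- gives det(M^-) x on the left, and [b] tends to 0 while [x] stays away from 0. *)
Lemma det_decay w (z : R -> vec) : sol 0 w z -> (forall t, dsubmx (z t) = 0) ->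
  z 0 != 0 ->
  (forall l t, Im l != 0 -> \det (Mp (s t w) l) = 0) \/
  (forall l, Im l != 0 -> forall e : R, 0 < e -> exists t0, forall t, t0 <= t ->
      nsq (\det (Mm (s t w) l)) < e).
Proof.
move=> hz z2 z0.
have usub0 t : usubmx (z t) != 0.
  apply: contra (sol_nonzero t hz z0) => /eqP h.
  by rewrite -[z t]vsubmxK h z2 col_mx0.
(* The case distinction concerns [z] alone, which solves the family for every [l]; hence one
   alternative holds for all parameters. *)
have [dz|ndz] := pselect (decays z); [left|right].
  move=> l t nl; apply: (det_eq0_of_kernel (usub0 t)).
  have hzt := sol_shift s_flow t (sol_indep l z2 hz).
  have [hp _] := hMM (s t w) nl.
  have := (hp _ hzt).1; rewrite /= add0r z2 => -> //.
  move=> e e0; have [t0 ht] := dz e e0; exists (t0 - t) => u; rewrite lerBlDr.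
  exact: ht.
move=> l nl e e0.
have hzl := sol_indep l z2 hz.
have [K [C2 [b [K0 C20 b0 dec]]]] := decay nl.
have [zp [zm [hzp hzm zE]]] := bundles_sum nl (two_ended nl) w (z 0).
have [yp [yp0 hyp]] := weyl_graph_sol w l zp.
have [ym [ym0 hym]] := weyl_graph_sol w l zm.
have [hp hm] := hMM w nl.
have dyp : decays yp by apply: (hp _ hyp).2; rewrite yp0.
have dym : decays (fun t => ym (- t)) by apply: (hm _ hym).2; rewrite ym0.
have zsum t : z t = yp t + ym t.
  apply: (sol_unique Om_compact H_cont Delta_cont hzl (linsolD hyp hym)).
  by rewrite yp0 ym0.
have zm0 : zm != 0.
  apply/negP => /eqP zm0; apply: ndz.
  have e1 t : z t = yp t.
    by rewrite zsum (sol_zero Om_compact H_cont Delta_cont t hym) ?addr0 // ym0.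
  by move=> d d0; have [t0 ht] := dyp d d0; exists t0 => t; rewrite e1; exact: ht.
(* The adjugate replaces the inverse, since M^- may be singular; its continuity gives bounds along
   the whole orbit. *)
have cadj i j : continuous (fun w => (\adj (Mm w l) *m (Mm w l - Mp w l)) i j).
  have cM (M : Om -> 'M[C]_n) : continuous M -> forall i j, continuous (fun v => M v i j).
    by move=> cM i' j' w'; have /cvg_mx_entries := cM w'; apply.
  have -> : (fun w => (\adj (Mm w l) *m (Mm w l - Mp w l)) i j) =
      (fun w => \sum_k \adj (Mm w l) i k * (Mm w l k j - Mp w l k j)).
    apply/funext => v; rewrite [LHS]mxE; apply: eq_bigr => k _; congr (_ * _).
    by rewrite !mxE.
  move=> w'; apply: cvg_big_sum => k _; apply: cvgM.
    by apply: cvg_adj => i' j'; exact: (cM _ (Mm_cont nl)).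
  by apply: cvgB; [exact: (cM _ (Mm_cont nl)) | exact: (cM _ (Mp_cont nl))].
have [c c0 hc] := mx_nsq_bounded cadj.
pose x t := usubmx (z t); pose bb t := usubmx (yp t).
have decp t : decays (fun u => yp (u + t)).
  by move=> d d0; have [t0 ht] := dyp d d0; exists (t0 - t) => u; rewrite lerBlDr; exact: ht.
have decm t : decays (fun u => ym (- u + t)).
  move=> d d0; have [t0 ht] := dym d d0; exists (t0 + t) => u; rewrite -lerBrDr.
  by move=> /ht; rewrite opprB addrC.
have gp t : dsubmx (yp t) = Mp (s t w) l *m bb t.
  have [hpt _] := hMM (s t w) nl.
  by have := (hpt _ (sol_shift s_flow t hyp)).1 (decp t); rewrite add0r.
have gm t : dsubmx (ym t) = Mm (s t w) l *m usubmx (ym t).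
  have [_ hmt] := hMM (s t w) nl.
  by have := (hmt _ (sol_shift s_flow t hym)).1 (decm t); rewrite add0r.
have key t : nsq (\det (Mm (s t w) l)) * sqn (x t) <= (n * n)%:R * c * sqn (bb t).
  have um : usubmx (ym t) = x t - bb t.
    by rewrite /x /bb zsum; apply/matrixP => i j; rewrite !mxE addrC addKr.
  have sum0 : Mp (s t w) l *m bb t + Mm (s t w) l *m (x t - bb t) = 0.
    rewrite -um -gp -gm -(z2 t) zsum.
    by apply/matrixP => i j; rewrite !mxE.
  have e1 : Mm (s t w) l *m x t = (Mm (s t w) l - Mp (s t w) l) *m bb t.
    move: sum0; rewrite mulmxBr addrC -addrA => /eqP; rewrite addr_eq0 opprD opprK.
    by rewrite mulmxBl => /eqP.
  have -> : nsq (\det (Mm (s t w) l)) * sqn (x t) =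
      sqn ((\adj (Mm (s t w) l) *m (Mm (s t w) l - Mp (s t w) l)) *m bb t).
    by rewrite -mulmxA -e1 mulmxA mul_adj_mx mul_scalar_mx sqnZ.
  by apply: sqn_mulmx => i j; exact: hc.
pose k := C2 + 1; have k0 : 0 < k by rewrite ltr_wpDl.
have szm : 0 < sqn zm.
  by rewrite lt0r sqn_ge0 andbT; apply: contra zm0 => /eqP/sqn_eq0 ->.
(* |ym(t)|^2 will be at least [4 * x0]; once |yp(t)|^2 is below [x0], the inequality for squared
   norms of a difference leaves |z(t)|^2 above [x0]. *)
pose x0 := sqn zm / k / 4; have x00 : 0 < x0 by rewrite !divr_gt0.
(* The backward decay of [ym] from time [t] to time 0 bounds its value at [t] from below. *)
have low t : 0 <= t -> sqn zm / k <= sqn (ym t).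
  move=> t0; rewrite ler_pdivrMr // mulrC.
  have [_ hmt] := dec _ _ (sol_shift s_flow t hym).
  have [_ g] := hmt (decm t); have := g (- t) _; rewrite oppr_le0 => /(_ t0).
  rewrite /= addNr add0r ym0 => h; apply: le_trans h _.
  rewrite ler_wpM2r ?sqn_ge0 //; apply: (@le_trans _ _ C2); last by rewrite lerDl.
  rewrite ler_piMr // -expR0 ler_expR mulrN oppr_le0 mulr_ge0 //; exact: ltW.
have ypb t : 0 <= t -> sqn (yp t) <= C2 * sqn zp * expR (- b * t).
  by move=> t0; have [_ g] := (dec w yp hyp).1 dyp; have := g t t0; rewrite yp0 mulrAC.
have [t1 [_ t10 h1]] := exp_small (C2 * sqn zp) 0 b0 x00.
have [t2 [_ t20 h2]] := exp_small ((n * n)%:R * c * (C2 * sqn zp)) 0 b0 (mulr_gt0 e0 x00).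
have mono u t (k' : R) : 0 <= k' -> u <= t -> k' * expR (- b * t) <= k' * expR (- b * u).
  by move=> k'0 ut; rewrite ler_wpM2l // ler_expR !mulNr lerN2 ler_wpM2l // ltW.
exists (Num.max t1 t2) => t; rewrite ge_max => /andP[tt1 tt2].
have t0 : 0 <= t := le_trans t10 tt1.
have Czp : 0 <= C2 * sqn zp by rewrite mulr_ge0 ?sqn_ge0.
have s1 : sqn (yp t) < x0.
  by apply: le_lt_trans (ypb t t0) (le_lt_trans (mono t1 t _ Czp tt1) h1).
have s2 : x0 < sqn (x t).
  have -> : sqn (x t) = sqn (z t) by rewrite (sqn_split (z t)) z2 sqn0 addr0.
  have := sqnB (z t) (yp t); have -> : z t - yp t = ym t by rewrite zsum addrC addKr.
  have := low t t0; have -> : sqn zm / k = 4 * x0 by rewrite /x0; field; exact: lt0r_neq0.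
  lra.
have xp : 0 < sqn (x t) := lt_trans x00 s2.
rewrite -(ltr_pM2r xp); apply: le_lt_trans (key t) _.
apply: (@lt_trans _ _ (e * x0)); last by rewrite ltr_pM2l.
apply: le_lt_trans _ h2.
have p0 : 0 <= (n * n)%:R * c by rewrite mulr_ge0.
apply: (@le_trans _ _ ((n * n)%:R * c * (C2 * sqn zp) * expR (- b * t))); last first.
  by apply: mono => //; rewrite mulr_ge0.
rewrite -[X in _ <= X]mulrA ler_wpM2l //; apply: le_trans (ypb t t0).
by rewrite [X in _ <= X]sqn_split lerDl sqn_ge0.
Qed.

Lemma integrand_continuous w (z : R -> vec) : sol 0 w z ->
  continuous (fun t => sqn (toC (Delta (s t w)) *m dsubmx (z t))).
Proof.
move=> hz t; rewrite /sqn; apply: cvg_big_sum => i _.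
have cz j : (fun u => z u j 0 : C) @ nbhs t --> z t j 0.
  apply/cvgC_ReIm; have [a a'] := hz t j 0.
  by split; [exact: rderiv_continuous a | exact: rderiv_continuous a'].
have cD j : (fun u => toC (Delta (s u w)) i j : C) @ nbhs t --> toC (Delta (s t w)) i j.
  rewrite toCE; under eq_fun do rewrite toCE.
  apply/cvgC_ReIm; split => /=; last exact: cvg_cst.
  apply: (@continuous_comp _ _ _ (s ^~ w) (fun w => Delta w i j)).
    exact: flow_orbit_continuous.
  exact: mx_continuous_entry.
have : (fun u => \sum_j toC (Delta (s u w)) i j * z u (rshift n j) 0 : C) @ nbhs t
    --> \sum_j toC (Delta (s t w)) i j * z t (rshift n j) 0.
  by apply: cvg_big_sum => j _; apply: cvgM; [exact: cD | exact: cz].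
have e u : (toC (Delta (s u w)) *m dsubmx (z u)) i 0 =
    \sum_j toC (Delta (s u w)) i j * z u (rshift n j) 0.
  by rewrite mxE; apply: eq_bigr => j _; rewrite [dsubmx _ _ _]mxE.
rewrite e; under [X in _ -> X @ _ --> _]eq_fun do rewrite e.
move/cvgC_ReIm => [a a']; rewrite /nsq.
by apply: cvgD; apply: cvgM.
Qed.

Lemma atkinson_failure : ~ atkinson_condition s H Delta ->
  exists2 M : set Om, minimal_set s M &
    (forall w l, M w -> Im l != 0 -> \det (Mp w l) = 0) \/
    (forall w l, M w -> Im l != 0 -> \det (Mm w l) = 0).
Proof.
move=> nA; apply: contrapT => nM; apply: nA => M Mmin; apply: contrapT => nw.
apply: nM; exists M => //; have [[w Mw] _ _ _] := Mmin.
have [z [hz z0 zint]] : exists z : R -> vec, [/\ sol 0 w z, z 0 != 0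
    & ~ (0 < \int[lebesgue_measure]_t
       ((enorm (toC (Delta (s t w)) *m dsubmx (z t))) ^+ 2)%:E)%E].
  apply: contrapT => nz; apply: nw; exists w => // z0 z00 z hz ez.
  apply: contrapT => nint; apply: nz; exists z; split => //; last by rewrite ez.
  move=> t; have := hz t; congr is_tderive; by rewrite toC_hamiltonian.
(* The integrand is continuous and nonnegative, so a nonpositive integral makes [Delta] z2 vanish at
   every time; coercivity of [Delta] then gives z2 = 0. *)
have z2 t : dsubmx (z t) = 0.
  have Dz : toC (Delta (s t w)) *m dsubmx (z t) = 0.
    apply: sqn_le0; rewrite leNgt; apply/negP => p0; apply: zint.
    under eq_integral do rewrite sqr_enorm.
    apply: (continuous_integral_gt0 (integrand_continuous hz) _ p0) => u.
    exact: sqn_ge0.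
  have [c c0 hc] := Delta_coercive Om_compact Delta_cont Delta_pos.
  apply: sqn_le0; apply: le_trans (hc (s t w) _) _.
  by rewrite /dform -mulmxA Dz mulmx0 mxE mulr0.
have [hd|hd] := det_decay hz z2 z0; [left|right] => w' l Mw' nl.
  apply: (minimal_vanishing (D := fun w => \det (Mp w l)) Mmin Mw) => //.
    exact: det_cvg (Mp_cont nl).
  by move=> e e0; exists 0 => t _; rewrite hd // nsq0.
apply: (minimal_vanishing (D := fun w => \det (Mm w l)) Mmin Mw) => //.
  exact: det_cvg (Mm_cont nl).
exact: hd.
Qed.

End Orbit.

End BothWeylFunctions.

Lemma possemidef_scaled (R : realType) n (c : R) (M : 'M[R]_n) : possemidef (c *: M) ->
  (0 < c -> possemidef M) /\ (c < 0 -> possemidef (- M)).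
Proof.
move=> [Ms Mp].
have q x : (x^T *m (c *: M) *m x) 0 0 = c * (x^T *m M *m x) 0 0.
  by rewrite -scalemxAr -scalemxAl mxE.
have sym : c != 0 -> M^T = M.
  move=> c0; apply: (scalerI c0); rewrite -[RHS]Ms.
  by apply/matrixP => i j; rewrite !mxE.
split=> c0; split.
- by apply: sym; rewrite gt_eqF.
- by move=> x; have := Mp x; rewrite q pmulr_rge0.
- by rewrite linearN /= sym // lt_eqF.
move=> x; have := Mp x; rewrite q nmulr_rge0 // => h.
by rewrite mulmxN mulNmx mxE oppr_ge0.
Qed.

(** [Mp] and [Mm] are quantified once, so that the determinants in (iii) are those of the Weyl
    functions in (ii); their values at real parameters are arbitrary. *)
Theorem theorem3p6 (R : realType) (Om : metricType R) (s : R -> Om -> Om)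
  (n : nat) (H : Om -> 'M[R]_(n + n)) (Delta : Om -> 'M[R]_n)
  (Om_compact : compact [set: Om]) (s_flow : continuous_flow s)
  (H_cont : continuous H) (H_sp : forall w, in_sp (H w))
  (Delta_cont : continuous Delta) (Delta_sym : forall w, (Delta w)^T = Delta w)
  (Delta_pos : forall w, posdef (Delta w))
  (l0 : R[i]) (l0_ed : exp_dichotomy s (hamiltonian_family H Delta l0)) :
  (* (i) *)
  (forall l : R[i], complex.Im l != 0 ->
     exp_dichotomy s (hamiltonian_family H Delta l)) /\
  exists Mp Mm : Om -> R[i] -> 'M[R[i]]_n,
  (* (ii) *)
  [/\ forall l : R[i], complex.Im l != 0 ->
        weyl_functions s (hamiltonian_family H Delta l) (Mp ^~ l) (Mm ^~ l),
      forall w (l : R[i]), complex.Im l != 0 ->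
        (Mp w l)^T = Mp w l /\ (Mm w l)^T = Mm w l,
      {within [set p : Om * R[i] | complex.Im p.2 != 0],
         continuous (fun p => Mp p.1 p.2)} /\
      {within [set p : Om * R[i] | complex.Im p.2 != 0],
         continuous (fun p => Mm p.1 p.2)},
      forall w (l : R[i]), complex.Im l != 0 ->
        possemidef (complex.Im l *: mxIm (Mp w l)) /\
        possemidef (- complex.Im l *: mxIm (Mm w l))
    & forall w,
        [/\ holomorphic_on (@nonreal R) (Mp w), holomorphic_on (@nonreal R) (Mm w),
            herglotz (@Cplus R) (Mp w) /\ herglotz (@Cminus R) (Mp w)
          & herglotz (@Cplus R) (Mm w) /\ herglotz (@Cminus R) (Mm w)]] /\
  (* (iii) *)
  (~ atkinson_condition s H Delta ->
   exists2 M : set Om, minimal_set s M &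
     ((forall w (l : R[i]), M w -> complex.Im l != 0 -> \det (Mp w l) = 0) \/
      (forall w (l : R[i]), M w -> complex.Im l != 0 -> \det (Mm w l) = 0))).
Proof.
have [Mp [Mm [hMM hsym hhol hcont hdec]]] := weyl_both Om_compact s_flow H_cont
  H_sp Delta_cont Delta_sym Delta_pos l0_ed.
have slice (l : R[i]) (P : set (Om * R[i])) (w : Om) : (\forall p \near (w, l), P p) ->
    \forall w' \near w, P (w', l).
  case=> -[P1 P2] /= [h1 h2] h12; apply: filterS h1 => w' Pw'.
  by apply: h12; split => //=; exact: (nbhs_singleton h2).
have Mp_cont l : complex.Im l != 0 -> continuous (Mp ^~ l).
  move=> nl w; apply/cvg_mx_nsqP => e e0.
  by apply: filterS (slice _ _ _ (hcont w l e nl e0)) => w' [].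
have Mm_cont l : complex.Im l != 0 -> continuous (Mm ^~ l).
  move=> nl w; apply/cvg_mx_nsqP => e e0.
  by apply: filterS (slice _ _ _ (hcont w l e nl e0)) => w' [].
have hweyl l : complex.Im l != 0 ->
    weyl_functions s (hamiltonian_family H Delta l) (Mp ^~ l) (Mm ^~ l).
  move=> nl; have [[K [C2 [b [_ C20 b0 dec]]]] two] := hdec l nl.
  exact: (weyl_functions_two_sided Om_compact s_flow H_cont Delta_cont hMM nl C20 b0
    dec two (Mp_cont l nl) (Mm_cont l nl)).
split; first by move=> l nl; have [] := hweyl l nl.
exists Mp, Mm; split; last first.
  apply: (atkinson_failure Om_compact s_flow H_cont H_sp Delta_cont Delta_pos hMM
    Mp_cont Mm_cont) => l nl; by have [] := hdec l nl.
have Im0 (l : R[i]) : 0 < complex.Im l -> complex.Im l != 0 by move=> h; rewrite gt_eqF.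
have Im0' (l : R[i]) : complex.Im l < 0 -> complex.Im l != 0 by move=> h; rewrite lt_eqF.
split.
- exact: hweyl.
- by move=> w l nl; have [] := hsym w l nl.
- split; apply: continuous_in_subspaceT => -[w l]; rewrite inE /= => nl;
    apply/cvg_mx_nsqP => e e0; by apply: filterS (hcont w l e nl e0) => p [].
- by move=> w l nl; have [_ _ hp hm] := hsym w l nl.
move=> w; split.
- by move=> l nl; have [] := hhol w l nl.
- by move=> l nl; have [] := hhol w l nl.
- split; split; [ | | left | | | right] => l il.
  + by have [] := hsym w l (Im0 _ il).
  + by have [] := hhol w l (Im0 _ il).
  + by have [_ _ /possemidef_scaled [h _] _] := hsym w l (Im0 _ il); exact: h.
  + by have [] := hsym w l (Im0' _ il).
  + by have [] := hhol w l (Im0' _ il).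
  by have [_ _ /possemidef_scaled [_ h] _] := hsym w l (Im0' _ il); exact: h.
split; split; [ | | right | | | left] => l il.
+ by have [] := hsym w l (Im0 _ il).
+ by have [] := hhol w l (Im0 _ il).
+ have [_ _ _ /possemidef_scaled [_ h]] := hsym w l (Im0 _ il).
  by apply: h; rewrite oppr_lt0.
+ by have [] := hsym w l (Im0' _ il).
+ by have [] := hhol w l (Im0' _ il).
have [_ _ _ /possemidef_scaled [h _]] := hsym w l (Im0' _ il).
by apply: h; rewrite oppr_gt0.
Qed.
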